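(* Subset Sum $\in \mathsf{AM}\left[n/4,\ O^*(2^{n/4})\right]$: there is an Arthur–Merlin protocol for Subset Sum on $n$ integers in which the proof has length at most $n/4$ bits and the deterministic verification takes time $O^*(2^{n/4})$, with the acceptance guarantees of the class $\mathsf{AM}$ (yes-instances accepted with probability at least $2/3$ for a suitable proof, no-instances rejected with probability $1$ for every proof).
   Context: Subset Sum: given a set $I$ of $n$ integers, each of absolute value at most $2^{O(n)}$, and a target integer $t$, decide whether some subset $S\subseteq I$ satisfies $\sum_{a\in S}a=t$. A language $L$ belongs to $\mathsf{AM}[s(n),t(n)]$ if there is an Arthur–Merlin protocol (shared public random string; the prover, after seeing it, sends a proof; the verifier is deterministic) such that for inputs of length parameter $n$ the proof length is at most $s(n)$, the verification time is at most $t(n)$, every $x\in L$ is accepted (for a suitable proof) with probability at least $2/3$ over the shared randomness, and every $x\notin L$ is rejected for every proof with probability $1$. $O^*(\cdot)$ hides factors polynomial in the input size. *)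

(* Defs.v *)
(* A concrete machine model: a logarithmic-cost RAM over Z
   (addition, subtraction, comparison, indirect addressing), which is
   polynomially equivalent to Turing machines, so O^*(.) time bounds are
   model-independent. *)
From Stdlib Require Import ZArith List Arith Lia.
Import ListNotations.

Inductive instr : Type :=
| IConst (d : nat) (z : Z)
| IAdd (d a b : nat)
| ISub (d a b : nat)
| ILoad (d a : nat)
| IStore (a s : nat)
| IJlt (a b : nat) (l : nat)
| IJmp (l : nat)
| IAccept
| IReject.

Definition program := list instr.
Definition memory := nat -> Z.

Definition upd (m : memory) (i : nat) (v : Z) : memory :=
  fun j => if Nat.eqb j i then v else m j.

Definition zlen (z : Z) : nat := Z.to_nat (Z.log2 (Z.abs z)) + 1.

(* negative addresses are mapped to 0 *)
Definition addr (z : Z) : nat := Z.to_nat z.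

Inductive outcome : Type :=
| Continue (pc : nat) (m : memory) (cost : nat)
| Halt (b : bool) (cost : nat)
| Stuck.

Definition step (P : program) (pc : nat) (m : memory) : outcome :=
  match nth_error P pc with
  | None => Stuck
  | Some i =>
    match i with
    | IConst d z => Continue (S pc) (upd m d z) (1 + zlen z)
    | IAdd d a b => Continue (S pc) (upd m d (m a + m b)%Z) (1 + zlen (m a) + zlen (m b))
    | ISub d a b => Continue (S pc) (upd m d (m a - m b)%Z) (1 + zlen (m a) + zlen (m b))
    | ILoad d a =>
        Continue (S pc) (upd m d (m (addr (m a)))) (1 + zlen (m a) + zlen (m (addr (m a))))
    | IStore a s =>
        Continue (S pc) (upd m (addr (m a)) (m s)) (1 + zlen (m a) + zlen (m s))
    | IJlt a b l =>
        Continue (if (m a <? m b)%Z then l else S pc) m (1 + zlen (m a) + zlen (m b))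
    | IJmp l => Continue l m 1
    | IAccept => Halt true 1
    | IReject => Halt false 1
    end
  end.

Fixpoint run (P : program) (fuel : nat) (pc : nat) (m : memory) : option (bool * nat) :=
  match fuel with
  | 0 => None
  | S f =>
    match step P pc m with
    | Stuck => None
    | Halt b c => Some (b, c)
    | Continue pc' m' c =>
      match run P f pc' m' with
      | Some (b, c') => Some (b, c + c')
      | None => None
      end
    end
  end.

Definition halts_with (P : program) (m : memory) (b : bool) (cost : nat) : Prop :=
  exists fuel, run P fuel 0 m = Some (b, cost).

Definition input_cells (a : list Z) (t : Z) (rho pi : list bool) : list Z :=
  Z.of_nat (length a) :: a ++ t :: Z.of_nat (length rho) :: map Z.b2z rho
    ++ Z.of_nat (length pi) :: map Z.b2z pi.

Definition init_mem (cells : list Z) : memory := fun i : nat => nth i cells 0%Z.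

Definition input_size (a : list Z) (t : Z) : nat :=
  length a + fold_right Nat.add 0 (map zlen a) + zlen t.

Definition subset_sum (a : list Z) (t : Z) : Prop :=
  exists mask : list bool, length mask = length a /\
    fold_right Z.add 0%Z
      (map (fun p : bool * Z => if fst p then snd p else 0%Z) (combine mask a)) = t.

(* Main.v *)
Require Import Defs.
From Stdlib Require Import ZArith List Arith.
From Stdlib Require Import Lia Bool.
Import ListNotations.

(** Cut the integers into four parts of about q = n/4 elements and let Q = 2^q.  The random string is
    a multiplier al, and an integer v is hashed to key v, the q leading bits of al * v modulo
    2^|rho| (multiply-shift hashing), which is additive up to rounding.  As in the algorithm of
    Schroeppel and Shamir, the proof announces the sum s modulo Q of the keys of the parts of a
    solution taken from the first two quarters.  The verifier lists the distinct subset sums of each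
    quarter and looks up the pairs of sums of the first two quarters whose keys add up to s, and
    those of the last two whose keys add up to key t - s up to a carry between 0 and n; it accepts if
    a sum v of the first kind and a sum t - v of the second are met, and rejects as soon as
    128 (n+1)^2 Q pairs have been met.

    For a fixed solution the pairs with the very sum of the solution number at most Q on each side,
    because repeated subset sums are listed once.  Any other pair is met with probability O(n / Q),
    as its sum differs from that of the solution by a nonzero integer, which a random al rarely
    multiplies to something close to 0.  By Markov's inequality the cutoff is harmless for at least
    2/3 of the random strings.  Addresses of the machine may be exponentially large, so that marks
    and hash buckets are plain arrays indexed by integers. *)

Open Scope Z_scope.

(** The error is one-sided because keys only decide which pairs are looked at: a match is always a
    true solution, so a bad random string or a false proof can only prevent matches. Distinct sums
    matter because an instance may have about Q^2 pairs of subsets with the sum of the solution. The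
    random string has (c+4) n bits so that W, the weight of the bits that a key drops, exceeds every
    difference of the sums compared; this is what the collision bound needs. The 128 covers 3 (for
    Markov) times the expected number of hits: n+1 carries, windows of O(n) residues of keys, and up
    to 8 Q sums in the last quarter.

    The rest is machine work. For each c one program must run on a RAM that has no multiplication
    and no division, and whose input fills the cells from 0 on, so that no cell is known to be free.
    The length in cell 0 is therefore doubled in place until it is an address past the input, and
    the low cells are moved there. The loops are verified in a small structured language, by weakest
    preconditions that spend a budget of machine steps. *)

Inductive msteps (P : program) : nat -> memory -> nat -> memory -> nat -> nat -> Prop :=
| ms_refl pc m : msteps P pc m pc m 0 0
| ms_step pc m pc1 m1 c1 pc2 m2 n c :
    step P pc m = Continue pc1 m1 c1 -> msteps P pc1 m1 pc2 m2 n c ->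
    msteps P pc m pc2 m2 (S n) (c1 + c).

Lemma msteps_trans P pc m pc1 m1 n1 c1 pc2 m2 n2 c2 :
  msteps P pc m pc1 m1 n1 c1 -> msteps P pc1 m1 pc2 m2 n2 c2 ->
  msteps P pc m pc2 m2 (n1 + n2) (c1 + c2).
Proof.
  intros S1 S2; induction S1; simpl; auto.
  rewrite <- Nat.add_assoc. econstructor; eauto.
Qed.

Lemma msteps_one P pc m pc1 m1 c1 :
  step P pc m = Continue pc1 m1 c1 -> msteps P pc m pc1 m1 1 c1.
Proof.
  intro Hs. replace c1 with (c1 + 0)%nat by lia. econstructor; [eassumption | constructor].
Qed.

Lemma run_deterministic P f1 : forall f2 pc m x y,
  run P f1 pc m = Some x -> run P f2 pc m = Some y -> x = y.
Proof.
  induction f1 as [|f1 IH]; intros [|f2] pc m x y; simpl; try discriminate.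
  destruct (step P pc m) as [pc' m' c | b c |]; try congruence.
  destruct (run P f1 pc' m') as [[b1 c1]|] eqn:E1; try discriminate.
  destruct (run P f2 pc' m') as [[b2 c2]|] eqn:E2; try discriminate.
  specialize (IH f2 pc' m' _ _ E1 E2). congruence.
Qed.

(** The no-case speaks of every halting run, whereas the analysis of the program constructs one;
    determinism identifies the two. *)
Lemma halts_with_deterministic P m b1 c1 b2 c2 :
  halts_with P m b1 c1 -> halts_with P m b2 c2 -> b1 = b2.
Proof.
  intros [f1 H1] [f2 H2]. pose proof (run_deterministic P f1 f2 0 m _ _ H1 H2). congruence.
Qed.

(** * Structured programs *)

(** Cells below 64 serve as registers and the others as the heap. Indirect accesses stay in the
    heap, so registers behave like variables without aliasing. *)
Definition nregs : nat := 64.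
Notation regs := (nat -> Z) (only parsing).
Notation heap := (Z -> Z) (only parsing).

Inductive cmd : Type :=
| Skip
| Cst (d : nat) (z : Z)
| Plus (d a b : nat)
| Minus (d a b : nat)
| Ld (d a : nat)
| St (a s : nat)
| Seq (c1 c2 : cmd)
| If (a b : nat) (c1 c2 : cmd)
| While (a b : nat) (c : cmd)
| Accept
| Reject.

Fixpoint size (c : cmd) : nat :=
  match c with
  | Skip => 0
  | Seq c1 c2 => size c1 + size c2
  | If _ _ c1 c2 => 2 + size c1 + size c2
  | While _ _ c => 3 + size c
  | _ => 1
  end.

(** [IJlt] jumps when its test succeeds, hence the else branch comes first and ends with a jump over
    the other one; this is why [exec] charges one step more for a false test. *)
Fixpoint compile (pc : nat) (c : cmd) : list instr :=
  match c with
  | Skip => []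
  | Cst d z => [IConst d z]
  | Plus d a b => [IAdd d a b]
  | Minus d a b => [ISub d a b]
  | Ld d a => [ILoad d a]
  | St a s => [IStore a s]
  | Seq c1 c2 => compile pc c1 ++ compile (pc + size c1) c2
  | If a b c1 c2 =>
      [IJlt a b (pc + 2 + size c2)] ++ compile (pc + 1) c2
        ++ [IJmp (pc + 2 + size c2 + size c1)] ++ compile (pc + 2 + size c2) c1
  | While a b c =>
      [IJlt a b (pc + 2); IJmp (pc + 3 + size c)] ++ compile (pc + 2) c ++ [IJmp pc]
  | Accept => [IAccept]
  | Reject => [IReject]
  end.

Lemma compile_length c : forall pc, length (compile pc c) = size c.
Proof.
  induction c; intro pc; simpl; rewrite ?length_app; simpl; rewrite ?length_app; simpl;
    rewrite ?IHc, ?IHc1, ?IHc2; lia.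
Qed.

Definition hset (H : heap) (z v : Z) : heap := fun y => if y =? z then v else H y.

Inductive res : Type :=
| RN (R : regs) (H : heap)
| RD (b : bool).

(* The fourth argument counts machine steps; [BB] bounds every value that is
   computed, so that it also bounds the logarithmic cost of one step. *)
Inductive exec (BB : Z) : cmd -> regs -> heap -> Z -> res -> Prop :=
| x_skip R H : exec BB Skip R H 0 (RN R H)
| x_const d z R H : Z.abs z <= BB -> exec BB (Cst d z) R H 1 (RN (upd R d z) H)
| x_add d a b R H : Z.abs (R a + R b) <= BB ->
    exec BB (Plus d a b) R H 1 (RN (upd R d (R a + R b)) H)
| x_sub d a b R H : Z.abs (R a - R b) <= BB ->
    exec BB (Minus d a b) R H 1 (RN (upd R d (R a - R b)) H)
| x_load d a R H : Z.of_nat nregs <= R a ->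
    exec BB (Ld d a) R H 1 (RN (upd R d (H (R a))) H)
| x_store a s R H : Z.of_nat nregs <= R a ->
    exec BB (St a s) R H 1 (RN R (hset H (R a) (R s)))
| x_seq c1 c2 R H n1 R1 H1 n2 r :
    exec BB c1 R H n1 (RN R1 H1) -> exec BB c2 R1 H1 n2 r ->
    exec BB (Seq c1 c2) R H (n1 + n2) r
| x_seq_done c1 c2 R H n b :
    exec BB c1 R H n (RD b) -> exec BB (Seq c1 c2) R H n (RD b)
| x_if_true a b c1 c2 R H n r :
    R a < R b -> exec BB c1 R H n r -> exec BB (If a b c1 c2) R H (n + 1) r
| x_if_false a b c1 c2 R H n r :
    R b <= R a -> exec BB c2 R H n r -> exec BB (If a b c1 c2) R H (n + 2) r
| x_while_end a b c R H :
    R b <= R a -> exec BB (While a b c) R H 2 (RN R H)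
| x_while_iter a b c R H n R1 H1 n' r :
    R a < R b -> exec BB c R H n (RN R1 H1) -> exec BB (While a b c) R1 H1 n' r ->
    exec BB (While a b c) R H (n + n' + 2) r
| x_while_done a b c R H n x :
    R a < R b -> exec BB c R H n (RD x) -> exec BB (While a b c) R H (n + 1) (RD x)
| x_acc R H : exec BB Accept R H 1 (RD true)
| x_rej R H : exec BB Reject R H 1 (RD false).

Lemma exec_nonneg BB c R H n r : exec BB c R H n r -> 0 <= n.
Proof. induction 1; lia. Qed.

Fixpoint wf (c : cmd) : bool :=
  let ok i := Nat.ltb i nregs in
  match c with
  | Skip | Accept | Reject => true
  | Cst d _ => ok d
  | Plus d a b | Minus d a b => ok d && ok a && ok b
  | Ld d a => ok d && ok a
  | St a s => ok a && ok s
  | Seq c1 c2 => wf c1 && wf c2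
  | If a b c1 c2 => ok a && ok b && wf c1 && wf c2
  | While a b c => ok a && ok b && wf c
  end.

Definition rep (R : regs) (H : heap) (m : memory) : Prop :=
  (forall i, (i < nregs)%nat -> m i = R i) /\
  (forall i, (nregs <= i)%nat -> m i = H (Z.of_nat i)).

Definition bounded (BB : Z) (m : memory) : Prop := forall i, Z.abs (m i) <= BB.

(** One unit for the instruction and at most [log2 BB + 1] for each of two operands. *)
Definition step_cost (BB : Z) : Z := 2 * Z.log2 BB + 3.

Definition code_at (P : program) (pc : nat) (code : list instr) : Prop :=
  forall i x, nth_error code i = Some x -> nth_error P (pc + i) = Some x.

Lemma code_at_app P pc l1 l2 :
  code_at P pc (l1 ++ l2) -> code_at P pc l1 /\ code_at P (pc + length l1) l2.
Proof.
  intro Hc; split; intros i x Hi.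
  - apply Hc. rewrite nth_error_app1; auto. apply nth_error_Some. congruence.
  - rewrite <- Nat.add_assoc. apply Hc. rewrite nth_error_app2 by lia.
    now replace (length l1 + i - length l1)%nat with i by lia.
Qed.

Lemma code_at_cons P pc x l :
  code_at P pc (x :: l) -> nth_error P pc = Some x /\ code_at P (S pc) l.
Proof.
  intro Hc; split.
  - replace pc with (pc + 0)%nat by lia. now apply Hc.
  - intros i y Hi. replace (S pc + i)%nat with (pc + S i)%nat by lia. now apply Hc.
Qed.

Lemma zlen_bound BB v : Z.abs v <= BB -> Z.of_nat (zlen v) <= Z.log2 BB + 1.
Proof.
  intro Hv. unfold zlen. pose proof (Z.log2_nonneg (Z.abs v)).
  pose proof (Z.log2_le_mono _ _ Hv). lia.
Qed.

Lemma rep_upd R H m d v :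
  (d < nregs)%nat -> rep R H m -> rep (upd R d v) H (upd m d v).
Proof.
  intros Hd [H1 H2]; split; intros i Hi; unfold upd.
  - destruct (Nat.eqb_spec i d); auto.
  - destruct (Nat.eqb_spec i d); [lia | auto].
Qed.

Lemma rep_store R H m z v :
  Z.of_nat nregs <= z -> rep R H m -> rep R (hset H z v) (upd m (addr z) v).
Proof.
  intros Hz [H1 H2]; split; intros i Hi; unfold nregs, upd, hset, addr in *.
  - destruct (Nat.eqb_spec i (Z.to_nat z)); [lia | auto].
  - destruct (Nat.eqb_spec i (Z.to_nat z)), (Z.eqb_spec (Z.of_nat i) z); try lia; auto.
Qed.

Lemma bounded_upd BB m d v : Z.abs v <= BB -> bounded BB m -> bounded BB (upd m d v).
Proof. intros Hv Hm i; unfold upd. destruct (Nat.eqb i d); auto. Qed.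

Lemma rep_heap R H m z :
  rep R H m -> Z.of_nat nregs <= z -> m (addr z) = H z.
Proof.
  intros [_ H2] Hz. unfold addr, nregs in *. rewrite H2 by lia. f_equal. lia.
Qed.

Ltac bsplit := repeat match goal with
  | H : (_ && _)%bool = true |- _ => apply andb_prop in H; destruct H
  | H : Nat.ltb _ _ = true |- _ => apply Nat.ltb_lt in H
  end.

Definition reaches BB P pc m n (r : res) (pcend : nat) : Prop :=
  match r with
  | RN R' H' => exists m' k c, msteps P pc m pcend m' k c /\ rep R' H' m' /\ bounded BB m' /\
      Z.of_nat c <= n * step_cost BB
  | RD b => exists fuel c, run P fuel pc m = Some (b, c) /\ Z.of_nat c <= n * step_cost BB
  end.

Lemma reaches_one BB P pc m R' H' m' c pcend :
  step P pc m = Continue pcend m' c -> Z.of_nat c <= step_cost BB ->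
  rep R' H' m' -> bounded BB m' -> reaches BB P pc m 1 (RN R' H') pcend.
Proof.
  intros Hs Hc Hr Hb. exists m', 1%nat, c. split; [now apply msteps_one|].
  split; [auto | split; [auto | lia]].
Qed.

Lemma reaches_prepend BB P pc m pc1 m1 k1 c1 n1 n r pcend :
  msteps P pc m pc1 m1 k1 c1 -> Z.of_nat c1 <= n1 * step_cost BB ->
  reaches BB P pc1 m1 n r pcend -> reaches BB P pc m (n1 + n) r pcend.
Proof.
  intros Hs Hc. destruct r as [R' H' | b]; simpl.
  - intros (m' & k & c & Hs' & Hr & Hb & Hc').
    exists m', (k1 + k)%nat, (c1 + c)%nat. repeat split; try apply Hr; auto.
    + eapply msteps_trans; eauto.
    + rewrite Z.mul_add_distr_r. lia.
  - intros (f & c & Hrun & Hc').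
    assert (Hx : exists f', run P f' pc m = Some (b, (c1 + c)%nat)).
    { clear Hc Hc'. induction Hs as [|pc m pc2 m2 c2 pc3 m3 n3 c3 Hs _ IH]; eauto.
      destruct (IH Hrun) as [f' Hf']. exists (S f'). simpl. rewrite Hs, Hf'.
      now rewrite Nat.add_assoc. }
    destruct Hx as [f' Hf']. exists f', (c1 + c)%nat. split; auto. rewrite Z.mul_add_distr_r. lia.
Qed.

Lemma reaches_weaken BB P pc m n n' r pcend :
  0 <= BB -> n <= n' -> reaches BB P pc m n r pcend -> reaches BB P pc m n' r pcend.
Proof.
  intros HB Hn. pose proof (Z.log2_nonneg BB).
  assert (n * step_cost BB <= n' * step_cost BB) by (unfold step_cost; nia).
  destruct r; simpl.
  - intros (m' & k & c & ?). exists m', k, c. intuition lia.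
  - intros (f & c & ?). exists f, c. intuition lia.
Qed.

(** All cells stay bounded by [BB] along the execution, so each of the [n] counted steps costs at
    most [step_cost BB] and logarithmic cost reduces to counting steps. *)
Theorem compile_correct BB P c R H n r :
  exec BB c R H n r -> forall pc m,
  wf c = true -> code_at P pc (compile pc c) -> rep R H m -> bounded BB m ->
  reaches BB P pc m n r (pc + size c).
Proof.
  induction 1; intros pc m Hwf Hcode Hrep Hbd; simpl in Hwf, Hcode; bsplit;
    assert (HBB : 0 <= BB) by (pose proof (Hbd 0%nat); lia);
    pose proof (Z.log2_nonneg BB) as Hlog;
    assert (Hzl : forall i, Z.of_nat (zlen (m i)) <= Z.log2 BB + 1)
      by (intro; apply zlen_bound, Hbd).
  - exists m, 0%nat, 0%nat. rewrite Nat.add_0_r. split; [constructor | split; [auto | split; [auto | lia]]].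
  - apply code_at_cons in Hcode as [Hi _]. pose proof (zlen_bound _ _ H0).
    eapply reaches_one; [unfold step; rewrite Hi; simpl size; rewrite Nat.add_1_r; reflexivity | ..].
    + unfold step_cost. lia.
    + now apply rep_upd.
    + now apply bounded_upd.
  - apply code_at_cons in Hcode as [Hi _]. pose proof (Hzl a); pose proof (Hzl b).
    eapply reaches_one; [unfold step; rewrite Hi; simpl size; rewrite Nat.add_1_r; reflexivity | ..].
    + unfold step_cost. lia.
    + rewrite !(proj1 Hrep) by auto. now apply rep_upd.
    + rewrite !(proj1 Hrep) by auto. now apply bounded_upd.
  - apply code_at_cons in Hcode as [Hi _]. pose proof (Hzl a); pose proof (Hzl b).
    eapply reaches_one; [unfold step; rewrite Hi; simpl size; rewrite Nat.add_1_r; reflexivity | ..].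
    + unfold step_cost. lia.
    + rewrite !(proj1 Hrep) by auto. now apply rep_upd.
    + rewrite !(proj1 Hrep) by auto. now apply bounded_upd.
  - apply code_at_cons in Hcode as [Hi _]. pose proof (Hzl a); pose proof (Hzl (addr (m a))).
    eapply reaches_one; [unfold step; rewrite Hi; simpl size; rewrite Nat.add_1_r; reflexivity | ..].
    + unfold step_cost. lia.
    + assert (Ea : m a = R a) by now apply Hrep.
      rewrite Ea, (rep_heap R H m) by auto. now apply rep_upd.
    + apply bounded_upd; auto.
  - apply code_at_cons in Hcode as [Hi _]. pose proof (Hzl a); pose proof (Hzl s).
    eapply reaches_one; [unfold step; rewrite Hi; simpl size; rewrite Nat.add_1_r; reflexivity | ..].
    + unfold step_cost. lia.
    + rewrite !(proj1 Hrep) by auto. now apply rep_store.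
    + apply bounded_upd; auto.
  - apply code_at_app in Hcode as [Hc1 Hc2]. rewrite compile_length in Hc2.
    destruct (IHexec1 pc m) as (m1 & k1 & cc1 & Hs1 & Hr1 & Hb1 & Hl1); auto.
    eapply reaches_prepend; eauto. simpl size. rewrite Nat.add_assoc.
    apply IHexec2; auto.
  - apply code_at_app in Hcode as [Hc1 Hc2].
    apply (IHexec pc m); auto.
  - apply code_at_cons in Hcode as [Hi Hcode].
    apply code_at_app in Hcode as [_ Hcode]. rewrite compile_length in Hcode.
    apply code_at_cons in Hcode as [_ Hcode].
    assert (Ea : m a = R a) by (now apply Hrep).
    assert (Eb : m b = R b) by (now apply Hrep).
    rewrite Z.add_comm.
    eapply reaches_prepend with (pc1 := (pc + 2 + size c2)%nat).
    + apply msteps_one. unfold step. rewrite Hi, Ea, Eb.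
      apply Z.ltb_lt in H0 as ->. reflexivity.
    + pose proof (Hzl a); pose proof (Hzl b). rewrite Ea, Eb in *. unfold step_cost. lia.
    + replace (pc + size (If a b c1 c2))%nat with (pc + 2 + size c2 + size c1)%nat
        by (simpl; lia).
      replace (S (S pc + size c2)) with (pc + 2 + size c2)%nat in Hcode by lia.
      apply IHexec; auto.
  - apply code_at_cons in Hcode as [Hi Hcode].
    apply code_at_app in Hcode as [Hc2 Hcode]. rewrite compile_length in Hcode.
    apply code_at_cons in Hcode as [Hj _].
    assert (Ea : m a = R a) by (now apply Hrep).
    assert (Eb : m b = R b) by (now apply Hrep).
    replace (n + 2) with (1 + (n + 1)) by lia.
    eapply reaches_prepend with (pc1 := (pc + 1)%nat).
    + apply msteps_one. unfold step. rewrite Hi, Ea, Eb.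
      apply Z.ltb_ge in H0 as ->. f_equal. lia.
    + pose proof (Hzl a); pose proof (Hzl b). rewrite Ea, Eb in *. unfold step_cost. lia.
    + replace (S pc) with (pc + 1)%nat in * by lia.
      specialize (IHexec (pc + 1)%nat m ltac:(auto) Hc2 Hrep Hbd).
      destruct r as [R' H' | x].
      * destruct IHexec as (m1 & k1 & cc1 & Hs1 & Hr1 & Hb1 & Hl1).
        eapply reaches_prepend; eauto.
        exists m1, 1%nat, 1%nat. split; [|split; [auto | split; auto]].
        -- apply msteps_one. unfold step. rewrite Hj. f_equal. simpl. lia.
        -- unfold step_cost. lia.
      (* A branch that halts never reaches the jump over the other branch and leaves one step
         unspent. *)
      * eapply reaches_weaken; [| |exact IHexec]; lia.
  - apply code_at_cons in Hcode as [Hi Hcode].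
    apply code_at_cons in Hcode as [Hj _].
    assert (Ea : m a = R a) by (now apply Hrep).
    assert (Eb : m b = R b) by (now apply Hrep).
    change 2 with (1 + 1).
    eapply reaches_prepend with (pc1 := S pc).
    + apply msteps_one. unfold step. rewrite Hi, Ea, Eb.
      apply Z.ltb_ge in H0 as ->. f_equal.
    + pose proof (Hzl a); pose proof (Hzl b). rewrite Ea, Eb in *. unfold step_cost. lia.
    + exists m, 1%nat, 1%nat. split; [|split; [auto | split; auto]].
      * apply msteps_one. unfold step. rewrite Hj. f_equal. simpl. lia.
      * unfold step_cost. lia.
  (* The next iteration executes the same loop at the same address, so the fact about the whole code
     is kept. *)
  - pose proof Hcode as Hcode0.
    apply code_at_cons in Hcode as [Hi Hcode].
    apply code_at_cons in Hcode as [_ Hcode].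
    apply code_at_app in Hcode as [Hc Hcode]. rewrite compile_length in Hcode.
    apply code_at_cons in Hcode as [Hj _].
    assert (Ea : m a = R a) by (now apply Hrep).
    assert (Eb : m b = R b) by (now apply Hrep).
    replace (n + n' + 2) with (1 + (n + (1 + n'))) by lia.
    replace (S (S pc)) with (pc + 2)%nat in * by lia.
    eapply reaches_prepend with (pc1 := (pc + 2)%nat).
    + apply msteps_one. unfold step. rewrite Hi, Ea, Eb.
      apply Z.ltb_lt in H0 as ->. f_equal.
    + pose proof (Hzl a); pose proof (Hzl b). rewrite Ea, Eb in *. unfold step_cost. lia.
    + destruct (IHexec1 (pc + 2)%nat m) as (m1 & k1 & cc1 & Hs1 & Hr1 & Hb1 & Hl1); auto.
      eapply reaches_prepend; eauto.
      eapply reaches_prepend with (pc1 := pc).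
      * apply msteps_one. unfold step. rewrite Hj. reflexivity.
      * unfold step_cost. lia.
      * apply IHexec2; auto. simpl. apply andb_true_intro; split; auto.
        apply andb_true_intro; split; now apply Nat.ltb_lt.
  - apply code_at_cons in Hcode as [Hi Hcode].
    apply code_at_cons in Hcode as [_ Hcode].
    apply code_at_app in Hcode as [Hc Hcode].
    assert (Ea : m a = R a) by (now apply Hrep).
    assert (Eb : m b = R b) by (now apply Hrep).
    replace (n + 1) with (1 + n) by lia.
    replace (S (S pc)) with (pc + 2)%nat in * by lia.
    eapply reaches_prepend with (pc1 := (pc + 2)%nat).
    + apply msteps_one. unfold step. rewrite Hi, Ea, Eb.
      apply Z.ltb_lt in H0 as ->. f_equal.
    + pose proof (Hzl a); pose proof (Hzl b). rewrite Ea, Eb in *. unfold step_cost. lia.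
    + apply (IHexec (pc + 2)%nat m); auto.
  - apply code_at_cons in Hcode as [Hi _].
    exists 1%nat, 1%nat. simpl run. unfold step. rewrite Hi. split; auto. unfold step_cost; lia.
  - apply code_at_cons in Hcode as [Hi _].
    exists 1%nat, 1%nat. simpl run. unfold step. rewrite Hi. split; auto. unfold step_cost; lia.
Qed.

(** * Weakest preconditions with a step budget *)

Definition post := (nat -> Z) -> (Z -> Z) -> Z -> Prop.

(* The budget [b] is spent by the execution and what is left is handed to the
   postcondition [Q]; [D] is required of the answer of an execution that halts. *)
Definition wp (BB : Z) (D : bool -> Prop) (c : cmd) (Q : post) : post := fun R H b =>
  exists n r, exec BB c R H n r /\ n <= b /\
    match r with RN R' H' => Q R' H' (b - n) | RD x => D x end.

Lemma wp_skip BB D (Q : post) R H b : 0 <= b -> Q R H b -> wp BB D Skip Q R H b.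
Proof.
  intros Hb HQ. exists 0, (RN R H). rewrite Z.sub_0_r. split; [constructor | auto].
Qed.

Lemma wp_const BB D (Q : post) d z R H b :
  1 <= b -> Z.abs z <= BB -> Q (upd R d z) H (b - 1) -> wp BB D (Cst d z) Q R H b.
Proof. intros. eexists _, _. split; [now constructor | auto]. Qed.

Lemma wp_add BB D (Q : post) d x y R H b :
  1 <= b -> Z.abs (R x + R y) <= BB -> Q (upd R d (R x + R y)) H (b - 1) ->
  wp BB D (Plus d x y) Q R H b.
Proof. intros. eexists _, _. split; [now constructor | auto]. Qed.

Lemma wp_sub BB D (Q : post) d x y R H b :
  1 <= b -> Z.abs (R x - R y) <= BB -> Q (upd R d (R x - R y)) H (b - 1) ->
  wp BB D (Minus d x y) Q R H b.
Proof. intros. eexists _, _. split; [now constructor | auto]. Qed.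

Lemma wp_ld BB D (Q : post) d x R H b :
  1 <= b -> Z.of_nat nregs <= R x -> Q (upd R d (H (R x))) H (b - 1) ->
  wp BB D (Ld d x) Q R H b.
Proof. intros. eexists _, _. split; [now constructor | auto]. Qed.

Lemma wp_st BB D (Q : post) x s R H b :
  1 <= b -> Z.of_nat nregs <= R x -> Q R (hset H (R x) (R s)) (b - 1) ->
  wp BB D (St x s) Q R H b.
Proof. intros. eexists _, _. split; [now constructor | auto]. Qed.

Lemma wp_acc BB (D : bool -> Prop) (Q : post) R H b :
  1 <= b -> D true -> wp BB D Accept Q R H b.
Proof. intros. eexists _, _. split; [now constructor | auto]. Qed.

Lemma wp_rej BB (D : bool -> Prop) (Q : post) R H b :
  1 <= b -> D false -> wp BB D Reject Q R H b.
Proof. intros. eexists _, _. split; [now constructor | auto]. Qed.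

Lemma wp_seq BB D (Q : post) c1 c2 R H b :
  wp BB D c1 (wp BB D c2 Q) R H b -> wp BB D (Seq c1 c2) Q R H b.
Proof.
  intros (n & r & He & Hn & Hr). destruct r as [R' H' | x].
  - destruct Hr as (n2 & r2 & He2 & Hn2 & Hr2).
    exists (n + n2), r2. split; [econstructor; eauto |]. split; [lia |].
    destruct r2; auto. now replace (b - (n + n2)) with (b - n - n2) by lia.
  - exists n, (RD x). split; [now constructor | auto].
Qed.

Lemma wp_if BB D (Q : post) x y c1 c2 R H b :
  (R x < R y -> wp BB D c1 Q R H (b - 1)) ->
  (R y <= R x -> wp BB D c2 Q R H (b - 2)) ->
  wp BB D (If x y c1 c2) Q R H b.
Proof.
  intros H1 H2. destruct (Z.lt_ge_cases (R x) (R y)) as [Hlt | Hge].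
  - destruct (H1 Hlt) as (n & r & He & Hn & Hr).
    exists (n + 1), r. split; [now constructor |]. split; [lia |].
    destruct r; auto. now replace (b - (n + 1)) with (b - 1 - n) by lia.
  - destruct (H2 Hge) as (n & r & He & Hn & Hr).
    exists (n + 2), r. split; [now constructor |]. split; [lia |].
    destruct r; auto. now replace (b - (n + 2)) with (b - 2 - n) by lia.
Qed.

Fixpoint writes (c : cmd) : list nat :=
  match c with
  | Cst d _ | Plus d _ _ | Minus d _ _ | Ld d _ => [d]
  | Seq c1 c2 | If _ _ c1 c2 => writes c1 ++ writes c2
  | While _ _ c => writes c
  | _ => []
  end.

Definition unwritten (c : cmd) (r : nat) : bool := negb (existsb (Nat.eqb r) (writes c)).

Definition agree (c : cmd) (R R' : nat -> Z) : Prop :=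
  forall r, unwritten c r = true -> R' r = R r.

Lemma exec_agree BB c R H n res :
  exec BB c R H n res -> match res with RN R' _ => agree c R R' | RD _ => True end.
Proof.
  assert (Happ : forall l1 l2 r, negb (existsb (Nat.eqb r) (l1 ++ l2)) = true ->
    negb (existsb (Nat.eqb r) l1) = true /\ negb (existsb (Nat.eqb r) l2) = true).
  { intros l1 l2 r. rewrite existsb_app, negb_orb. apply andb_prop. }
  induction 1; unfold agree, unwritten in *; simpl; auto;
    try (intros r0; unfold upd; destruct (Nat.eqb r0 d); simpl; congruence || discriminate).
  - destruct r; auto. intros r0 Hr. apply Happ in Hr as [Ha Hb]. now rewrite IHexec2, IHexec1.
  - destruct r; auto. intros r0 Hr. apply Happ in Hr as [Ha Hb]. auto.
  - destruct r; auto. intros r0 Hr. apply Happ in Hr as [Ha Hb]. auto.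
  - destruct r; auto. intros r0 Hr. now rewrite IHexec2, IHexec1.
Qed.

(** Frame rule for registers: those that a command does not write syntactically keep their values,
    so the specifications mention only what changes. *)
Lemma wp_agree BB D c (Q : post) R H b :
  wp BB D c (fun R' H' b' => agree c R R' -> Q R' H' b') R H b -> wp BB D c Q R H b.
Proof.
  intros (n & r & He & Hn & Hr). exists n, r. repeat split; auto.
  pose proof (exec_agree _ _ _ _ _ _ He). destruct r; auto.
Qed.

(* Termination comes for free: every iteration spends part of the budget. *)
Lemma wp_while BB D (I Q : post) x y c R0 H0 b0 :
  I R0 H0 b0 ->
  (forall R H b, agree c R0 R -> I R H b -> R x < R y ->
     wp BB D c (fun R' H' b' => 1 <= b' /\ I R' H' (b' - 1)) R H (b - 1)) ->
  (forall R H b, agree c R0 R -> I R H b -> R y <= R x -> 2 <= b /\ Q R H (b - 2)) ->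
  wp BB D (While x y c) Q R0 H0 b0.
Proof.
  intros HI Hbody Hend.
  assert (Hrefl : agree c R0 R0) by (intros ? ?; auto).
  assert (Hmain : forall k R H b, Z.to_nat b = k -> agree c R0 R -> I R H b ->
            wp BB D (While x y c) Q R H b); [|eapply Hmain; eauto].
  induction k as [k IH] using lt_wf_ind. intros R H b Hk Hag Hinv.
  destruct (Z.lt_ge_cases (R x) (R y)) as [Hlt | Hge].
  - destruct (Hbody R H b Hag Hinv Hlt) as (n & r & He & Hn & Hr).
    pose proof (exec_nonneg _ _ _ _ _ _ He).
    pose proof (exec_agree _ _ _ _ _ _ He) as Hag'.
    destruct r as [R1 Hp1 | z].
    + destruct Hr as [Hb1 Hinv'].
      replace (b - 1 - n - 1) with (b - n - 2) in Hinv' by lia.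
      destruct (fun h h' => IH (Z.to_nat (b - n - 2)) h R1 Hp1 _ eq_refl h' Hinv')
        as (n' & r' & He' & Hn' & Hr').
      * lia.
      * intros r Hr. now rewrite (Hag' r Hr), (Hag r Hr).
      * exists (n + n' + 2), r'. split; [econstructor; eauto |]. split; [lia |].
        destruct r'; auto. now replace (b - (n + n' + 2)) with (b - n - 2 - n') by lia.
    + exists (n + 1), (RD z). split; [now constructor |]. split; [lia | auto].
  - destruct (Hend R H b Hag Hinv Hge) as [Hb HQ].
    exists 2, (RN R H). split; [now constructor | auto].
Qed.

Fixpoint block (l : list cmd) : cmd :=
  match l with
  | [] => Skip
  | [c] => c
  | c :: l => Seq c (block l)
  end.

(** * The list of subset sums with their hash keys *)

Definition add_item (acc : list (Z * Z)) (p : Z * Z) : list (Z * Z) :=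
  if existsb (fun p' => fst p' =? fst p) acc then acc else acc ++ [p].

Definition shift_item (Q x k : Z) (p : Z * Z) : Z * Z := (fst p + x, (snd p + k) mod Q).

(** The old list is traversed while new entries are appended behind it, just as the program does
    within one array. *)
Definition extend (Q x k : Z) (L : list (Z * Z)) : list (Z * Z) :=
  fold_left (fun acc p => add_item acc (shift_item Q x k p)) L L.

(* One entry (value, key) for every value of a subset sum of [l]; the key is the sum modulo [Q]
   of the keys of the elements of one subset with this value. *)
Definition items (Q : Z) (kf : Z -> Z) (l : list Z) : list (Z * Z) :=
  fold_left (fun L x => extend Q x (kf x) L) l [(0, 0)].

Lemma items_snoc Q kf l x : items Q kf (l ++ [x]) = extend Q x (kf x) (items Q kf l).
Proof. unfold items. now rewrite fold_left_app. Qed.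

Lemma existsb_fst (v : Z) (L : list (Z * Z)) :
  existsb (fun p => fst p =? v) L = true <-> In v (map fst L).
Proof.
  rewrite existsb_exists, in_map_iff. split; intros (p & H1 & H2); exists p.
  - apply Z.eqb_eq in H2. auto.
  - subst. now rewrite Z.eqb_refl.
Qed.

Lemma in_add_item p acc x : In p (add_item acc x) -> In p acc \/ p = x.
Proof.
  unfold add_item. destruct existsb; auto. rewrite in_app_iff. simpl. intuition.
Qed.

Lemma add_item_incl p acc x : In p acc -> In p (add_item acc x).
Proof.
  unfold add_item. destruct existsb; auto. rewrite in_app_iff. auto.
Qed.

Lemma add_item_value acc x : In (fst x) (map fst (add_item acc x)).
Proof.
  unfold add_item. destruct existsb eqn:E.
  - now apply existsb_fst in E.
  - rewrite map_app, in_app_iff. simpl. auto.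
Qed.

Lemma add_item_nodup acc x : NoDup (map fst acc) -> NoDup (map fst (add_item acc x)).
Proof.
  unfold add_item. destruct existsb eqn:E; auto. intro Hn. rewrite map_app. simpl.
  apply NoDup_app; auto.
  - constructor; [intros [] | constructor].
  - intros v Hv [<- | []]. apply existsb_fst in Hv. congruence.
Qed.

Lemma add_item_length acc x :
  (length acc <= length (add_item acc x) <= length acc + 1)%nat.
Proof. unfold add_item. destruct existsb; rewrite ?length_app; simpl; lia. Qed.

Lemma in_fold_add (f : Z * Z -> Z * Z) L : forall acc p,
  In p (fold_left (fun acc p => add_item acc (f p)) L acc) ->
  In p acc \/ exists p', In p' L /\ p = f p'.
Proof.
  induction L as [|y L IH]; simpl; auto. intros acc p Hp.
  destruct (IH _ _ Hp) as [Ha | (p' & Hp' & ->)].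
  - apply in_add_item in Ha as [Ha | ->]; eauto.
  - eauto.
Qed.

Lemma fold_add_incl (f : Z * Z -> Z * Z) L : forall acc p,
  In p acc -> In p (fold_left (fun acc p => add_item acc (f p)) L acc).
Proof.
  induction L as [|y L IH]; simpl; auto. intros acc p Hp. now apply IH, add_item_incl.
Qed.

Lemma fold_add_value (f : Z * Z -> Z * Z) L : forall acc p,
  In p L -> In (fst (f p)) (map fst (fold_left (fun acc p => add_item acc (f p)) L acc)).
Proof.
  induction L as [|y L IH]; simpl; [tauto|]. intros acc p [-> | Hp]; auto.
  pose proof (add_item_value acc (f p)) as Hv. apply in_map_iff in Hv as (p' & E & Hp').
  rewrite <- E. apply in_map. now apply fold_add_incl.
Qed.

Lemma fold_add_nodup (f : Z * Z -> Z * Z) L : forall acc,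
  NoDup (map fst acc) -> NoDup (map fst (fold_left (fun acc p => add_item acc (f p)) L acc)).
Proof. induction L as [|y L IH]; simpl; auto. intros. now apply IH, add_item_nodup. Qed.

Lemma fold_add_length (f : Z * Z -> Z * Z) L : forall acc,
  (length acc <= length (fold_left (fun acc p => add_item acc (f p)) L acc)
    <= length acc + length L)%nat.
Proof.
  induction L as [|y L IH]; simpl; intro acc; [lia|].
  pose proof (IH (add_item acc (f y))). pose proof (add_item_length acc (f y)). lia.
Qed.

Lemma items_nodup Q kf l : NoDup (map fst (items Q kf l)).
Proof.
  induction l as [|x l IH] using rev_ind.
  - repeat constructor. intros [].
  - rewrite items_snoc. now apply fold_add_nodup.
Qed.

Lemma items_length Q kf l : (1 <= length (items Q kf l) <= 2 ^ length l)%nat.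
Proof.
  induction l as [|x l IH] using rev_ind; [simpl; lia|].
  rewrite items_snoc, length_app, Nat.add_comm. simpl.
  pose proof (fold_add_length (shift_item Q x (kf x)) (items Q kf l) (items Q kf l)).
  unfold extend. lia.
Qed.

(** Every entry arises from (0, 0) by skipping or taking the elements one after the other. *)
Lemma items_ind Q kf (P : list Z -> Z * Z -> Prop) :
  P [] (0, 0) ->
  (forall l x p, P l p -> P (l ++ [x]) p /\ P (l ++ [x]) (shift_item Q x (kf x) p)) ->
  forall l p, In p (items Q kf l) -> P l p.
Proof.
  intros H0 HS l. induction l as [|x l IH] using rev_ind; intros p Hp.
  - destruct Hp as [<- | []]; auto.
  - rewrite items_snoc in Hp. apply in_fold_add in Hp as [Hp | (p' & Hp & ->)];
      apply HS; auto.
Qed.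

Lemma map_fst_add_item acc1 acc2 x1 x2 :
  map fst acc1 = map fst acc2 -> fst x1 = fst x2 ->
  map fst (add_item acc1 x1) = map fst (add_item acc2 x2).
Proof.
  intros Ha Hx. unfold add_item.
  destruct (existsb _ acc1) eqn:E1, (existsb _ acc2) eqn:E2; auto.
  - apply existsb_fst in E1. rewrite Ha, Hx in E1. apply existsb_fst in E1. congruence.
  - apply existsb_fst in E2. rewrite <- Ha, <- Hx in E2. apply existsb_fst in E2. congruence.
  - rewrite !map_app, Ha. simpl. now rewrite Hx.
Qed.

(** Whether an entry is added depends on values alone. The list of values is thus the same for all
    multipliers, and averages over the random string run over a fixed set of pairs. *)
Lemma items_values Q1 kf1 Q2 kf2 l : map fst (items Q1 kf1 l) = map fst (items Q2 kf2 l).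
Proof.
  induction l as [|x l IH] using rev_ind; auto. rewrite !items_snoc. unfold extend.
  (* [extend] uses its list both as the list traversed and as the initial accumulator; the induction
     needs them separate. *)
  enough (Hg : forall L1 L2 acc1 acc2,
    map fst L1 = map fst L2 -> map fst acc1 = map fst acc2 ->
    map fst (fold_left (fun acc p => add_item acc (shift_item Q1 x (kf1 x) p)) L1 acc1) =
    map fst (fold_left (fun acc p => add_item acc (shift_item Q2 x (kf2 x) p)) L2 acc2))
    by (apply Hg; auto).
  induction L1 as [|p1 L1 IHL]; intros [|p2 L2] acc1 acc2 HL Ha; simpl in *;
    try discriminate; auto.
  injection HL as Hp HL. apply IHL; auto. apply map_fst_add_item; auto.
  simpl. now rewrite Hp.
Qed.

Definition msum (mask : list bool) (l : list Z) : Z :=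
  fold_right Z.add 0 (map (fun p : bool * Z => if fst p then snd p else 0) (combine mask l)).

Lemma msum_app m1 : forall l1 m2 l2, length m1 = length l1 ->
  msum (m1 ++ m2) (l1 ++ l2) = msum m1 l1 + msum m2 l2.
Proof.
  unfold msum. induction m1 as [|b m1 IH]; intros [|x l1] m2 l2 Hl; simpl in *;
    try discriminate; auto.
  rewrite IH by congruence. lia.
Qed.

Lemma items_sound Q kf l p :
  In p (items Q kf l) -> exists mask, length mask = length l /\ msum mask l = fst p.
Proof.
  revert l p. apply items_ind.
  - now exists [].
  - intros l x p (mask & Hl & Hm). split.
    + exists (mask ++ [false]). rewrite !length_app, msum_app by auto. cbn. split; lia.
    + exists (mask ++ [true]). rewrite !length_app, msum_app by auto. cbn. split; lia.
Qed.

Lemma items_complete Q kf l : forall mask, length mask = length l ->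
  In (msum mask l) (map fst (items Q kf l)).
Proof.
  induction l as [|x l IH] using rev_ind; intros mask Hl.
  - destruct mask; [simpl; auto | discriminate].
  - destruct mask as [|b mask _] using rev_ind;
      rewrite !length_app in Hl; simpl in Hl; [lia|].
    assert (Hl' : length mask = length l) by lia.
    rewrite msum_app, items_snoc by auto. unfold extend.
    specialize (IH mask Hl'). apply in_map_iff in IH as (p & Hp & Hin). rewrite <- Hp.
    destruct b; cbn.
    + rewrite Z.add_0_r. change (fst p + x) with (fst (shift_item Q x (kf x) p)).
      now apply fold_add_value.
    + rewrite Z.add_0_r. apply in_map. now apply fold_add_incl.
Qed.

Lemma msum_bound mask : forall l B, (forall x, In x l -> Z.abs x <= B) ->
  Z.abs (msum mask l) <= Z.of_nat (length l) * B.
Proof.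
  unfold msum. induction mask as [|b mask IH]; intros l B HB.
  - destruct l as [|x l]; [cbn; lia|]. pose proof (HB x (or_introl eq_refl)). cbn - [Z.mul]. nia.
  - destruct l as [|x l]; [cbn; lia|].
    pose proof (HB x (or_introl eq_refl)).
    specialize (IH l B (fun y Hy => HB y (or_intror Hy))).
    change (length (x :: l)) with (S (length l)). cbn [combine map fold_right fst snd].
    destruct b; nia.
Qed.

Lemma items_bound Q kf l p B : (forall x, In x l -> Z.abs x <= B) ->
  In p (items Q kf l) -> Z.abs (fst p) <= Z.of_nat (length l) * B.
Proof.
  intros HB Hp. destruct (items_sound _ _ _ _ Hp) as (mask & _ & <-). now apply msum_bound.
Qed.

(* Multiply-shift: the top [log2 Q] bits of [al * v] modulo [Q * W]. *)
Definition key (al Q W v : Z) : Z := (al * v) mod (Q * W) / W.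

Lemma key_range al Q W v : 0 < Q -> 0 < W -> 0 <= key al Q W v < Q.
Proof.
  intros HQ HW. unfold key. pose proof (Z.mod_pos_bound (al * v) (Q * W) ltac:(nia)).
  split; [apply Z.div_pos; lia | apply Z.div_lt_upper_bound; nia].
Qed.

(** Rounding made explicit: [r] is what the division by [W] drops and [j] counts the periods of
    length [Q * W]. Additivity of keys becomes linear arithmetic with such equations. *)
Lemma key_spec al Q W v : 0 < Q -> 0 < W ->
  exists r j, 0 <= r < W /\ al * v = W * key al Q W v + r + Q * W * j.
Proof.
  intros HQ HW. unfold key.
  exists ((al * v) mod (Q * W) mod W), (al * v / (Q * W)).
  pose proof (Z.mod_pos_bound ((al * v) mod (Q * W)) W HW).
  pose proof (Z.div_mod (al * v) (Q * W) ltac:(nia)).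
  pose proof (Z.div_mod ((al * v) mod (Q * W)) W ltac:(lia)).
  split; lia.
Qed.

Lemma items_key_range Q kf l p : 0 < Q -> In p (items Q kf l) -> 0 <= snd p < Q.
Proof.
  intro HQ. revert l p. apply (items_ind Q kf (fun _ p => 0 <= snd p < Q)); cbn; [lia|].
  intros _ x p Hp. split; auto. now apply Z.mod_pos_bound.
Qed.

(** The rounding errors of the elements add up, at most [W - 1] for each, while reductions of the
    keys modulo [Q] change the hashed value by multiples of [Q * W] only. *)
Lemma items_key_spec al Q W l p : 0 < Q -> 0 < W -> In p (items Q (key al Q W) l) ->
  exists r j, 0 <= r <= Z.of_nat (length l) * (W - 1) /\
    al * fst p = W * snd p + r + Q * W * j.
Proof.
  intros HQ HW. revert l p.
  apply (items_ind Q (key al Q W) (fun l p => exists r j,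
    0 <= r <= Z.of_nat (length l) * (W - 1) /\ al * fst p = W * snd p + r + Q * W * j)).
  - exists 0, 0. cbn. lia.
  - intros l x p (r & j & Hr & E). rewrite length_app. cbn [length]. split.
    + exists r, j. split; [nia | auto].
    + destruct (key_spec al Q W x HQ HW) as (r1 & j1 & Hr1 & E1).
      set (k := key al Q W x) in *. cbn [shift_item fst snd].
      pose proof (Z.div_mod (snd p + k) Q ltac:(lia)).
      (* The quotient of the reduction modulo [Q] joins the number of periods. *)
      exists (r + r1), (j + j1 + (snd p + k) / Q). split; [nia|].
      rewrite Z.mul_add_distr_l, E, E1. nia.
Qed.

Definition row (kp x : Z) (L2 : list (Z * Z)) : list Z :=
  map (fun p => x + fst p) (filter (fun p => snd p =? kp) L2).

Definition sweep (Q tau : Z) (L1 L2 : list (Z * Z)) : list Z :=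
  flat_map (fun p => row ((tau - snd p) mod Q) (fst p) L2) (rev L1).

(* The hits are listed in the reverse of the order in which the program meets them. *)
Definition hits (Q tau : Z) (E : nat) (L1 L2 : list (Z * Z)) : list Z :=
  flat_map (fun e => sweep Q (tau - Z.of_nat e) L1 L2) (rev (seq 0 E)).

Lemma in_hits Q tau E L1 L2 v :
  In v (hits Q tau E L1 L2) <->
  exists e p1 p2, (e < E)%nat /\ In p1 L1 /\ In p2 L2 /\
    snd p2 = (tau - Z.of_nat e - snd p1) mod Q /\ v = fst p1 + fst p2.
Proof.
  unfold hits, sweep, row. rewrite in_flat_map. split.
  - intros (e & He & Hv). apply in_flat_map in Hv as (p1 & H1 & Hv).
    apply in_map_iff in Hv as (p2 & <- & H2). apply filter_In in H2 as [H2 Hk].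
    apply in_rev in H1. apply in_rev, in_seq in He. apply Z.eqb_eq in Hk.
    exists e, p1, p2. intuition lia.
  - intros (e & p1 & p2 & He & H1 & H2 & Hk & ->). exists e.
    rewrite <- in_rev, in_seq. split; [lia|]. apply in_flat_map. exists p1.
    rewrite <- in_rev. split; auto. apply in_map_iff. exists p2. split; auto.
    apply filter_In. split; auto. now apply Z.eqb_eq.
Qed.

(** * Multiply-shift hashing is almost universal *)

Fixpoint zsum (f : Z -> Z) (n : nat) : Z :=
  match n with
  | O => 0
  | S n => zsum f n + f (Z.of_nat n)
  end.

Lemma zsum_le f g n :
  (forall i, 0 <= i < Z.of_nat n -> f i <= g i) -> zsum f n <= zsum g n.
Proof.
  induction n as [|n IH]; cbn [zsum]; intro Hfg; [lia|].
  pose proof (Hfg (Z.of_nat n)). enough (zsum f n <= zsum g n) by lia.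
  apply IH. intros; apply Hfg; lia.
Qed.

Lemma zsum_ext f g n :
  (forall i, 0 <= i < Z.of_nat n -> f i = g i) -> zsum f n = zsum g n.
Proof.
  intro Hfg. apply Z.le_antisymm; apply zsum_le; intros i Hi; rewrite Hfg; lia.
Qed.

Lemma zsum_const c n : zsum (fun _ => c) n = Z.of_nat n * c.
Proof. induction n; cbn [zsum]; lia. Qed.

Lemma zsum_plus f g n : zsum (fun i => f i + g i) n = zsum f n + zsum g n.
Proof. induction n; cbn [zsum]; lia. Qed.

Lemma zsum_scale c f n : zsum (fun i => c * f i) n = c * zsum f n.
Proof. induction n; cbn [zsum]; lia. Qed.

Lemma zsum_app f m n : zsum f (m + n) = zsum f m + zsum (fun j => f (Z.of_nat m + j)) n.
Proof.
  induction n; cbn [zsum]; rewrite ?Nat.add_0_r, ?Nat.add_succ_r; cbn [zsum]; [lia|].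
  rewrite IHn, Nat2Z.inj_add. lia.
Qed.

Lemma zsum_blocks f a b :
  zsum f (a * b) = zsum (fun i => zsum (fun j => f (i * Z.of_nat b + j)) b) a.
Proof.
  induction a as [|a IH]; auto. cbn [zsum]. rewrite <- IH. change (S a * b)%nat with (b + a * b)%nat.
  rewrite Nat.add_comm, zsum_app. f_equal. apply zsum_ext.
  intros; f_equal. lia.
Qed.

Lemma zsum_below A n : 0 <= A -> zsum (fun i => Z.b2z (i <? A)) n <= A.
Proof.
  intro HA. enough (zsum (fun i => Z.b2z (i <? A)) n <= Z.min A (Z.of_nat n)) by lia.
  induction n; cbn [zsum]; [lia|]. destruct (Z.ltb_spec (Z.of_nat n) A); cbn [Z.b2z]; lia.
Qed.

Lemma zsum_above B M n : 0 <= B -> Z.of_nat n <= M ->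
  zsum (fun i => Z.b2z (M - B <=? i)) n <= B.
Proof.
  intros HB Hn.
  enough (zsum (fun i => Z.b2z (M - B <=? i)) n <= Z.max 0 (Z.of_nat n - (M - B))) by lia.
  induction n; cbn [zsum]; [lia|].
  destruct (Z.leb_spec (M - B) (Z.of_nat n)); cbn [Z.b2z]; lia.
Qed.

(** An interval around 0 on the cycle of residues modulo [M]: [A] residues from 0 upwards and [B]
    residues below 0. *)
Definition window (A B M x : Z) : bool := (x mod M <? A) || (M - B <=? x mod M).

(* Replace every multiple al * D by the D integers following it: they are distinct for distinct
   al, fill D periods of length M, and lie in a window that is larger by D only. *)
Lemma count_window_pos (A B : Z) (M D : nat) : 0 <= A -> 0 <= B -> (0 < M)%nat -> (0 < D)%nat ->
  zsum (fun al => Z.b2z (window A B (Z.of_nat M) (al * Z.of_nat D))) M <= A + B + Z.of_nat D.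
Proof.
  intros HA HB HM HD.
  set (zM := Z.of_nat M). set (zD := Z.of_nat D).
  set (g := fun y => Z.b2z (y mod zM <? A + zD) + Z.b2z (zM - B <=? y mod zM)).
  (* If a multiple of [D] lies in the window, the [D] integers from it on lie in the window enlarged
     by [D] at its upper end, which [g] counts. *)
  assert (H1 : zsum (fun al => zD * Z.b2z (window A B zM (al * zD))) M <= zsum g (M * D)).
  { rewrite zsum_blocks. apply zsum_le. intros al Hal.
    unfold zD at 1. rewrite <- zsum_const. apply zsum_le. intros j Hj. fold zD.
    unfold window, g.
    assert (Hr : 0 <= (al * zD) mod zM < zM) by (apply Z.mod_pos_bound; lia).
    destruct (Z.lt_ge_cases ((al * zD) mod zM + j) zM) as [Hs | Hs].
    - replace ((al * zD + j) mod zM) with ((al * zD) mod zM + j).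
      2: { apply Z.mod_unique with (al * zD / zM); [lia|].
           pose proof (Z.div_mod (al * zD) zM ltac:(lia)). lia. }
      destruct (Z.ltb_spec ((al * zD) mod zM) A), (Z.leb_spec (zM - B) ((al * zD) mod zM)),
        (Z.ltb_spec ((al * zD) mod zM + j) (A + zD)),
        (Z.leb_spec (zM - B) ((al * zD) mod zM + j)); cbn [orb Z.b2z]; lia.
    (* The shift by [j] passes the end of the period, so the new residue is at most [j], hence below
       [D]. *)
    - assert (Hlt : (al * zD + j) mod zM < A + zD).
      { apply Z.le_lt_trans with j; [|lia].
        replace (al * zD + j) with ((al * zD) mod zM + j - zM + (al * zD / zM + 1) * zM).
        2: { pose proof (Z.div_mod (al * zD) zM ltac:(lia)). lia. }
        rewrite Z.mod_add by lia.
        eapply Z.le_trans; [apply Z.mod_le; lia | lia]. }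
      apply Z.ltb_lt in Hlt. rewrite Hlt.
      destruct (_ || _), (zM - B <=? (al * zD + j) mod zM); cbn; lia. }
  (* The same range of integers is now read as [D] periods of length [M]. *)
  assert (H2 : zsum g (D * M) <= zD * (A + zD + B)).
  { rewrite zsum_blocks. unfold zD at 1. rewrite <- zsum_const. apply zsum_le. intros i Hi.
    unfold g. rewrite zsum_plus. apply Z.add_le_mono.
    - rewrite <- (zsum_below (A + zD) M) by lia. apply zsum_le. intros j Hj.
      rewrite Z.add_comm, Z.mod_add, Z.mod_small by lia. lia.
    - rewrite <- (zsum_above B zM M) by lia. apply zsum_le. intros j Hj.
      rewrite Z.add_comm, Z.mod_add, Z.mod_small by lia. lia. }
  rewrite zsum_scale in H1. rewrite Nat.mul_comm in H2. nia.
Qed.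

Definition near (E Q W x : Z) : bool := window (E * W) (E * W) (Q * W) x.

Lemma near_intro E Q W x y j : 0 < Q -> 0 < W ->
  - (E * W) <= y < E * W -> x = y + Q * W * j -> near E Q W x = true.
Proof.
  intros HQ HW Hy ->. unfold near, window. apply orb_true_iff.
  rewrite Z.ltb_lt, Z.leb_le. rewrite (Z.mul_comm (Q * W)), Z.mod_add by nia.
  pose proof (Z.mod_pos_bound y (Q * W) ltac:(nia)) as Hr.
  destruct (Z.lt_ge_cases y 0).
  - destruct (Z.lt_ge_cases y (- (Q * W))); [lia|].
    replace (y mod (Q * W)) with (y + Q * W); [lia|].
    apply Z.mod_unique with (-1); lia.
  - left. eapply Z.le_lt_trans; [apply Z.mod_le; nia | lia].
Qed.

(** Out of [Q * W] multipliers this is a fraction of at most [(2 * E + 1) / Q]. The window holds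
    [2 * E * W] residues, and its enlargement by the size of [D] adds less than [W]. *)
Lemma count_near E Q W D n : 0 <= E -> 0 < Q -> 0 < W -> Z.of_nat n = Q * W ->
  D <> 0 -> Z.abs D < W ->
  zsum (fun al => Z.b2z (near E Q W (al * D))) n <= (2 * E + 1) * W.
Proof.
  intros HE HQ HW Hn HD HDW. unfold near. rewrite <- Hn.
  destruct (Z.lt_ge_cases 0 D) as [Hp | Hp].
  - pose proof (count_window_pos (E * W) (E * W) n (Z.to_nat D)) as Hc.
    rewrite Z2Nat.id in Hc by lia. nia.
  (* Reflection sends the lower end of the half-open window to the residue [E * W], which must now
     be included. The extra 1 is absorbed because [- D] is an integer below [W]. *)
  - pose proof (count_window_pos (E * W + 1) (E * W) n (Z.to_nat (- D))) as Hc.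
    rewrite Z2Nat.id in Hc by lia.
    apply Z.le_trans with (E * W + 1 + E * W + - D); [|lia].
    eapply Z.le_trans; [|apply Hc; nia].
    apply zsum_le. intros al Hal. unfold window.
    replace (al * - D) with (- (al * D)) by ring.
    pose proof (Z.mod_pos_bound (al * D) (Z.of_nat n) ltac:(lia)).
    destruct (Z.eq_dec ((al * D) mod Z.of_nat n) 0) as [E0 | N0].
    + rewrite Z.mod_opp_l_z by (assumption || lia).
      destruct (Z.ltb_spec 0 (E * W + 1)); [|nia]. cbn [orb]; destruct (_ || _); cbn [orb Z.b2z]; lia.
    + rewrite Z.mod_opp_l_nz by (assumption || lia).
      set (r := (al * D) mod Z.of_nat n) in *.
      destruct (Z.ltb_spec r (E * W)), (Z.leb_spec (Z.of_nat n - E * W) r),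
        (Z.ltb_spec (Z.of_nat n - r) (E * W + 1)),
        (Z.leb_spec (Z.of_nat n - E * W) (Z.of_nat n - r)); cbn; lia.
Qed.

(** * Averaging over the random strings *)

Definition horner (l : list bool) : Z := fold_left (fun acc b => 2 * acc + Z.b2z b) l 0.

Lemma horner_snoc l b : horner (l ++ [b]) = 2 * horner l + Z.b2z b.
Proof. unfold horner. now rewrite fold_left_app. Qed.

Lemma horner_range l : 0 <= horner l < 2 ^ Z.of_nat (length l).
Proof.
  induction l as [|b l IH] using rev_ind; [cbn; lia|].
  rewrite horner_snoc, length_app, Nat2Z.inj_add, Z.pow_add_r by lia.
  change (2 ^ Z.of_nat (length [b])) with 2. destruct b; cbn [Z.b2z]; lia.
Qed.

Lemma horner_surj n : forall v, 0 <= v < 2 ^ Z.of_nat n ->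
  exists l, length l = n /\ horner l = v.
Proof.
  induction n as [|n IH]; intros v Hv.
  - exists []. cbn in *. split; lia.
  - rewrite Nat2Z.inj_succ, Z.pow_succ_r in Hv by lia.
    pose proof (Z.div_mod v 2 ltac:(lia)). pose proof (Z.mod_pos_bound v 2 ltac:(lia)).
    destruct (IH (v / 2) ltac:(lia)) as (l & Hl & E).
    exists (l ++ [v mod 2 =? 1]). rewrite length_app, horner_snoc, E. cbn [length].
    split; [lia|]. destruct (Z.eqb_spec (v mod 2) 1); cbn [Z.b2z]; lia.
Qed.

(** New bits go to the end, so that the last bit of [horner] matches the inner index in
    [zsum_blocks]. *)
Fixpoint bitstrings (n : nat) : list (list bool) :=
  match n with
  | O => [[]]
  | S n => flat_map (fun l => [l ++ [false]; l ++ [true]]) (bitstrings n)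
  end.

Lemma in_bitstrings n : forall l, In l (bitstrings n) -> length l = n.
Proof.
  induction n as [|n IH]; simpl; intros l Hl; [now destruct Hl as [<- | []]|].
  apply in_flat_map in Hl as (l' & Hl' & [<- | [<- | []]]);
    rewrite length_app, (IH l' Hl'); simpl; lia.
Qed.

Lemma bitstrings_nodup n : NoDup (bitstrings n).
Proof.
  induction n as [|n IH]; simpl; [repeat constructor; intros []|].
  induction IH as [|l L Hl HL IHL]; simpl; [constructor|].
  assert (Hx : forall b, In (l ++ [b]) (flat_map (fun l => [l ++ [false]; l ++ [true]]) L) -> False).
  { intros b Hb. apply in_flat_map in Hb as (l' & Hl' & [E | [E | []]]);
      apply app_inj_tail in E as [-> _]; auto. }
  constructor; [|constructor; auto].
  - intros [E | Hb]; [|eauto]. apply app_inj_tail in E as [_ E]. discriminate.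
  - intro Hb; eauto.
Qed.

Definition lsum {A : Type} (f : A -> Z) (l : list A) : Z :=
  fold_right (fun x acc => f x + acc) 0 l.

Lemma lsum_le {A} (f g : A -> Z) l :
  (forall x, In x l -> f x <= g x) -> lsum f l <= lsum g l.
Proof.
  induction l as [|x l IH]; simpl; intro Hfg; [lia|].
  pose proof (Hfg x (or_introl eq_refl)). pose proof (IH (fun y Hy => Hfg y (or_intror Hy))). lia.
Qed.

Lemma lsum_plus {A} (f g : A -> Z) l : lsum (fun x => f x + g x) l = lsum f l + lsum g l.
Proof. induction l; simpl; lia. Qed.

Lemma lsum_scale {A} c (f : A -> Z) l : lsum (fun x => c * f x) l = c * lsum f l.
Proof. induction l; simpl; lia. Qed.

Lemma lsum_const {A} c (l : list A) : lsum (fun _ => c) l = Z.of_nat (length l) * c.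
Proof. induction l; simpl lsum; simpl length; lia. Qed.

Lemma lsum_swap {A B} (f : A -> B -> Z) l1 l2 :
  lsum (fun x => lsum (f x) l2) l1 = lsum (fun y => lsum (fun x => f x y) l1) l2.
Proof.
  induction l1 as [|x l1 IH]; simpl.
  - rewrite lsum_const. lia.
  - rewrite IH, <- lsum_plus. reflexivity.
Qed.

Lemma lsum_map {A B} (f : B -> Z) (h : A -> B) l : lsum f (map h l) = lsum (fun x => f (h x)) l.
Proof. induction l; simpl; auto. now rewrite IHl. Qed.

Lemma lsum_rev {A} (f : A -> Z) l : lsum f (rev l) = lsum f l.
Proof.
  assert (Happ : forall l1 l2, lsum f (l1 ++ l2) = lsum f l1 + lsum f l2)
    by (induction l1; intro; simpl; rewrite ?IHl1; lia).
  induction l; simpl; auto. rewrite Happ, IHl. simpl. lia.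
Qed.

Lemma length_flat_map_lsum {A B} (f : A -> list B) l :
  Z.of_nat (length (flat_map f l)) = lsum (fun x => Z.of_nat (length (f x))) l.
Proof. induction l; simpl; auto. rewrite length_app, Nat2Z.inj_add. lia. Qed.

Lemma length_filter_lsum {A} (f : A -> bool) l :
  Z.of_nat (length (filter f l)) = lsum (fun x => Z.b2z (f x)) l.
Proof. induction l; simpl; auto. destruct (f a); cbn [length Z.b2z]; lia. Qed.

(** A uniform bit string is a uniform multiplier: [horner] is a bijection onto the integers from 0
    to 2^n - 1, used here in summed form. *)
Lemma lsum_bitstrings n : forall f : Z -> Z,
  lsum (fun l => f (horner l)) (bitstrings n) = zsum f (2 ^ n).
Proof.
  induction n as [|n IH]; intro f; [cbn; lia|].
  rewrite Nat.pow_succ_r', Nat.mul_comm, zsum_blocks, <- IH. simpl bitstrings. clear IH.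
  induction (bitstrings n) as [|l L IHL]; simpl flat_map; auto.
  cbn [lsum fold_right app] in *. unfold lsum in IHL. rewrite IHL, !horner_snoc.
  cbn [zsum Z.b2z]. change (Z.of_nat 2) with 2. change (Z.of_nat 0) with 0.
  change (Z.of_nat 1) with 1. rewrite !(Z.mul_comm (horner l) 2). lia.
Qed.

Lemma bitstrings_length n : Z.of_nat (length (bitstrings n)) = 2 ^ Z.of_nat n.
Proof.
  rewrite <- (Z.mul_1_r (Z.of_nat _)), <- lsum_const, (lsum_bitstrings n (fun _ => 1)).
  rewrite zsum_const, Nat2Z.inj_pow. lia.
Qed.

(** An entry with [h] above [T] is worth more than [T], while the total allows only a third of [T]
    per entry; so at most a third of the entries are of this kind. *)
Lemma markov {A} (h : A -> Z) (T : Z) (l : list A) : 0 < T ->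
  (forall x, In x l -> 0 <= h x) -> 3 * lsum h l <= T * Z.of_nat (length l) ->
  2 * Z.of_nat (length l) <= 3 * Z.of_nat (length (filter (fun x => h x <=? T) l)).
Proof.
  intros HT Hh Hs.
  assert (Hm : lsum (fun x => T * (1 - Z.b2z (h x <=? T))) l <= lsum h l).
  { apply lsum_le. intros x Hx. pose proof (Hh x Hx).
    destruct (Z.leb_spec (h x) T); cbn [Z.b2z]; lia. }
  rewrite lsum_scale in Hm.
  assert (Hc : lsum (fun x => 1 - Z.b2z (h x <=? T)) l
    = Z.of_nat (length l) - Z.of_nat (length (filter (fun x => h x <=? T) l))).
  { rewrite length_filter_lsum. clear. unfold lsum. induction l; cbn [fold_right length]; lia. }
  rewrite Hc in Hm. nia.
Qed.

(** * The protocol *)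

(** After the [n / 4] bits of the key at least [(c + 3) * n] bits remain, so that [W] exceeds
    [2 * n * 2 ^ (c * n)], a bound on the differences of the sums compared. *)
Definition rlen (c n : nat) : nat := ((c + 4) * n)%nat.

Definition seg (lo hi : nat) (a : list Z) : list Z := firstn (hi - lo) (skipn lo a).

Lemma seg_length lo hi a : (lo <= hi)%nat -> (hi <= length a)%nat -> length (seg lo hi a) = (hi - lo)%nat.
Proof. intros. unfold seg. rewrite length_firstn, length_skipn. lia. Qed.

Lemma seg_in lo hi a x : In x (seg lo hi a) -> In x a.
Proof.
  intro Hx. rewrite <- (firstn_skipn lo a), in_app_iff. right.
  rewrite <- (firstn_skipn (hi - lo) (skipn lo a)), in_app_iff. auto.
Qed.

Lemma seg_split lo mid hi a : (lo <= mid)%nat -> (mid <= hi)%nat ->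
  seg lo hi a = seg lo mid a ++ seg mid hi a.
Proof.
  intros H1 H2. unfold seg.
  rewrite <- (firstn_skipn (mid - lo) (firstn (hi - lo) (skipn lo a))).
  rewrite firstn_firstn, skipn_firstn_comm, skipn_skipn.
  replace (Nat.min (mid - lo) (hi - lo)) with (mid - lo)%nat by lia.
  replace (mid - lo + lo)%nat with mid by lia.
  now replace (hi - lo - (mid - lo))%nat with (hi - mid)%nat by lia.
Qed.

Lemma seg_all a : seg 0 (length a) a = a.
Proof. unfold seg. simpl. rewrite Nat.sub_0_r. apply firstn_all. Qed.

(* The last quarter also receives the remainder of [length a] modulo 4. *)
Definition quarter (a : list Z) (i : nat) : list Z :=
  let q := (length a / 4)%nat in
  seg (i * q) (if Nat.eqb i 3 then length a else (i + 1) * q)%nat a.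

Definition left_hits (Q : Z) (kf : Z -> Z) (a : list Z) (s : Z) : list Z :=
  hits Q s 1 (items Q kf (quarter a 0)) (items Q kf (quarter a 1)).

Definition right_hits (Q : Z) (kf : Z -> Z) (a : list Z) (t s : Z) : list Z :=
  hits Q (kf t - s) (S (length a)) (items Q kf (quarter a 2)) (items Q kf (quarter a 3)).

(** The factor is a power of two, which the machine produces by seven doublings; [average_le_cutoff]
    shows that it is large enough. *)
Definition cutoff (n : nat) (Q : Z) : Z := 128 * (Z.of_nat n + 1) * (Z.of_nat n + 1) * Q.

(** A sufficient condition for the program to accept. The program stops at its first match, so it
    may also accept when the total number of hits passes the cutoff. The bound on [t] holds for all
    solvable instances and lets one addition reduce [t] modulo [Q * W]. *)
Definition accepts (Q W : Z) (kf : Z -> Z) (a : list Z) (t s : Z) : Prop :=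
  Z.abs t < Q * W /\
  Z.of_nat (length (left_hits Q kf a s) + length (right_hits Q kf a t s))
    <= cutoff (length a) Q /\
  exists v, In v (left_hits Q kf a s) /\ In (t - v) (right_hits Q kf a t s).

Lemma quarters a :
  a = quarter a 0 ++ quarter a 1 ++ quarter a 2 ++ quarter a 3.
Proof.
  pose proof (Nat.div_mod_eq (length a) 4).
  unfold quarter. simpl Nat.eqb. cbv iota zeta.
  set (q := (length a / 4)%nat) in *. simpl Nat.mul. simpl Nat.add. rewrite !Nat.add_0_r.
  rewrite <- (seg_split (q + q)) by lia.
  rewrite <- (seg_split q) by lia.
  rewrite <- (seg_split 0) by lia. now rewrite seg_all.
Qed.

Lemma quarter_length a i : (i < 4)%nat ->
  length (quarter a i) = (if Nat.eqb i 3 then length a - 3 * (length a / 4) else length a / 4)%nat.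
Proof.
  intro Hi. pose proof (Nat.div_mod_eq (length a) 4).
  unfold quarter. cbv zeta.
  destruct i as [|[|[|[|i]]]]; try lia; simpl Nat.eqb; cbv iota; rewrite seg_length; lia.
Qed.

Lemma quarter_in a i x : In x (quarter a i) -> In x a.
Proof. apply seg_in. Qed.

Lemma subset_sum_quarters a t :
  subset_sum a t <->
  exists m0 m1 m2 m3,
    length m0 = length (quarter a 0) /\ length m1 = length (quarter a 1) /\
    length m2 = length (quarter a 2) /\ length m3 = length (quarter a 3) /\
    msum m0 (quarter a 0) + msum m1 (quarter a 1)
      + (msum m2 (quarter a 2) + msum m3 (quarter a 3)) = t.
Proof.
  pose proof (quarters a) as Ha. revert Ha.
  generalize (quarter a 0) (quarter a 1) (quarter a 2) (quarter a 3).
  intros l0 l1 l2 l3 ->. unfold subset_sum. split.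
  - intros (m & Hm & Ht). fold (msum m (l0 ++ l1 ++ l2 ++ l3)) in Ht.
    rewrite !length_app in Hm.
    rewrite <- (firstn_skipn (length l0) m) in Ht.
    rewrite <- (firstn_skipn (length l1) (skipn (length l0) m)) in Ht.
    rewrite <- (firstn_skipn (length l2) (skipn (length l1) (skipn (length l0) m))) in Ht.
    rewrite !msum_app in Ht by (rewrite length_firstn, ?length_skipn; lia).
    eexists _, _, _, _.
    split; [|split; [|split; [|split; [|rewrite <- Ht, !Z.add_assoc; reflexivity]]]].
    all: rewrite ?length_firstn, ?length_skipn; lia.
  - intros (m0 & m1 & m2 & m3 & H0 & H1 & H2 & H3 & Ht).
    exists (m0 ++ m1 ++ m2 ++ m3). rewrite !length_app. split; [lia|].
    fold (msum (m0 ++ m1 ++ m2 ++ m3) (l0 ++ l1 ++ l2 ++ l3)).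
    rewrite !msum_app by auto. lia.
Qed.

(** Keys only filter the pairs. The values are true subset sums of disjoint quarters, whatever the
    random string and the proof are. *)
Lemma accepts_sound Q kf a t s v :
  In v (left_hits Q kf a s) -> In (t - v) (right_hits Q kf a t s) -> subset_sum a t.
Proof.
  unfold left_hits, right_hits. intros HL HR. apply in_hits in HL as (e & p0 & p1 & _ & H0 & H1 & _ & Hv).
  apply in_hits in HR as (e' & p2 & p3 & _ & H2 & H3 & _ & Hv').
  apply subset_sum_quarters.
  apply items_sound in H0 as (m0 & L0 & E0). apply items_sound in H1 as (m1 & L1 & E1).
  apply items_sound in H2 as (m2 & L2 & E2). apply items_sound in H3 as (m3 & L3 & E3).
  exists m0, m1, m2, m3. repeat split; auto. lia.
Qed.

(** Computed with a trivial hash; by [items_values] every other hash gives the same list. *)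
Definition values (l : list Z) : list Z := map fst (items 1 (fun _ => 0) l).

Lemma map_fst_items Q kf l : map fst (items Q kf l) = values l.
Proof. apply items_values. Qed.

(** The first alternative singles out the sum [sigma] itself, which is counted for every multiplier;
    for all other sums closeness is a rare event. *)
Definition close (E Q W sigma al v : Z) : bool := (v =? sigma) || near E Q W (al * (v - sigma)).

Definition close_pairs (E Q W sigma al : Z) (l1 l2 : list Z) : Z :=
  lsum (fun x => lsum (fun y => Z.b2z (close E Q W sigma al (x + y))) (values l2)) (values l1).

(** For a fixed carry [e] each pair of entries is met at most once, and only if its sum passes
    [ok]. *)
Lemma hits_length Q tau E L1 L2 (ok : Z -> bool) :
  (forall e p1 p2, (e < E)%nat -> In p1 L1 -> In p2 L2 ->
     snd p2 = (tau - Z.of_nat e - snd p1) mod Q -> ok (fst p1 + fst p2) = true) ->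
  Z.of_nat (length (hits Q tau E L1 L2)) <=
  Z.of_nat E * lsum (fun x => lsum (fun y => Z.b2z (ok (x + y))) (map fst L2)) (map fst L1).
Proof.
  intro Hok. unfold hits. rewrite length_flat_map_lsum, lsum_rev.
  rewrite <- (length_seq E 0) at 2. rewrite <- lsum_const. apply lsum_le.
  intros e He. apply in_seq in He. unfold sweep. rewrite length_flat_map_lsum, lsum_rev, lsum_map.
  apply lsum_le. intros p1 H1. unfold row. rewrite length_map, length_filter_lsum, lsum_map.
  apply lsum_le. intros p2 H2.
  destruct (Z.eqb_spec (snd p2) ((tau - Z.of_nat e - snd p1) mod Q)) as [Hk | _].
  - rewrite (Hok e p1 p2); auto; lia.
  - destruct (ok _); cbn; lia.
Qed.

(* Two pairs whose keys add up to almost the same residue have hashed sums that are almost equal,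
   because a sum of keys determines the hash of the sum up to the rounding errors. *)
Lemma hits_close al Q W tau E n e0 l1 l2 q1 q2 :
  0 < Q -> 0 < W -> (0 < n)%nat -> (E <= S n)%nat -> (length l1 + length l2 <= n)%nat ->
  In q1 (items Q (key al Q W) l1) -> In q2 (items Q (key al Q W) l2) ->
  (e0 < E)%nat -> snd q2 = (tau - Z.of_nat e0 - snd q1) mod Q ->
  Z.of_nat (length (hits Q tau E (items Q (key al Q W) l1) (items Q (key al Q W) l2))) <=
  Z.of_nat E * close_pairs (2 * Z.of_nat n) Q W (fst q1 + fst q2) al l1 l2.
Proof.
  intros HQ HW Hn HE Hl Hq1 Hq2 He0 Hk0.
  eapply Z.le_trans; [eapply hits_length with (ok := close (2 * Z.of_nat n) Q W (fst q1 + fst q2) al)|].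
  2: { rewrite !map_fst_items. reflexivity. }
  intros e p1 p2 He Hp1 Hp2 Hk. unfold close. apply orb_true_iff. right.
  apply items_key_spec in Hp1 as (r1 & j1 & Hr1 & E1); auto.
  apply items_key_spec in Hp2 as (r2 & j2 & Hr2 & E2); auto.
  apply items_key_spec in Hq1 as (r3 & j3 & Hr3 & E3); auto.
  apply items_key_spec in Hq2 as (r4 & j4 & Hr4 & E4); auto.
  set (u := tau - Z.of_nat e - snd p1) in *. set (u0 := tau - Z.of_nat e0 - snd q1) in *.
  pose proof (Z.div_mod u Q ltac:(lia)) as Hd. pose proof (Z.div_mod u0 Q ltac:(lia)) as Hd0.
  (* The hashed sums differ by [W] times the difference of the two carries, at most [n * W] in size,
     and by the rounding errors, at most [n * (W - 1)] in size. This is where the width [2 * n]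
     comes from. *)
  apply near_intro with
    (y := W * (Z.of_nat e0 - Z.of_nat e) + (r1 + r2 - r3 - r4))
    (j := j1 + j2 - j3 - j4 - u / Q + u0 / Q); auto.
  - assert (Hr12 : 0 <= r1 + r2 <= Z.of_nat n * (W - 1)) by nia.
    assert (Hr34 : 0 <= r3 + r4 <= Z.of_nat n * (W - 1)) by nia.
    assert (W * (Z.of_nat e0 - Z.of_nat e) <= W * Z.of_nat n) by (apply Z.mul_le_mono_nonneg_l; lia).
    assert (W * - Z.of_nat n <= W * (Z.of_nat e0 - Z.of_nat e)) by (apply Z.mul_le_mono_nonneg_l; lia).
    lia.
  - rewrite Z.mul_sub_distr_l, !Z.mul_add_distr_l, E1, E2, E3, E4, Hk, Hk0.
    replace (u mod Q) with (u - Q * (u / Q)) by lia.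
    replace (u0 mod Q) with (u0 - Q * (u0 / Q)) by lia.
    unfold u at 1, u0 at 1. ring.
Qed.

Lemma lsum_eqb_le (V : list Z) v : NoDup V -> lsum (fun y => Z.b2z (y =? v)) V <= 1.
Proof.
  induction 1 as [|y V Hy HV IH]; cbn [lsum fold_right]; [lia|].
  fold (lsum (fun y => Z.b2z (y =? v)) V).
  destruct (Z.eqb_spec y v) as [-> |]; cbn [Z.b2z]; [|lia].
  enough (lsum (fun y => Z.b2z (y =? v)) V <= lsum (fun _ => 0) V) by (rewrite lsum_const in *; lia).
  apply lsum_le. intros y Hin. destruct (Z.eqb_spec y v); cbn; [congruence | lia].
Qed.

(** For each [x] only [y = sigma - x] can count for all [Q * W] strings, and it occurs once since
    values are distinct. Any other [y] counts for at most [(2 * E + 1) * W] strings, by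
    [count_near]. *)
Lemma close_pairs_average E Q W sigma w l1 l2 :
  0 <= E -> 0 < Q -> 0 < W -> 2 ^ Z.of_nat w = Q * W ->
  (forall x y, In x (values l1) -> In y (values l2) -> Z.abs (x + y - sigma) < W) ->
  lsum (fun rho => close_pairs E Q W sigma (horner rho) l1 l2) (bitstrings w) <=
  Z.of_nat (length (values l1)) * (Q * W
    + Z.of_nat (length (values l2)) * ((2 * E + 1) * W)).
Proof.
  intros HE HQ HW Hw Hb. unfold close_pairs. rewrite lsum_swap, <- lsum_const.
  apply lsum_le. intros x Hx. rewrite lsum_swap.
  eapply Z.le_trans with (lsum (fun y => (Q * W) * Z.b2z (y =? sigma - x) + (2 * E + 1) * W) (values l2)).
  - apply lsum_le. intros y Hy. unfold close.
    destruct (Z.eqb_spec (x + y) sigma) as [Es | Es], (Z.eqb_spec y (sigma - x)) as [Ey | Ey];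
      try lia; cbn [orb Z.b2z].
    + rewrite lsum_const, bitstrings_length, Hw. nia.
    + rewrite Z.mul_0_r.
      rewrite (lsum_bitstrings w (fun al => Z.b2z (near E Q W (al * (x + y - sigma))))).
      apply count_near; auto; [|lia]. rewrite Nat2Z.inj_pow. exact Hw.
  - rewrite lsum_plus, lsum_scale, lsum_const.
    pose proof (lsum_eqb_le (values l2) (sigma - x) (items_nodup _ _ _)). nia.
Qed.

Lemma values_sum_bound l1 l2 x y n B :
  (forall z, In z l1 -> Z.abs z <= B) -> (forall z, In z l2 -> Z.abs z <= B) -> 0 <= B ->
  (length l1 + length l2 <= n)%nat -> In x (values l1) -> In y (values l2) ->
  Z.abs (x + y) <= Z.of_nat n * B.
Proof.
  intros H1 H2 HB Hl Hx Hy.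
  apply in_map_iff in Hx as (p1 & <- & Hp1). apply in_map_iff in Hy as (p2 & <- & Hp2).
  pose proof (items_bound _ _ _ _ _ H1 Hp1). pose proof (items_bound _ _ _ _ _ H2 Hp2). nia.
Qed.

Lemma Zmod_shift Q a k j : 0 <= k < Q -> a = k + Q * j -> k = a mod Q.
Proof. intros Hk ->. rewrite Z.mul_comm, Z.mod_add, Z.mod_small; lia. Qed.

(* The keys of the parts of a solution add up to the key of [t] up to a carry. *)
Lemma key_carry Q W al t n k r j : 0 < Q -> 0 < W -> (0 < n)%nat ->
  0 <= r <= Z.of_nat n * (W - 1) -> al * t = W * k + r + Q * W * j ->
  exists e i, (e < S n)%nat /\ key al Q W t = k + Z.of_nat e + Q * i.
Proof.
  intros HQ HW Hn Hr E.
  destruct (key_spec al Q W t HQ HW) as (r1 & j1 & Hr1 & E1).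
  set (kt := key al Q W t) in *.
  set (e := kt - k + Q * (j1 - j)).
  (* From [0 <= r <= n * (W - 1)] and [0 <= r1 < W] it follows that [e] is greater than -1 and at
     most [n]. *)
  assert (He : W * e = r - r1) by (unfold e; lia).
  assert (0 <= e <= Z.of_nat n) by nia.
  exists (Z.to_nat e), (j - j1). split; [lia|]. rewrite Z2Nat.id by lia. unfold e. lia.
Qed.

Lemma pow2_ge_succ n : Z.of_nat n + 1 <= 2 ^ Z.of_nat n.
Proof.
  induction n as [|n IH]; [cbn; lia|]. rewrite Nat2Z.inj_succ, Z.pow_succ_r; lia.
Qed.

Lemma item_of_mask Q kf l mask : length mask = length l ->
  exists p, In p (items Q kf l) /\ fst p = msum mask l.
Proof.
  intro Hl. pose proof (items_complete Q kf l mask Hl) as Hv.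
  apply in_map_iff in Hv as (p & Hp & Hin). eauto.
Qed.

Lemma values_length l : Z.of_nat (length (values l)) <= 2 ^ Z.of_nat (length l).
Proof.
  unfold values. rewrite length_map.
  change 2 with (Z.of_nat 2). rewrite <- Nat2Z.inj_pow. apply inj_le. apply items_length.
Qed.

Lemma close_pairs_average_le n E Q W B sigma w l1 l2 k :
  0 <= E -> 0 < Q -> 0 < W -> 2 ^ Z.of_nat w = Q * W -> 0 <= B -> 2 * Z.of_nat n * B < W ->
  Z.abs sigma <= Z.of_nat n * B ->
  (forall x, In x l1 -> Z.abs x <= B) -> (forall x, In x l2 -> Z.abs x <= B) ->
  (length l1 + length l2 <= n)%nat ->
  Z.of_nat (length (values l1)) <= Q -> Z.of_nat (length (values l2)) <= k ->
  lsum (fun rho => close_pairs E Q W sigma (horner rho) l1 l2) (bitstrings w) <=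
  Q * (Q * W + k * ((2 * E + 1) * W)).
Proof.
  intros HE HQ HW HM HB HBW Hs H1 H2 Hl V1 V2.
  assert (HEW : 0 <= (2 * E + 1) * W) by (apply Z.mul_nonneg_nonneg; lia).
  assert (HQW : 0 <= Q * W) by (apply Z.mul_nonneg_nonneg; lia).
  eapply Z.le_trans; [apply close_pairs_average; auto|].
  - intros x y Hx Hy. pose proof (values_sum_bound l1 l2 x y n B H1 H2 HB Hl Hx Hy). lia.
  - apply Z.mul_le_mono_nonneg; [lia | assumption | |].
    + apply Z.add_nonneg_nonneg; [|apply Z.mul_nonneg_nonneg]; lia.
    + apply Z.add_le_mono_l, Z.mul_le_mono_nonneg_r; assumption.
Qed.

(** The 3 is that of Markov's inequality. The first summand is the left side, with at most [Q] sums
    in its second list; the other is the right side, with [N + 1] carries and at most [8 * Q] sums.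
    The windows have [E = 2 * N]. *)
Lemma average_le_cutoff N Q W : 0 <= N -> 0 < Q -> 0 < W ->
  3 * (Q * (Q * W + Q * ((2 * (2 * N) + 1) * W)) +
      (N + 1) * (Q * (Q * W + 8 * Q * ((2 * (2 * N) + 1) * W))))
  <= 128 * (N + 1) * (N + 1) * Q * (Q * W).
Proof.
  intros HN HQ HW.
  assert (Hp : 3 * ((4 * N + 2) + (N + 1) * (32 * N + 9)) <= 128 * (N + 1) * (N + 1)) by nia.
  apply Z.mul_le_mono_nonneg_r with (p := Q * (Q * W)) in Hp; [lia | nia].
Qed.

(** One solution is fixed before the random string is drawn, and the good strings are those for
    which few pairs are close to its two partial sums. The proof for a good string is then read off
    from the keys of the four parts. *)
Lemma protocol_complete c a t :
  let n := length a in
  let q := (n / 4)%nat in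
  let w := rlen c n in
  let Q := 2 ^ Z.of_nat q in
  let W := 2 ^ Z.of_nat (w - q) in
  (0 < n)%nat ->
  (forall x, In x a -> Z.abs x <= 2 ^ Z.of_nat (c * n)) ->
  subset_sum a t ->
  exists S : list (list bool), NoDup S /\
    (forall rho, In rho S -> length rho = w /\
       exists pi, length pi = q /\ accepts Q W (key (horner rho) Q W) a t (horner pi)) /\
    (3 * length S >= 2 * 2 ^ w)%nat.
Proof.
  intros n q w Q W Hn Ha Hsum.
  pose proof (Nat.div_mod_eq n 4) as Hq. pose proof (Nat.mod_upper_bound n 4 ltac:(lia)) as Hq4.
  fold q in Hq.
  assert (Hw : (c * n + 3 * n <= w - q)%nat) by (unfold w, rlen; nia).
  assert (HQ : 0 < Q) by (apply Z.pow_pos_nonneg; lia).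
  assert (HW : 0 < W) by (apply Z.pow_pos_nonneg; lia).
  assert (HM : 2 ^ Z.of_nat w = Q * W).
  { unfold Q, W. rewrite <- Z.pow_add_r by lia. f_equal. unfold w, rlen in *. lia. }
  set (B := 2 ^ Z.of_nat (c * n)) in *.
  assert (HQW : 0 < Q * W) by nia.
  assert (HWQ : W <= Q * W) by nia.
  assert (HB : 0 < B) by (apply Z.pow_pos_nonneg; lia).
  assert (HBW : 2 * Z.of_nat n * B < W).
  { apply Z.lt_le_trans with (2 ^ Z.of_nat (c * n + 3 * n)).
    - replace (Z.of_nat (c * n + 3 * n))
        with (Z.of_nat (c * n) + (Z.of_nat n + (Z.of_nat n + Z.of_nat n))) by lia.
      rewrite !Z.pow_add_r by lia. fold B.
      pose proof (pow2_ge_succ n). set (p := 2 ^ Z.of_nat n) in *.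
      assert (2 * Z.of_nat n < p * (p * p)) by nia. nia.
    - apply Z.pow_le_mono_r; lia. }
  pose proof (fun i x (H : In x (quarter a i)) => Ha x (quarter_in a i x H)) as Hqb.
  pose proof Hsum as Hs.
  apply subset_sum_quarters in Hs as (m0 & m1 & m2 & m3 & L0 & L1 & L2 & L3 & Hs).
  set (l0 := quarter a 0) in *. set (l1 := quarter a 1) in *.
  set (l2 := quarter a 2) in *. set (l3 := quarter a 3) in *.
  assert (Z0 : length l0 = q) by (apply quarter_length; lia).
  assert (Z1 : length l1 = q) by (apply quarter_length; lia).
  assert (Z2 : length l2 = q) by (apply quarter_length; lia).
  assert (Z3 : length l3 = (n - 3 * q)%nat) by (apply quarter_length; lia).
  assert (Hlen : (length l0 + (length l1 + (length l2 + length l3)) = n)%nat) by lia.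
  set (sL := msum m0 l0 + msum m1 l1) in *. set (sR := msum m2 l2 + msum m3 l3) in *.
  assert (Hval : forall i m, length m = length (quarter a i) -> In (msum m (quarter a i)) (values (quarter a i)))
    by (intros; apply items_complete; auto).
  assert (HsL : Z.abs sL <= Z.of_nat n * B).
  { apply values_sum_bound with (l1 := l0) (l2 := l1); try (apply (Hval 0%nat) || apply (Hval 1%nat));
      auto; try lia; try apply (Hqb 0%nat); apply (Hqb 1%nat). }
  assert (HsR : Z.abs sR <= Z.of_nat n * B).
  { apply values_sum_bound with (l1 := l2) (l2 := l3); try (apply (Hval 2%nat) || apply (Hval 3%nat));
      auto; try lia; try apply (Hqb 2%nat); apply (Hqb 3%nat). }
  set (E := 2 * Z.of_nat n).
  (* By [hits_close] this bounds the total number of hits against the honest proof. The right side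
     is weighted by its [n + 1] carries; the left side has none. *)
  set (h := fun rho => close_pairs E Q W sL (horner rho) l0 l1
                       + (Z.of_nat n + 1) * close_pairs E Q W sR (horner rho) l2 l3).
  assert (Hnn : forall rho, 0 <= h rho).
  { assert (Hc : forall s al k1 k2, 0 <= close_pairs E Q W s al k1 k2).
    { intros s al k1 k2. unfold close_pairs.
      rewrite <- (Z.mul_0_r (Z.of_nat (length (values k1)))), <- lsum_const.
      apply lsum_le. intros x _.
      rewrite <- (Z.mul_0_r (Z.of_nat (length (values k2)))), <- lsum_const.
      apply lsum_le. intros y _. destruct (close _ _ _ _ _ _); cbn; lia. }
    intro rho. unfold h.
    pose proof (Hc sL (horner rho) l0 l1). pose proof (Hc sR (horner rho) l2 l3). nia. }
  assert (HT : 0 < cutoff n Q) by (unfold cutoff; apply Z.mul_pos_pos; lia).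
  assert (Havg : 3 * lsum h (bitstrings w) <= cutoff n Q * Z.of_nat (length (bitstrings w))).
  { rewrite bitstrings_length, HM. unfold h. rewrite lsum_plus, lsum_scale.
    pose proof (values_length l0) as V0. pose proof (values_length l1) as V1.
    pose proof (values_length l2) as V2. pose proof (values_length l3) as V3.
    rewrite Z0 in V0. rewrite Z1 in V1. rewrite Z2 in V2. fold Q in V0, V1, V2.
    (* The last quarter has at most [q + 3] elements. *)
    assert (V3' : Z.of_nat (length (values l3)) <= 8 * Q).
    { eapply Z.le_trans; [exact V3|]. unfold Q. change 8 with (2 ^ 3).
      rewrite <- Z.pow_add_r by lia. apply Z.pow_le_mono_r; lia. }
    pose proof (close_pairs_average_le n E Q W B sL w l0 l1 Q ltac:(lia) HQ HW HM ltac:(lia)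
      ltac:(lia) HsL (Hqb 0%nat) (Hqb 1%nat) ltac:(lia) V0 V1) as B1.
    pose proof (close_pairs_average_le n E Q W B sR w l2 l3 (8 * Q) ltac:(lia) HQ HW HM ltac:(lia)
      ltac:(lia) HsR (Hqb 2%nat) (Hqb 3%nat) ltac:(lia) V2 V3') as B2.
    assert (B3 : (Z.of_nat n + 1) * lsum (fun rho => close_pairs E Q W sR (horner rho) l2 l3) (bitstrings w)
       <= (Z.of_nat n + 1) * (Q * (Q * W + (8 * Q) * ((2 * E + 1) * W))))
      by (apply Z.mul_le_mono_nonneg_l; lia).
    unfold cutoff, E in *. set (N := Z.of_nat n) in *.
    apply Z.le_trans with (3 * (Q * (Q * W + Q * ((2 * (2 * N) + 1) * W)) +
      (N + 1) * (Q * (Q * W + 8 * Q * ((2 * (2 * N) + 1) * W))))); [lia|].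
    apply average_le_cutoff; lia. }
  exists (filter (fun rho => h rho <=? cutoff n Q) (bitstrings w)).
  split; [|split].
  - apply NoDup_filter, bitstrings_nodup.
  - intros rho Hrho. apply filter_In in Hrho as [Hrho Hh]. apply Z.leb_le in Hh.
    split; [now apply in_bitstrings|].
    set (al := horner rho) in *. set (kf := key al Q W).
    destruct (item_of_mask Q kf l0 m0 L0) as (p0 & I0 & F0).
    destruct (item_of_mask Q kf l1 m1 L1) as (p1 & I1 & F1).
    destruct (item_of_mask Q kf l2 m2 L2) as (p2 & I2 & F2).
    destruct (item_of_mask Q kf l3 m3 L3) as (p3 & I3 & F3).
    pose proof (Z.div_mod (snd p0 + snd p1) Q ltac:(lia)) as Hd.
    set (s := (snd p0 + snd p1) mod Q) in *.
    assert (Hs0 : 0 <= s < Q) by (apply Z.mod_pos_bound; lia).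
    (* As [s] is below [Q = 2 ^ q], it is spelled with exactly [q] bits. *)
    destruct (horner_surj q s Hs0) as (pi & Hpi & Hps).
    exists pi. split; auto. rewrite Hps.
    assert (K1 : snd p1 = (s - Z.of_nat 0 - snd p0) mod Q).
    { apply Zmod_shift with (- ((snd p0 + snd p1) / Q)); [|lia].
      eapply items_key_range; eauto. }
    destruct (items_key_spec al Q W l0 p0 HQ HW I0) as (r0 & j0 & R0 & E0).
    destruct (items_key_spec al Q W l1 p1 HQ HW I1) as (r1 & j1 & R1 & E1).
    destruct (items_key_spec al Q W l2 p2 HQ HW I2) as (r2 & j2 & R2 & E2).
    destruct (items_key_spec al Q W l3 p3 HQ HW I3) as (r3 & j3 & R3 & E3).
    destruct (key_carry Q W al t n (snd p0 + snd p1 + snd p2 + snd p3) (r0 + r1 + r2 + r3)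
                (j0 + j1 + j2 + j3) HQ HW Hn) as (e & i & He & Hkt).
    { replace (Z.of_nat n) with (Z.of_nat (length l0) + Z.of_nat (length l1)
        + Z.of_nat (length l2) + Z.of_nat (length l3)) by lia.
      rewrite !Z.mul_add_distr_r. lia. }
    { rewrite <- Hs. unfold sL, sR. rewrite <- F0, <- F1, <- F2, <- F3.
      rewrite !Z.mul_add_distr_l, E0, E1, E2, E3. ring. }
    assert (K3 : snd p3 = (kf t - s - Z.of_nat e - snd p2) mod Q).
    { apply Zmod_shift with (i + (snd p0 + snd p1) / Q); [|unfold kf; lia].
      eapply items_key_range; eauto. }
    split; [|split].
    + lia.
    + unfold left_hits, right_hits. fold l0 l1 l2 l3 n.
      pose proof (hits_close al Q W s 1 n 0 l0 l1 p0 p1 HQ HW Hn ltac:(lia) ltac:(lia)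
        I0 I1 ltac:(lia) K1) as HL.
      pose proof (hits_close al Q W (kf t - s) (S n) n e l2 l3 p2 p3 HQ HW Hn ltac:(lia) ltac:(lia)
        I2 I3 He K3) as HR.
      rewrite F0, F1 in HL. rewrite F2, F3 in HR. fold sL in HL. fold sR in HR. fold E kf in HL, HR.
      unfold h in Hh. rewrite Nat2Z.inj_succ in HR. fold al in Hh. lia.
    + exists sL. split.
      * unfold left_hits. fold l0 l1. apply in_hits.
        exists 0%nat, p0, p1. repeat split; auto. rewrite F0, F1. reflexivity.
      * unfold right_hits. fold l2 l3 n. apply in_hits.
        exists e, p2, p3. repeat split; auto. rewrite F2, F3. unfold sL, sR in *. lia.
  - pose proof (markov h (cutoff n Q) (bitstrings w) HT (fun x _ => Hnn x) Havg) as Hmk.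
    rewrite bitstrings_length in Hmk.
    assert (Z.of_nat (2 ^ w) = 2 ^ Z.of_nat w) by apply Nat2Z.inj_pow. lia.
Qed.

(** * The verifier *)

(* Region 0 is a copy of the input, which starts at address [X]; region [r] is centred at the address
   [2 * G * r] and contains the offsets of absolute value less than [G]. *)
Definition base (X G : Z) (r : nat) : Z :=
  match r with O => X | _ => 2 * G * Z.of_nat r end.

Definition breg (r : nat) : nat := match r with O => 0 | _ => 40 + r end.

Definition in_region (X G : Z) (r : nat) (i : Z) : Prop :=
  match r with O => 0 <= i < X | _ => (r <= 18)%nat /\ Z.abs i < G end.

Definition rd (X G : Z) (H : Z -> Z) (r : nat) (i : Z) : Z := H (base X G r + i).
Definition wr (X G : Z) (H : Z -> Z) (r : nat) (i v : Z) : Z -> Z := hset H (base X G r + i) v.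

(** Regions do not overlap: their centres are [2 * G] apart while offsets are smaller than [G], and
    the copy of the input ends before [2 * X], below all of them. *)
Lemma rd_wr X G H r i v r' j : 0 < X -> 2 * X <= G ->
  in_region X G r i -> in_region X G r' j ->
  rd X G (wr X G H r i v) r' j = if Nat.eqb r' r && (j =? i) then v else rd X G H r' j.
Proof.
  intros HX HG Hi Hj. unfold rd, wr, hset.
  destruct (Nat.eqb_spec r' r) as [-> | Hr]; simpl andb.
  - destruct (Z.eqb_spec (base X G r + j) (base X G r + i)), (Z.eqb_spec j i); auto; lia.
  - destruct (Z.eqb_spec (base X G r' + j) (base X G r + i)) as [E | _]; auto. exfalso.
    unfold base, in_region in *. destruct r as [|r], r' as [|r']; try lia; try nia.
Qed.

(** Register 1 is scratch space for the address. *)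
Definition LdR (d r a : nat) : cmd := Seq (Plus 1 (breg r) a) (Ld d 1).
Definition StR (r a s : nat) : cmd := Seq (Plus 1 (breg r) a) (St 1 s).
(* register 11 holds 0: both branches write [d] so that they leave states of the same shape *)
Definition condsub (d m : nat) : cmd := If d m (Plus d d 11) (Minus d d m).
Definition fixneg (d m : nat) : cmd := If d 11 (Plus d d m) (Plus d d 11).

Definition is_static (r : nat) : bool :=
  match r with
  | 0 | 2 | 3 | 4 | 5 | 6 | 7 | 8 | 9 | 10 | 11 | 12 | 15 | 16 | 17 | 18 => true
  | _ => Nat.leb 41 r && Nat.leb r 58
  end%nat.

Definition select (d x s : nat) : cmd := If 11 x (Plus d s 11) (Plus d 11 11).

Section Machine.

(** [X] is the address of the copy of the input, [G] the radius of the regions, [BB] the bound on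
    all values, and [D] what the final answer has to satisfy. *)
Variables (BB X G : Z) (D : bool -> Prop).
Variables (a : list Z) (t : Z) (rho pi : list bool).
Variables (n q w : nat) (Q W A_max : Z) (kf : Z -> Z).

Hypothesis n_def : length a = n.
Hypothesis n_pos : (0 < n)%nat.
Hypothesis q_def : q = (n / 4)%nat.
Hypothesis w_ge : (q <= w)%nat.
Hypothesis Q_def : Q = 2 ^ Z.of_nat q.
Hypothesis W_def : W = 2 ^ Z.of_nat (w - q).
Hypothesis rho_length : length rho = w.
Hypothesis pi_length : (length pi <= q)%nat.
Hypothesis kf_def : kf = key (horner rho) Q W.
Hypothesis a_bound : forall x, In x a -> Z.abs x <= A_max.
Hypothesis W_size : Z.of_nat n * A_max < W.
Hypothesis X_size : 64 <= X.
Hypothesis X_input : Z.of_nat (n + w + q) + 4 <= X.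
Hypothesis G_X : 2 * X <= G.
Hypothesis G_QW : 20 * (Q * W) <= G.
Hypothesis BB_G : 100 * G <= BB.
Hypothesis BB_cutoff : cutoff n Q <= BB.

Definition static_value (r : nat) : Z :=
  match r with
  | 0 => X
  | 2 => Z.of_nat n
  | 3 => Z.of_nat q
  | 4 => Q
  | 5 => Z.of_nat w
  | 6 => (Q * W)%Z
  | 7 => (W - 1)%Z
  | 8 => horner pi
  | 9 => t
  | 10 => 1%Z
  | 11 => 0%Z
  | 12 => cutoff n Q
  | 15 => (Z.of_nat n + 1)%Z
  | 16 => W
  | 17 => (2 * Z.of_nat q)%Z
  | 18 => (3 * Z.of_nat q)%Z
  | _ => (2 * G * (Z.of_nat r - 40))%Z
  end%nat.

Definition Env (R : nat -> Z) : Prop := forall r, is_static r = true -> R r = static_value r.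

Definition no_static (c : cmd) : bool := forallb (fun r => negb (is_static r)) (writes c).

Lemma Env_agree c0 R R' : no_static c0 = true -> agree c0 R R' -> Env R -> Env R'.
Proof.
  intros Hc Hag HE r Hr. rewrite <- (HE r Hr). apply Hag. unfold unwritten.
  destruct (existsb (Nat.eqb r) (writes c0)) eqn:Hex; auto. exfalso.
  apply existsb_exists in Hex as (r' & Hin & Heq). apply Nat.eqb_eq in Heq as <-.
  unfold no_static in Hc. rewrite forallb_forall in Hc. specialize (Hc r Hin).
  rewrite Hr in Hc. discriminate.
Qed.

Lemma Env_upd R d v : is_static d = false -> Env R -> Env (upd R d v).
Proof.
  intros Hd HE r Hr. unfold upd. destruct (Nat.eqb_spec r d); [congruence | auto].
Qed.

Lemma Env_base R r : (r <= 18)%nat -> Env R -> R (breg r) = base X G r.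
Proof.
  intros Hr HE. destruct r as [|r]; [apply (HE 0%nat eq_refl)|].
  unfold breg. rewrite (HE (40 + S r)%nat).
  - do 18 (destruct r as [|r]; [cbn; lia|]). lia.
  - do 18 (destruct r as [|r]; [reflexivity|]). lia.
Qed.

Notation wp := (wp BB D).
Notation rd := (rd X G).
Notation wr := (wr X G).
Notation in_region := (in_region X G).

Lemma Q_pos : 0 < Q.
Proof. rewrite Q_def. apply Z.pow_pos_nonneg; lia. Qed.

Lemma W_pos : 0 < W.
Proof. rewrite W_def. apply Z.pow_pos_nonneg; lia. Qed.

Lemma QW_ge : Q <= Q * W /\ W <= Q * W.
Proof. pose proof Q_pos. pose proof W_pos. nia. Qed.

Lemma A_max_range : 0 <= A_max < W.
Proof.
  destruct a as [|x a'] eqn:Ea; [simpl in n_def; lia|].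
  pose proof (a_bound x (or_introl eq_refl)). nia.
Qed.

Lemma in_region_le r i : in_region r i -> (r <= 18)%nat.
Proof. destruct r; simpl; lia. Qed.

Lemma in_region_base r i : in_region r i -> Z.of_nat nregs <= base X G r + i <= BB.
Proof.
  unfold in_region, base, nregs. destruct r as [|r]; intro Hi; [lia|]. nia.
Qed.

(** The content of the scratch register is generalized to an arbitrary [z], which keeps addresses
    out of later goals. *)
Lemma wp_ldR (P : post) d r x R H b :
  Env R -> in_region r (R x) -> 2 <= b ->
  (forall z, P (upd (upd R 1 z) d (rd H r (R x))) H (b - 2)) ->
  wp (LdR d r x) P R H b.
Proof.
  intros HE Hi Hb HP. specialize (HP (base X G r + R x)). pose proof (in_region_base _ _ Hi). pose proof (in_region_le _ _ Hi).
  unfold LdR. rewrite <- (Env_base R r) in * by auto. unfold nregs in *.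
  apply wp_seq, wp_add; [lia | lia |]. apply wp_ld; [lia | unfold nregs; cbn [upd Nat.eqb]; lia |].
  cbn [upd Nat.eqb]. unfold rd in HP. rewrite <- (Env_base R r) in HP by auto. now replace (b - 1 - 1) with (b - 2) by lia.
Qed.

Lemma wp_stR (P : post) r x s R H b :
  Env R -> in_region r (R x) -> 2 <= b -> Nat.eqb s 1 = false ->
  (forall z, P (upd R 1 z) (wr H r (R x) (R s)) (b - 2)) ->
  wp (StR r x s) P R H b.
Proof.
  intros HE Hi Hb Hs HP. specialize (HP (base X G r + R x)). pose proof (in_region_base _ _ Hi). pose proof (in_region_le _ _ Hi).
  unfold StR. rewrite <- (Env_base R r) in * by auto. unfold nregs in *.
  apply wp_seq, wp_add; [lia | lia |]. apply wp_st; [lia | unfold nregs; cbn [upd Nat.eqb]; lia |].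
  unfold wr in HP. rewrite <- (Env_base R r) in HP by auto.
  replace (upd R 1 (R (breg r) + R x) s) with (R s) by (unfold upd; now rewrite Hs).
  change (upd R 1 (R (breg r) + R x) 1%nat) with (R (breg r) + R x). now replace (b - 1 - 1) with (b - 2) by lia.
Qed.

(** The machine has no division, but below [2 * m] one conditional subtraction reduces modulo [m].
    The two branches take different times, hence the quantified budget. *)
Lemma wp_condsub (P : post) d m R H b : R 11%nat = 0 ->
  0 <= R d < 2 * R m -> R m <= BB -> 3 <= b ->
  (forall b', b - 3 <= b' -> P (upd R d (R d mod R m)) H b') -> wp (condsub d m) P R H b.
Proof.
  intros H0 Hd Hm Hb HP. apply wp_if; intro Hc.
  - apply wp_add; try lia. rewrite H0, Z.add_0_r.
    rewrite <- (Z.mod_small (R d) (R m)) at 1 by lia. apply HP. lia.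
  - apply wp_sub; try lia.
    replace (R d - R m) with (R d mod R m); [apply HP; lia|].
    symmetry. apply Z.mod_unique with 1; lia.
Qed.

Lemma wp_fixneg (P : post) d m R H b : R 11%nat = 0 ->
  - R m <= R d < R m -> R m <= BB -> 3 <= b ->
  (forall b', b - 3 <= b' -> P (upd R d (R d mod R m)) H b') -> wp (fixneg d m) P R H b.
Proof.
  intros H0 Hd Hm Hb HP. apply wp_if; intro Hc; rewrite H0 in Hc; apply wp_add; try lia.
  - replace (R d + R m) with (R d mod R m); [apply HP; lia|].
    symmetry. apply Z.mod_unique with (-1); lia.
  - rewrite H0, Z.add_0_r.
    rewrite <- (Z.mod_small (R d) (R m)) at 1 by lia. apply HP. lia.
Qed.

Lemma wp_select (P : post) d x s R H b : R 11%nat = 0 -> Z.abs (R s) <= BB -> 3 <= b ->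
  (forall b', b - 3 <= b' -> P (upd R d (if 0 <? R x then R s else 0)) H b') ->
  wp (select d x s) P R H b.
Proof.
  intros H0 Hs Hb HP.
  apply wp_if; intro Hc; rewrite H0 in Hc; apply wp_add; try lia; rewrite H0, Z.add_0_r.
  - destruct (Z.ltb_spec 0 (R x)); [|lia]. apply HP. lia.
  - destruct (Z.ltb_spec 0 (R x)); [lia|]. apply HP. lia.
Qed.

Lemma in_region_0 i : 0 <= i < X -> in_region 0 i.
Proof. auto. Qed.

Lemma in_region_pos r i : (1 <= r <= 18)%nat -> Z.abs i < G -> in_region r i.
Proof. destruct r; simpl; lia. Qed.

Lemma rd_wr_same r i v H : in_region r i -> rd (wr H r i v) r i = v.
Proof. intro Hi. rewrite rd_wr by (auto; lia). now rewrite Nat.eqb_refl, Z.eqb_refl. Qed.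

Lemma rd_wr_index r i v j H : in_region r i -> in_region r j -> j <> i ->
  rd (wr H r i v) r j = rd H r j.
Proof.
  intros Hi Hj Hij. rewrite rd_wr by (auto; lia).
  destruct (Z.eqb_spec j i); [lia|]. now rewrite andb_false_r.
Qed.

Lemma rd_wr_region r i v r' j H : in_region r i -> in_region r' j -> r' <> r ->
  rd (wr H r i v) r' j = rd H r' j.
Proof.
  intros Hi Hj Hr. rewrite rd_wr by (auto; lia).
  now destruct (Nat.eqb_spec r' r).
Qed.

Definition hframe (l : list nat) (H H' : Z -> Z) : Prop :=
  forall r i, in_region r i -> ~ In r l -> rd H' r i = rd H r i.

Lemma hframe_refl l H : hframe l H H.
Proof. intros r i _ _. reflexivity. Qed.

Lemma hframe_trans l1 l2 H1 H2 H3 : incl l1 l2 ->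
  hframe l1 H1 H2 -> hframe l2 H2 H3 -> hframe l2 H1 H3.
Proof.
  intros Hi F1 F2 r i Hr Hn. rewrite F2 by auto. apply F1; auto.
Qed.

Lemma hframe_wr l H H' r i v : hframe l H H' -> In r l -> in_region r i ->
  hframe l H (wr H' r i v).
Proof.
  intros F Hl Hi r' j Hj Hn. rewrite rd_wr_region; auto. congruence.
Qed.

Lemma firstn_snoc {T} (d : T) j (l : list T) : (j < length l)%nat ->
  firstn (S j) l = firstn j l ++ [nth j l d].
Proof.
  revert l; induction j as [|j IH]; intros [|x l] Hj; simpl in *; try lia; auto.
  f_equal. apply IH. lia.
Qed.

(** Index [n] stands for the target, which is hashed by the same loop as the elements. *)
Definition elt (i : nat) : Z := nth i (a ++ [t]) 0.

(** The copy omits the first input cell. Offset [n] therefore holds the target, [n + 1] the length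
    of the random string, and its bits start at [n + 2]. *)
Definition Inp (H : Z -> Z) : Prop :=
  (forall i, (i <= n)%nat -> rd H 0 (Z.of_nat i) = elt i) /\
  (forall i, (i < w)%nat ->
     rd H 0 (Z.of_nat n + 2 + Z.of_nat i) = Z.b2z (nth i rho false)).

Lemma Inp_frame l H H' : ~ In 0%nat l -> hframe l H H' -> Inp H -> Inp H'.
Proof.
  intros H0 HF [H1 H2]. split; intros i Hi; rewrite HF; auto; apply in_region_0; lia.
Qed.

Ltac lookup := cbn [upd Nat.eqb].
Ltac statics := repeat match goal with
  | HE : Env ?R |- context [?R ?k] => rewrite (HE k eq_refl) end; cbn [static_value].
Ltac env := repeat (apply Env_upd; [reflexivity|]); assumption.
Ltac unwritten_reg :=
  first [reflexivity | match goal with b : bool |- _ => destruct b; reflexivity end].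
Ltac keep H Hag E :=
  lazymatch type of H with ?R ?k = ?v => lazymatch type of Hag with agree _ _ ?R' =>
    assert (E : R' k = v) by (rewrite <- H; apply Hag; unwritten_reg) end end.
Ltac keep_env Hag E :=
  lazymatch type of Hag with agree ?c0 _ ?R =>
    assert (E : Env R) by (refine (Env_agree c0 _ _ _ Hag _); [unwritten_reg | env]) end.
Ltac inreg := simpl; lia || apply in_region_pos; lia.
Ltac side := lookup; statics;
  first [ lia | apply in_region_0; lia | apply in_region_pos; lia ].
Ltac wstep :=
  lazymatch goal with
  | |- wp (Seq _ _) _ _ _ _ => apply wp_seq
  | |- wp Skip _ _ _ _ => apply wp_skip; [lia|]
  | |- wp (Cst _ _) _ _ _ _ => apply wp_const; [lia | try side |]
  | |- wp (Plus _ _ _) _ _ _ _ => apply wp_add; [lia | try side |]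
  | |- wp (Minus _ _ _) _ _ _ _ => apply wp_sub; [lia | try side |]
  | |- wp (LdR _ _ _) _ _ _ _ => apply wp_ldR; [env | try side | lia | intros ?]
  | |- wp (StR _ _ _) _ _ _ _ => apply wp_stR; [env | try side | lia | reflexivity | intros ?]
  | |- wp (condsub _ _) _ _ _ _ =>
      apply wp_condsub; [side | try side | try side | lia | intros ? ?]
  | |- wp (fixneg _ _) _ _ _ _ =>
      apply wp_fixneg; [side | try side | try side | lia | intros ? ?]
  | |- wp (select _ _ _) _ _ _ _ =>
      apply wp_select; [side | try side | lia | intros ? ?]
  end; lookup.

(** * Hash keys of the elements and of the target *)

Definition bits_loop : cmd := While 23 24 (block [
  Plus 22 22 22; condsub 22 6; LdR 25 0 23; select 26 25 21; Plus 22 22 26; condsub 22 6;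
  Plus 23 23 10]).

(** Multiplication modulo [Q * W] by Horner's rule over the random bits: double, add [v] if the bit
    is set, and reduce after each operation. With [v] already reduced, single subtractions
    suffice. *)
Lemma wp_bits_loop (P : post) R0 H b0 :
  Env R0 -> Inp H -> R0 22%nat = 0 -> R0 23%nat = Z.of_nat n + 2 ->
  R0 24%nat = Z.of_nat n + 2 + Z.of_nat w -> 0 <= R0 21%nat < Q * W ->
  20 * Z.of_nat w + 20 <= b0 ->
  (forall R b, agree bits_loop R0 R -> R 22%nat = (horner rho * R0 21%nat) mod (Q * W) ->
     b0 - (20 * Z.of_nat w + 20) <= b -> P R H b) ->
  wp bits_loop P R0 H b0.
Proof.
  intros HE [_ HI] H22 H23 H24 H21 Hb HP.
  pose proof Q_pos as HQ. pose proof W_pos as HW.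
  assert (HM : 0 < Q * W) by nia.
  set (v := R0 21%nat) in *.
  apply wp_while with (I := fun R H' b => H' = H /\ exists j, (j <= w)%nat /\
    R 23%nat = Z.of_nat n + 2 + Z.of_nat j /\
    R 22%nat = (horner (firstn j rho) * v) mod (Q * W) /\ b0 - 20 * Z.of_nat j <= b).
  - split; auto. exists 0%nat. rewrite H22, H23. simpl firstn. split; [lia|]. split; [lia|].
    split; [symmetry; apply Z.mod_0_l; lia | lia].
  - intros R H' b Hag (-> & j & Hj & E23 & E22 & Eb) Hlt.
    keep_env Hag HER.
    assert (E21 : R 21%nat = v) by (apply Hag; reflexivity).
    keep H24 Hag E24.
    pose proof (Z.mod_pos_bound (horner (firstn j rho) * v) (Q * W) HM) as Hu.
    cbn [block]. do 4 wstep.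
    pose proof (Z.mod_pos_bound (R 22%nat + R 22%nat) (Q * W) HM) as Hu2.
    do 4 wstep. statics. rewrite E21, E22, E23, HI by lia.
    set (u := (horner (firstn j rho) * v) mod (Q * W)) in *.
    replace (if 0 <? Z.b2z (nth j rho false) then v else 0) with (Z.b2z (nth j rho false) * v)
      by (destruct (nth j rho false); cbn [Z.b2z Z.ltb Z.compare]; lia).
    rewrite E22 in Hu2. fold u in Hu2.
    assert (Hbit : 0 <= Z.b2z (nth j rho false) * v <= v)
      by (destruct (nth j rho false); cbn [Z.b2z]; lia).
    do 5 wstep. split; [lia|]. split; auto. exists (S j). statics.
    rewrite (firstn_snoc false) by lia. rewrite horner_snoc, E23.
    split; [lia|]. split; [lia|]. split; [|lia].
    unfold u. rewrite <- Z.add_mod, Z.add_mod_idemp_l by lia.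
    f_equal. lia.
  - intros R H' b Hag (-> & j & Hj & E23 & E22 & Eb) Hge.
    keep H24 Hag E24.
    assert (j = w) by lia. subst j. rewrite <- rho_length, firstn_all in E22.
    split; [lia|]. apply HP; [exact Hag | auto | lia].
Qed.

Definition div_loop : cmd := While 7 22 (block [Minus 22 22 16; Plus 26 26 10]).

(** Division by repeated subtraction takes fewer than [Q] rounds, as the dividend is below [Q * W].
    This is affordable, being done only [n + 1] times. *)
Lemma wp_div_loop (P : post) R0 H b0 :
  Env R0 -> R0 26%nat = 0 -> 0 <= R0 22%nat < Q * W -> 4 * Q + 4 <= b0 ->
  (forall R b, agree div_loop R0 R -> R 26%nat = R0 22%nat / W ->
     b0 - (4 * Q + 4) <= b -> P R H b) ->
  wp div_loop P R0 H b0.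
Proof.
  intros HE H26 H22 Hb HP.
  pose proof Q_pos as HQ. pose proof W_pos as HW.
  set (u := R0 22%nat) in *.
  apply wp_while with (I := fun R H' b => H' = H /\ 0 <= R 26%nat /\ 0 <= R 22%nat /\
    u = W * R 26%nat + R 22%nat /\ b0 - 4 * R 26%nat <= b).
  - fold u. split; auto. rewrite H26. lia.
  - intros R H' b Hag (-> & H0 & H1 & Eu & Eb) Hlt.
    keep_env Hag HER.
    revert Hlt. statics. intro Hlt.
    assert (R 26%nat < Q) by nia. pose proof QW_ge.
    assert (0 <= W * R 26%nat) by (apply Z.mul_nonneg_nonneg; lia).
    cbn [block]. do 2 wstep.
    wstep. split; [lia|]. split; auto. lookup. statics. lia.
  - intros R H' b Hag (-> & H0 & H1 & Eu & Eb) Hge.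
    keep_env Hag HER.
    revert Hge. statics. intro Hge.
    assert (R 26%nat < Q) by nia.
    split; [lia|]. apply HP; [exact Hag | apply Z.div_unique with (R 22%nat); lia | lia].
Qed.

Definition keys_loop : cmd := While 20 15 (block [
  LdR 21 0 20; fixneg 21 6; Cst 22 0; Plus 23 2 10; Plus 23 23 10; Plus 24 23 5;
  bits_loop; Cst 26 0; div_loop; StR 1 20 26; Plus 20 20 10]).

Definition Keys (H : Z -> Z) : Prop :=
  forall i, (i <= n)%nat -> rd H 1 (Z.of_nat i) = kf (elt i).

Definition keys_cost : Z := (Z.of_nat n + 1) * (20 * Z.of_nat w + 4 * Q + 60) + 10.

Lemma wp_keys_loop (P : post) R0 H0 b0 :
  Env R0 -> Inp H0 -> R0 20%nat = 0 -> Z.abs t < Q * W -> keys_cost <= b0 ->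
  (forall R H b, agree keys_loop R0 R -> hframe [1%nat] H0 H -> Keys H ->
     b0 - keys_cost <= b -> P R H b) ->
  wp keys_loop P R0 H0 b0.
Proof.
  intros HE HI H20 Ht Hb HP. unfold keys_cost in *.
  pose proof Q_pos as HQ. pose proof W_pos as HW. pose proof QW_ge as [_ HWQ].
  pose proof A_max_range as HA.
  set (C := 20 * Z.of_nat w + 4 * Q + 60) in *.
  (* Within this range [fixneg] yields the residue by a single addition; for the target this rests
     on the size test made beforehand. *)
  assert (Helt : forall i, (i <= n)%nat -> Z.abs (elt i) < Q * W).
  { intros i Hi. unfold elt. destruct (Nat.eq_dec i n) as [-> | Hne].
    - rewrite app_nth2 by lia. now rewrite n_def, Nat.sub_diag.
    - rewrite app_nth1 by lia. pose proof (a_bound (nth i a 0) ltac:(apply nth_In; lia)). lia. }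
  apply wp_while with (I := fun R H b => exists i, (i <= n + 1)%nat /\ R 20%nat = Z.of_nat i /\
    hframe [1%nat] H0 H /\ (forall j, (j < i)%nat -> rd H 1 (Z.of_nat j) = kf (elt j)) /\
    b0 - Z.of_nat i * C <= b).
  - exists 0%nat. split; [lia|]. split; auto. split; [apply hframe_refl|]. split; [lia | lia].
  - intros R H b Hag (i & Hi & E20 & HF & Hk & Eb) Hlt.
    keep_env Hag HER.
    revert Hlt. statics. intro Hlt.
    assert (HIH : Inp H) by (eapply Inp_frame; [|eassumption|assumption]; simpl; lia).
    specialize (Helt i ltac:(lia)).
    assert ((Z.of_nat i + 1) * C <= (Z.of_nat n + 1) * C)
      by (apply Z.mul_le_mono_nonneg_r; lia).
    assert (C + 10 <= b) by lia.
    cbn [block]. do 2 wstep. rewrite E20. rewrite (proj1 HIH) by lia.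
    do 2 wstep. statics.
    pose proof (Z.mod_pos_bound (elt i) (Q * W) ltac:(lia)) as Hv.
    do 9 wstep.
    apply wp_bits_loop; [env | assumption | lookup; statics; lia ..|].
    intros R1 b1 Hag1. lookup. intros E22 Eb1.
    keep_env Hag1 HER1.
    assert (E20' : R1 20%nat = Z.of_nat i) by (rewrite Hag1 by reflexivity; exact E20).
    pose proof (Z.mod_pos_bound (horner rho * (elt i mod (Q * W))) (Q * W) ltac:(lia)) as Hu.
    do 3 wstep.
    apply wp_div_loop; [env | lookup; statics; lia ..|].
    intros R2 b2 Hag2. lookup. intros E26 Eb2.
    keep_env Hag2 HER2.
    assert (E20'' : R2 20%nat = Z.of_nat i) by (rewrite Hag2 by reflexivity; exact E20').
    do 3 wstep. split; [lia|].
    exists (S i). lookup. statics. rewrite E20''. split; [lia|]. split; [lia|].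
    assert (Hin : in_region 1 (Z.of_nat i)) by (apply in_region_pos; lia).
    split; [|split].
    + apply hframe_wr; simpl; auto.
    + intros j Hj. destruct (Nat.eq_dec j i) as [-> | Hne].
      * rewrite rd_wr_same, E26, E22, kf_def by auto. unfold key.
        now rewrite Z.mul_mod_idemp_r by lia.
      * rewrite rd_wr_index by (auto || lia || (apply in_region_pos; lia)). apply Hk. lia.
    + unfold C in *. lia.
  - intros R H b Hag (i & Hi & E20 & HF & Hk & Eb) Hge.
    keep_env Hag HER.
    revert Hge. statics. intro Hge. assert (i = n + 1)%nat by lia. subst i.
    split; [lia|]. apply HP; [exact Hag | auto | | lia]. intros j Hj. apply Hk. lia.
Qed.

(** * Listing the distinct subset sums *)

Definition ext_loop (rv rk rm : nat) : cmd := While 33 32 (block [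
  LdR 34 rv 33; Plus 34 34 30; LdR 35 rk 33; Plus 35 35 31; condsub 35 4; LdR 36 rm 34;
  If 36 10 (block [StR rm 34 10; StR rv 29 34; StR rk 29 35; Plus 29 29 10]) Skip;
  Plus 33 33 10]).

Definition IsList (H : Z -> Z) (rv rk : nat) (L : list (Z * Z)) : Prop :=
  forall i, (i < length L)%nat ->
    rd H rv (Z.of_nat i) = fst (nth i L (0, 0)) /\ rd H rk (Z.of_nat i) = snd (nth i L (0, 0)).

(** A membership table addressed by the subset sum itself, of either sign, so that a repeated sum is
    recognized in a constant number of steps. *)
Definition IsMark (H : Z -> Z) (rm : nat) (L : list (Z * Z)) : Prop :=
  forall v, Z.abs v < G -> rd H rm v = Z.b2z (existsb (fun p => fst p =? v) L).

Definition distinct3 (r1 r2 r3 : nat) : Prop :=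
  (2 <= r1 <= 18 /\ 2 <= r2 <= 18 /\ 2 <= r3 <= 18 /\ r1 <> r2 /\ r1 <> r3 /\ r2 <> r3)%nat.

(** Old entries stay in place, so reading position [j] of the growing array still gives entry [j] of
    the original list. *)
Lemma fold_add_prefix (f : Z * Z -> Z * Z) L : forall acc,
  exists l, fold_left (fun acc p => add_item acc (f p)) L acc = acc ++ l.
Proof.
  induction L as [|p L IH]; intro acc; simpl.
  - exists []. now rewrite app_nil_r.
  - destruct (IH (add_item acc (f p))) as [l ->]. unfold add_item.
    destruct (existsb _ acc); eauto. rewrite <- app_assoc. eauto.
Qed.

Lemma IsList_snoc H rv rk rm v k acc : distinct3 rv rk rm -> Z.abs v < G ->
  Z.of_nat (length acc) < G ->
  IsList H rv rk acc ->
  IsList (wr (wr (wr H rm v 1) rv (Z.of_nat (length acc)) v) rk (Z.of_nat (length acc)) k)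
    rv rk (acc ++ [(v, k)]).
Proof.
  intros Hd Hv Hlen HL i Hi. unfold distinct3 in Hd. rewrite length_app in Hi. simpl in Hi.
  assert (in_region rv (Z.of_nat i)) by (apply in_region_pos; lia).
  assert (in_region rk (Z.of_nat i)) by (apply in_region_pos; lia).
  assert (in_region rv (Z.of_nat (length acc))) by (apply in_region_pos; lia).
  assert (in_region rk (Z.of_nat (length acc))) by (apply in_region_pos; lia).
  assert (in_region rm v) by (apply in_region_pos; lia).
  destruct (Nat.eq_dec i (length acc)) as [-> | Hne].
  - rewrite app_nth2, Nat.sub_diag by lia.
    rewrite rd_wr_region by (auto; lia). rewrite !rd_wr_same by auto. auto.
  - rewrite app_nth1 by lia.
    rewrite rd_wr_region by (auto; lia). rewrite rd_wr_index by (auto; lia).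
    rewrite rd_wr_region by (auto; lia).
    rewrite rd_wr_index by (auto; lia). rewrite !rd_wr_region by (auto; lia).
    apply HL. lia.
Qed.

Lemma IsMark_snoc H rv rk rm v k acc : distinct3 rv rk rm -> Z.abs v < G ->
  Z.of_nat (length acc) < G ->
  IsMark H rm acc ->
  IsMark (wr (wr (wr H rm v 1) rv (Z.of_nat (length acc)) v) rk (Z.of_nat (length acc)) k)
    rm (acc ++ [(v, k)]).
Proof.
  intros Hd Hv Hlen HM v' Hv'. unfold distinct3 in Hd.
  assert (in_region rv (Z.of_nat (length acc))) by (apply in_region_pos; lia).
  assert (in_region rk (Z.of_nat (length acc))) by (apply in_region_pos; lia).
  assert (in_region rm v) by (apply in_region_pos; lia).
  assert (in_region rm v') by (apply in_region_pos; lia).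
  rewrite !(rd_wr_region _ _ _ rm) by (auto; lia). rewrite existsb_app. simpl. rewrite orb_false_r.
  destruct (Z.eqb_spec v v') as [-> | Hne].
  - rewrite rd_wr_same, orb_true_r by auto. reflexivity.
  - rewrite rd_wr_index, orb_false_r by auto. now apply HM.
Qed.

Lemma wp_ext_loop (P : post) rv rk rm R0 H0 b0 x k L V :
  distinct3 rv rk rm -> Env R0 -> IsList H0 rv rk L -> IsMark H0 rm L ->
  (forall p, In p L -> Z.abs (fst p) <= V /\ 0 <= snd p < Q) ->
  V + Z.abs x < G -> 0 <= k < Q -> 2 * Z.of_nat (length L) < G ->
  R0 30%nat = x -> R0 31%nat = k -> R0 32%nat = Z.of_nat (length L) -> R0 33%nat = 0 ->
  R0 29%nat = Z.of_nat (length L) -> 30 * Z.of_nat (length L) + 10 <= b0 ->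
  (forall R H b, agree (ext_loop rv rk rm) R0 R -> hframe [rv; rk; rm] H0 H ->
     IsList H rv rk (extend Q x k L) -> IsMark H rm (extend Q x k L) ->
     R 29%nat = Z.of_nat (length (extend Q x k L)) ->
     b0 - (30 * Z.of_nat (length L) + 10) <= b -> P R H b) ->
  wp (ext_loop rv rk rm) P R0 H0 b0.
Proof.
  intros Hd HE HL HM Hbd HV Hk Hlen H30 H31 H32 H33 H29 Hb HP.
  pose proof Q_pos as HQ. pose proof W_pos as HW. pose proof QW_ge as [HQW _].
  pose proof Hd as Hd'. unfold distinct3 in Hd'.
  set (f := shift_item Q x k).
  set (acc := fun j => fold_left (fun acc p => add_item acc (f p)) (firstn j L) L).
  assert (Hacc : forall j, (length L <= length (acc j) <= length L + j)%nat).
  { intro j. pose proof (fold_add_length f (firstn j L) L) as Hfl. unfold acc.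
    rewrite length_firstn in Hfl. lia. }
  apply wp_while with (I := fun R H b => exists j, (j <= length L)%nat /\
    R 33%nat = Z.of_nat j /\ hframe [rv; rk; rm] H0 H /\
    IsList H rv rk (acc j) /\ IsMark H rm (acc j) /\ R 29%nat = Z.of_nat (length (acc j)) /\
    b0 - 30 * Z.of_nat j <= b).
  - exists 0%nat. split; [lia|]. split; auto. split; [apply hframe_refl|].
    repeat split; auto; try apply HL; auto; lia.
  - intros R H2 b Hag (j & Hj & E33 & HF & HLj & HMj & E29 & Eb) Hlt.
    keep_env Hag HER. keep H30 Hag E30. keep H31 Hag E31. keep H32 Hag E32.
    assert (Hjl : (j < length L)%nat) by lia.
    specialize (Hacc j).
    set (p := nth j L (0, 0)).
    destruct (Hbd p ltac:(apply nth_In; auto)) as [Hpv Hpk].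
    assert (Hp : rd H2 rv (Z.of_nat j) = fst p /\ rd H2 rk (Z.of_nat j) = snd p).
    { destruct (HLj j ltac:(lia)) as [-> ->].
      destruct (fold_add_prefix f (firstn j L) L) as [l El]. unfold acc.
      rewrite El, app_nth1 by lia. auto. }
    destruct Hp as [Hp1 Hp2].
    assert (Hsucc : acc (S j) = add_item (acc j) (f p)).
    { unfold acc. rewrite (firstn_snoc (0, 0)) by auto. now rewrite fold_left_app. }
    pose proof (Z.mod_pos_bound (snd p + k) Q HQ) as Hkp.
    cbn [block]. do 2 wstep. rewrite E33, Hp1. do 2 wstep. rewrite E30. do 2 wstep.
    rewrite E33, Hp2. do 6 wstep. rewrite E31. statics.
    rewrite HMj by lia.
    wstep. apply wp_if; lookup; statics; intro Hm.
    + assert (Ef : existsb (fun p0 => fst p0 =? fst p + x) (acc j) = false)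
        by (destruct (existsb _ (acc j)); auto; cbn in Hm; lia).
      cbn [block]. do 2 wstep. statics. do 2 wstep. rewrite E29. do 4 wstep.
      split; [lia|]. exists (S j). rewrite Hsucc. unfold add_item. cbn [f shift_item fst snd].
      rewrite Ef. statics. rewrite E33, E29, length_app. cbn [length].
      split; [lia|]. split; [lia|].
      split; [|split; [|split; [|split; [lia | lia]]]].
      * repeat apply hframe_wr; simpl; auto; apply in_region_pos; lia.
      * apply IsList_snoc; auto; lia.
      * apply IsMark_snoc; auto; lia.
    + assert (Ef : existsb (fun p0 => fst p0 =? fst p + x) (acc j) = true)
        by (destruct (existsb _ (acc j)); auto; cbn in Hm; lia).
      do 2 wstep. split; [lia|]. exists (S j). rewrite Hsucc. unfold add_item. cbn [f shift_item fst snd].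
      rewrite Ef. statics. rewrite E33, E29. repeat split; auto; try apply HLj; auto; lia.
  - intros R H2 b Hag (j & Hj & E33 & HF & HLj & HMj & E29 & Eb) Hge.
    keep H32 Hag E32.
    assert (j = length L) by lia. subst j. unfold acc in *. rewrite firstn_all in *.
    split; [lia|]. apply HP; [exact Hag | ..]; auto; lia.
Qed.

Definition gen_loop (rv rk rm : nat) : cmd := While 27 28 (block [
  LdR 30 0 27; LdR 31 1 27; Plus 32 29 11; Cst 33 0; ext_loop rv rk rm; Plus 27 27 10]).

Definition gen (rv rk rm : nat) : cmd := block [
  Cst 29 1; StR rv 11 11; StR rk 11 11; StR rm 11 10; gen_loop rv rk rm].

Lemma kf_range v : 0 <= kf v < Q.
Proof. rewrite kf_def. apply key_range; [apply Q_pos | apply W_pos]. Qed.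

Lemma items_seg_range lo hi p : (lo <= hi)%nat -> (hi <= n)%nat ->
  In p (items Q kf (seg lo hi a)) -> Z.abs (fst p) < W /\ 0 <= snd p < Q.
Proof.
  intros H1 H2 Hp. pose proof A_max_range.
  split; [|eapply items_key_range; eauto; apply Q_pos].
  pose proof (items_bound Q kf (seg lo hi a) p A_max
    (fun x Hx => a_bound x (seg_in _ _ _ _ Hx)) Hp) as Hb.
  rewrite seg_length in Hb by lia. nia.
Qed.

Lemma seg_snoc lo i : (lo + i < n)%nat -> seg lo (lo + S i) a = seg lo (lo + i) a ++ [elt (lo + i)].
Proof.
  intro Hi. unfold seg, elt. replace (lo + S i - lo)%nat with (S i) by lia.
  replace (lo + i - lo)%nat with i by lia.
  rewrite (firstn_snoc 0) by (rewrite length_skipn; lia). rewrite nth_skipn, app_nth1 by lia.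
  reflexivity.
Qed.

Lemma items_seg_length lo i : (lo + i <= n)%nat -> (i <= q + 3)%nat ->
  1 <= Z.of_nat (length (items Q kf (seg lo (lo + i) a))) <= 2 ^ Z.of_nat i /\
  2 ^ Z.of_nat i <= 8 * Q.
Proof.
  intros Hi Hq. pose proof (items_length Q kf (seg lo (lo + i) a)) as Hl.
  rewrite seg_length in Hl by lia. replace (lo + i - lo)%nat with i in Hl by lia.
  pose proof (Nat2Z.inj_pow 2 i) as Hp. change (Z.of_nat 2) with 2 in Hp.
  split; [lia|]. rewrite Q_def. change 8 with (2 ^ 3). rewrite <- Z.pow_add_r by lia.
  apply Z.pow_le_mono_r; lia.
Qed.

(** Lists at most double in each round, so the costs form a geometric sum: at most [50 * 2 ^ len],
    with [2 ^ len <= 8 * Q]. *)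
Lemma wp_gen (P : post) rv rk rm R0 H0 b0 lo len :
  distinct3 rv rk rm -> Env R0 -> Inp H0 -> Keys H0 ->
  (forall v, Z.abs v < G -> rd H0 rm v = 0) ->
  (lo + len <= n)%nat -> (len <= q + 3)%nat ->
  R0 27%nat = Z.of_nat lo -> R0 28%nat = Z.of_nat (lo + len) -> 400 * Q + 30 <= b0 ->
  (forall R H b, agree (gen rv rk rm) R0 R -> hframe [rv; rk; rm] H0 H ->
     IsList H rv rk (items Q kf (seg lo (lo + len) a)) ->
     R 29%nat = Z.of_nat (length (items Q kf (seg lo (lo + len) a))) ->
     b0 - (400 * Q + 30) <= b -> P R H b) ->
  wp (gen rv rk rm) P R0 H0 b0.
Proof.
  intros Hd HE HI HK Hz Hlo Hlen H27 H28 Hb HP.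
  pose proof Q_pos as HQ. pose proof W_pos as HW. pose proof QW_ge as [HQW HWW].
  pose proof A_max_range as HA.
  pose proof Hd as Hd'. unfold distinct3 in Hd'.
  apply wp_agree. unfold gen. cbn [block]. do 2 wstep. do 6 wstep. statics.
  assert (Hv0 : in_region rv 0) by (apply in_region_pos; lia).
  assert (Hk0 : in_region rk 0) by (apply in_region_pos; lia).
  assert (Hm0 : in_region rm 0) by (apply in_region_pos; lia).
  set (Hi1 := wr (wr (wr H0 rv 0 0) rk 0 0) rm 0 1).
  set (R1 := upd _ _ _).
  assert (HE1 : Env R1) by (unfold R1; env).
  assert (HF1 : hframe [rv; rk; rm] H0 Hi1)
    by (unfold Hi1; repeat (apply hframe_wr; [|simpl; auto|auto]); apply hframe_refl).
  apply wp_while with (I := fun R H b => exists i, (i <= len)%nat /\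
    R 27%nat = Z.of_nat (lo + i) /\ hframe [rv; rk; rm] H0 H /\
    IsList H rv rk (items Q kf (seg lo (lo + i) a)) /\
    IsMark H rm (items Q kf (seg lo (lo + i) a)) /\
    R 29%nat = Z.of_nat (length (items Q kf (seg lo (lo + i) a))) /\
    b0 - 10 - 50 * (2 ^ Z.of_nat i - 1) <= b).
  - exists 0%nat. split; [lia|]. rewrite Nat.add_0_r.
    replace (seg lo lo a) with (@nil Z) by (unfold seg; now rewrite Nat.sub_diag).
    unfold R1; lookup. split; [lia|]. split; auto. split; [|split; [|split; [auto | lia]]].
    + intros i Hi. assert (i = 0)%nat by (simpl in Hi; lia). subst i.
      unfold Hi1. change (Z.of_nat 0) with 0. simpl nth. simpl fst. simpl snd. split.
      * rewrite !(rd_wr_region _ _ _ rv) by (auto; lia). now rewrite rd_wr_same.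
      * rewrite (rd_wr_region _ _ _ rk) by (auto; lia). now rewrite rd_wr_same.
    + intros v Hv. change (items Q kf []) with [(0, 0)]. cbn [existsb fst].
      rewrite orb_false_r. unfold Hi1.
      assert (in_region rm v) by (apply in_region_pos; lia).
      destruct (Z.eqb_spec 0 v) as [<- | Hne]; [now rewrite rd_wr_same|].
      rewrite rd_wr_index by auto. rewrite !(rd_wr_region _ _ _ rm) by (auto; lia). now rewrite Hz by auto.
  - intros R H2 b Hag (i & Hi & E27 & HF & HL & HM & E29 & Eb) Hlt.
    keep_env Hag HER.
    assert (E28 : R 28%nat = Z.of_nat (lo + len)) by (transitivity (R1 28%nat); [apply Hag; reflexivity | exact H28]).
    assert (Hil : (i < len)%nat) by lia.
    assert (HI2 : Inp H2) by (eapply Inp_frame; [|eassumption|assumption]; simpl; lia).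
    assert (HK2 : Keys H2).
    { intros j Hj. rewrite <- HK by auto. apply HF; [apply in_region_pos; lia | simpl; lia]. }
    destruct (items_seg_length lo i ltac:(lia) ltac:(lia)) as [Hl1 Hl2].
    destruct (items_seg_length lo (S i) ltac:(lia) ltac:(lia)) as [_ Hl3].
    assert (Hpow : 2 ^ Z.of_nat (S i) = 2 * 2 ^ Z.of_nat i)
      by (rewrite Nat2Z.inj_succ, Z.pow_succ_r; lia).
    assert (Hpos : 1 <= 2 ^ Z.of_nat i) by lia.
    assert (Helt : Z.abs (elt (lo + i)) <= A_max).
    { unfold elt. rewrite app_nth1 by lia. apply a_bound, nth_In. lia. }
    pose proof (kf_range (elt (lo + i))) as Hkf.
    cbn [block]. do 2 wstep. rewrite E27, (proj1 HI2) by lia.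
    do 2 wstep. rewrite E27, HK2 by lia.
    do 5 wstep. statics. rewrite E29, Z.add_0_r.
    apply wp_ext_loop with (x := elt (lo + i)) (k := kf (elt (lo + i)))
      (L := items Q kf (seg lo (lo + i) a)) (V := W); auto; [env | | lia | lia | lia |].
    { intros p Hp. apply items_seg_range in Hp; lia. }
    intros R3 H3 b3 Hag3 HF3 HL3 HM3 E29'. intros Eb3.
    keep_env Hag3 HER3.
    assert (E27' : R3 27%nat = Z.of_nat (lo + i)) by (rewrite Hag3 by reflexivity; exact E27).
    wstep. split; [lia|]. exists (S i). statics. rewrite seg_snoc, items_snoc by lia.
    split; [lia|]. split; [lia|]. split.
    { eapply hframe_trans; eauto. intros ? ?; auto. }
    split; auto. split; auto. split; auto. lia.
  - intros R H2 b Hag (i & Hi & E27 & HF & HL & HM & E29 & Eb) Hge.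
    assert (E28 : R 28%nat = Z.of_nat (lo + len)) by (transitivity (R1 28%nat); [apply Hag; reflexivity | exact H28]).
    assert (i = len) by lia. subst i.
    destruct (items_seg_length lo len ltac:(lia) ltac:(lia)) as [Hl1 Hl2].
    split; [lia|]. intro Hag0. apply HP; auto. lia.
Qed.

(** * Buckets of entries with equal keys *)

Definition bucket_loop (rk hd nx : nat) : cmd := While 33 29 (block [
  LdR 35 rk 33; LdR 36 hd 35; Plus 33 33 10; StR nx 33 36; StR hd 35 33]).

(* The position, counted from 1, of the last of the first [j] items with key [k], or 0. *)
Fixpoint last_key (L : list (Z * Z)) (j : nat) (k : Z) : Z :=
  match j with
  | O => 0
  | S i => if snd (nth i L (0, 0)) =? k then Z.of_nat (S i) else last_key L i k
  end.

Lemma last_key_range L j k : 0 <= last_key L j k <= Z.of_nat j.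
Proof.
  induction j; cbn [last_key]; [lia|]. destruct (_ =? _); lia.
Qed.

(* The items with the same key form a list linked through the region [nx] and headed in [hd]. *)
Definition Linked (H : Z -> Z) (hd nx : nat) (L : list (Z * Z)) (j : nat) : Prop :=
  (forall k, 0 <= k < Q -> rd H hd k = last_key L j k) /\
  (forall i, (i < j)%nat -> rd H nx (Z.of_nat (S i)) = last_key L i (snd (nth i L (0, 0)))).

(** Positions are counted from 1, so the 0 of untouched memory already means an empty bucket and the
    heads need no initialization. *)
Lemma wp_bucket_loop (P : post) rv rk hd nx R0 H0 b0 L :
  distinct3 rk hd nx -> Env R0 -> IsList H0 rv rk L ->
  (forall p, In p L -> 0 <= snd p < Q) -> Z.of_nat (length L) + 1 < G ->
  (forall v, Z.abs v < G -> rd H0 hd v = 0) ->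
  R0 33%nat = 0 -> R0 29%nat = Z.of_nat (length L) -> 12 * Z.of_nat (length L) + 10 <= b0 ->
  (forall R H b, agree (bucket_loop rk hd nx) R0 R -> hframe [hd; nx] H0 H ->
     Linked H hd nx L (length L) -> b0 - (12 * Z.of_nat (length L) + 10) <= b -> P R H b) ->
  wp (bucket_loop rk hd nx) P R0 H0 b0.
Proof.
  intros Hd HE HL Hkey Hlen Hz H33 H29 Hb HP.
  pose proof Q_pos as HQ. pose proof W_pos as HW. pose proof QW_ge as [HQW _].
  pose proof Hd as Hd'. unfold distinct3 in Hd'.
  apply wp_while with (I := fun R H b => exists j, (j <= length L)%nat /\
    R 33%nat = Z.of_nat j /\ hframe [hd; nx] H0 H /\ Linked H hd nx L j /\
    b0 - 12 * Z.of_nat j <= b).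
  - exists 0%nat. split; [lia|]. split; auto. split; [apply hframe_refl|]. split; [|lia].
    split; [|lia]. intros k Hk. apply Hz. lia.
  - intros R H b Hag (j & Hj & E33 & HF & [HLh HLn] & Eb) Hlt.
    keep_env Hag HER. keep H29 Hag E29.
    assert (Hjl : (j < length L)%nat) by lia.
    assert (Hk : rd H rk (Z.of_nat j) = snd (nth j L (0, 0))).
    { rewrite HF by inreg. now apply HL. }
    pose proof (Hkey (nth j L (0, 0)) ltac:(apply nth_In; lia)) as Hkj.
    pose proof (last_key_range L j (snd (nth j L (0, 0)))) as Hlk.
    set (k := snd (nth j L (0, 0))) in *.
    cbn [block]. do 2 wstep. rewrite E33, Hk. do 2 wstep. rewrite HLh by lia.
    do 2 wstep. statics. rewrite E33. do 3 wstep. split; [lia|].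
    assert (Hin1 : in_region nx (Z.of_nat j + 1)) by (apply in_region_pos; lia).
    assert (Hin2 : in_region hd k) by (apply in_region_pos; lia).
    exists (S j). split; [lia|]. split; [lia|].
    split; [|split; [|lia]].
    + repeat apply hframe_wr; simpl; auto.
    + split.
      * intros k' Hk'. assert (in_region hd k') by (apply in_region_pos; lia).
        cbn [last_key]. fold k. destruct (Z.eqb_spec k k') as [<- | Hne].
        -- rewrite rd_wr_same by auto. lia.
        -- rewrite rd_wr_index by auto. rewrite rd_wr_region by (auto; lia). now apply HLh.
      * intros i Hi. assert (in_region nx (Z.of_nat (S i))) by (apply in_region_pos; lia).
        rewrite rd_wr_region by (auto; lia).
        destruct (Nat.eq_dec i j) as [-> | Hne].
        -- replace (Z.of_nat (S j)) with (Z.of_nat j + 1) by lia. now rewrite rd_wr_same.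
        -- rewrite rd_wr_index by (auto; lia). apply HLn. lia.
  - intros R H b Hag (j & Hj & E33 & HF & HLk & Eb) Hge.
    keep H29 Hag E29.
    assert (j = length L) by lia. subst j. split; [lia|]. apply HP; [exact Hag | ..]; auto; lia.
Qed.

(** * Search for pairs with prescribed keys *)

Definition hit (right : bool) : cmd :=
  if right then block [Minus 35 9 35; LdR 35 18 35; If 11 35 Accept Skip] else StR 18 35 10.

(* [S] lists the hits so far; those of the left side are marked in region 18. *)
Definition HitInv (right : bool) (HL S : list Z) (H : Z -> Z) : Prop :=
  (forall v, Z.abs v < G ->
     rd H 18 v = Z.b2z (existsb (Z.eqb v) (if right then HL else S))) /\
  (right = true -> exists S', S = S' ++ HL /\ forall v, In v S' -> ~ In (t - v) HL).

Lemma existsb_eqb v S : existsb (Z.eqb v) S = true <-> In v S.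
Proof.
  rewrite existsb_exists. split.
  - intros (x & Hx & E). apply Z.eqb_eq in E. now subst.
  - intro Hv. exists v. now rewrite Z.eqb_refl.
Qed.

Lemma wp_hit (P : post) right HL S v R H b :
  Env R -> Z.abs t < Q * W -> Z.abs v < 2 * W -> R 35%nat = v -> HitInv right HL S H ->
  (right = true -> In (t - v) HL -> D true) -> 10 <= b ->
  (forall R' H' b', agree (hit right) R R' -> hframe [18%nat] H H' ->
     HitInv right HL (v :: S) H' -> b - 10 <= b' -> P R' H' b') ->
  wp (hit right) P R H b.
Proof.
  intros HE Ht Hv E35 [HM HR] HD Hb HP.
  pose proof Q_pos as HQ. pose proof W_pos as HW. pose proof QW_ge as [_ HQW].
  apply wp_agree.
  destruct right; cbn [hit].
  - cbn [block]. do 4 wstep. statics. rewrite E35, HM by lia.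
    apply wp_if; lookup; statics; intro Hc.
    + apply wp_acc; [lia|]. apply HD; auto. apply existsb_eqb.
      destruct (existsb _ HL); auto. cbn in Hc. lia.
    + apply wp_skip; [lia|]. intro Hag. apply HP; [exact Hag | apply hframe_refl | | lia].
      split; auto. intros _. destruct (HR eq_refl) as (S' & -> & HS').
      exists (v :: S'). split; auto. intros v' [<- | Hin] Hbad; [|eapply HS'; eauto].
      apply existsb_eqb in Hbad. rewrite Hbad in Hc. cbn in Hc. lia.
  - wstep. statics. rewrite E35.
    assert (Hin : in_region 18 v) by (apply in_region_pos; lia).
    intro Hag. apply HP; [exact Hag | | | lia].
    { apply hframe_wr; [apply hframe_refl | simpl; auto | auto]. }
    split; [|discriminate]. intros v' Hv'. cbn [existsb].
    destruct (Z.eqb_spec v' v) as [-> | Hne].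
    + now rewrite rd_wr_same.
    + rewrite rd_wr_index by (auto; apply in_region_pos; lia). now apply HM.
Qed.

(** Register 36 is a position counted from 1, whereas the array starts at offset 0. Register 39 is
    the number of hits still allowed; it becomes negative at the first hit beyond the cutoff. *)
Definition chain_loop (rv2 nx : nat) (right : bool) : cmd := While 11 36 (block [
  Minus 35 36 10; LdR 35 rv2 35; Plus 35 35 34; Minus 39 39 10; If 39 11 Reject Skip;
  hit right; LdR 36 nx 36]).

(** Following a link removes the last entry of the row, so a chain delivers its row from the end;
    this is why [hits] is in reverse order. *)
Lemma last_key_row L j k x : (j <= length L)%nat ->
  (last_key L j k = 0 /\ row k x (firstn j L) = []) \/
  exists i, (i < j)%nat /\ last_key L j k = Z.of_nat (S i) /\ snd (nth i L (0, 0)) = k /\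
    row k x (firstn j L) = row k x (firstn i L) ++ [x + fst (nth i L (0, 0))].
Proof.
  unfold row. induction j as [|j IH]; intro Hj; [left; auto|].
  rewrite (firstn_snoc (0, 0)), filter_app, map_app by lia. cbn [last_key filter].
  destruct (Z.eqb_spec (snd (nth j L (0, 0))) k) as [E | Hne].
  - right. exists j. split; [lia|]. auto.
  - simpl map. rewrite app_nil_r.
    destruct (IH ltac:(lia)) as [? | (i & ? & ?)]; [auto|]. right. exists i. split; [lia | auto].
Qed.

(** The time is charged to register 39, at 30 steps per hit. The cutoff thus bounds the time of all
    chains together, however long a single bucket may be. *)
Lemma wp_chain_loop (P : post) rv2 rk2 hd nx right HL S0 L2 k x R0 H0 b0 :
  (1 <= rv2 <= 17)%nat -> (1 <= nx <= 17)%nat ->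
  Env R0 -> Z.abs t < Q * W -> Z.abs x < W ->
  (forall p, In p L2 -> Z.abs (fst p) < W) -> Z.of_nat (length L2) + 1 < G ->
  IsList H0 rv2 rk2 L2 -> Linked H0 hd nx L2 (length L2) -> HitInv right HL S0 H0 ->
  R0 36%nat = last_key L2 (length L2) k -> R0 34%nat = x ->
  R0 39%nat = cutoff n Q - Z.of_nat (length S0) -> 0 <= R0 39%nat ->
  (right = true -> forall v, In v (row k x L2) -> In (t - v) HL -> D true) ->
  (cutoff n Q < Z.of_nat (length S0 + length (row k x L2)) -> D false) ->
  30 * R0 39%nat + 40 <= b0 ->
  (forall R H b, agree (chain_loop rv2 nx right) R0 R -> hframe [18%nat] H0 H ->
     HitInv right HL (row k x L2 ++ S0) H ->
     R 39%nat = cutoff n Q - Z.of_nat (length (row k x L2 ++ S0)) -> 0 <= R 39%nat ->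
     b0 - 5 - 30 * (R0 39%nat - R 39%nat) <= b -> P R H b) ->
  wp (chain_loop rv2 nx right) P R0 H0 b0.
Proof.
  intros Hrv Hnx HE Ht Hx HL2 Hlen HIL HLk HHit H36 H34 H39 H39p HDt HDf Hb HP.
  pose proof Q_pos as HQ. pose proof W_pos as HW. pose proof QW_ge as [_ HQW].
  apply wp_while with (I := fun R H b => exists j dn, (j <= length L2)%nat /\
    R 36%nat = last_key L2 j k /\ hframe [18%nat] H0 H /\
    row k x L2 = row k x (firstn j L2) ++ dn /\ HitInv right HL (dn ++ S0) H /\
    R 39%nat = cutoff n Q - Z.of_nat (length (dn ++ S0)) /\ 0 <= R 39%nat /\
    b0 - 30 * (R0 39%nat - R 39%nat) <= b).
  - exists (length L2), []. rewrite firstn_all, app_nil_r. repeat split; auto; try apply HHit; lia.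
  - intros R H b Hag (j & dn & Hj & E36 & HF & Erow & HHit' & E39 & E39p & Eb) Hlt.
    keep_env Hag HER. keep H34 Hag E34.
    revert Hlt. statics. intro Hlt.
    destruct (last_key_row L2 j k x Hj) as [[E0 _] | (i & Hi & Ei & Eki & Erow')]; [lia|].
    rewrite Ei in E36.
    assert (Hpi : Z.abs (fst (nth i L2 (0, 0))) < W) by (apply HL2, nth_In; lia).
    assert (Hrd : rd H rv2 (Z.of_nat i) = fst (nth i L2 (0, 0))).
    { rewrite HF by inreg. apply HIL. lia. }
    assert (Hrdn : rd H nx (Z.of_nat (S i)) = last_key L2 i k).
    { rewrite HF by inreg.
      destruct HLk as [_ HLn]. rewrite HLn by lia. now rewrite Eki. }
    set (y := fst (nth i L2 (0, 0))) in *.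
    assert (Hy : In (x + y) (row k x L2)).
    { rewrite Erow, Erow', !in_app_iff. simpl. auto. }
    assert (Hcnt : Z.of_nat (length S0 + length (row k x L2)) >= Z.of_nat (length (dn ++ S0)) + 1).
    { rewrite Erow, Erow'. rewrite !length_app. simpl. lia. }
    cbn [block]. do 2 wstep. statics. rewrite E36.
    replace (Z.of_nat (S i) - 1) with (Z.of_nat i) by lia.
    do 2 wstep. rewrite Hrd. do 2 wstep. rewrite E34. do 3 wstep.
    apply wp_if; lookup; statics; intro Hc.
    (* With a negative counter, the hits so far and the current one already exceed the cutoff. *)
    { apply wp_rej; [lia|]. apply HDf. lia. }
    apply wp_skip; [lia|]. wstep.
    apply wp_hit with (HL := HL) (S := dn ++ S0) (v := x + y); auto;
      [env | lia | lookup; lia | intros Hr; apply HDt; auto | lia |].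
    intros R1 H1 b1 Hag1 HF1 HHit1 Eb1.
    keep_env Hag1 HER1.
    assert (E36' : R1 36%nat = Z.of_nat (S i))
      by (rewrite Hag1 by (destruct right; reflexivity); exact E36).
    assert (E39' : R1 39%nat = R 39%nat - 1)
      by (rewrite Hag1 by (destruct right; reflexivity); lookup; statics; reflexivity).
    assert (Hrdn1 : rd H1 nx (Z.of_nat (S i)) = last_key L2 i k).
    { rewrite HF1 by inreg. exact Hrdn. }
    wstep. rewrite E36', Hrdn1. split; [lia|].
    exists i, ((x + y) :: dn). rewrite E39', E39. cbn [app length].
    split; [lia|]. split; auto. split.
    { eapply hframe_trans; eauto. intros ? ?; auto. }
    split; [rewrite Erow, Erow', <- app_assoc; reflexivity|]. split; auto.
    split; [lia|]. split; [lia|]. lia.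
  - intros R H b Hag (j & dn & Hj & E36 & HF & Erow & HHit' & E39 & E39p & Eb) Hge.
    keep_env Hag HER.
    revert Hge. statics. intro Hge.
    destruct (last_key_row L2 j k x Hj) as [[_ Er] | (i & _ & Ei & _)]; [|lia].
    rewrite Er in Erow. simpl in Erow. subst dn.
    split; [lia|]. apply HP; [exact Hag | ..]; auto; lia.
Qed.

Definition Tables (H : Z -> Z) (rv1 rk1 rv2 rk2 hd nx : nat) (L1 L2 : list (Z * Z)) : Prop :=
  (1 <= rv1 <= 17 /\ 1 <= rk1 <= 17 /\ 1 <= rv2 <= 17 /\ 1 <= rk2 <= 17 /\ 1 <= hd <= 17 /\
    1 <= nx <= 17)%nat /\
  (forall p, In p L1 -> Z.abs (fst p) < W /\ 0 <= snd p < Q) /\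
  (forall p, In p L2 -> Z.abs (fst p) < W) /\
  Z.of_nat (length L1) + 1 < G /\ Z.of_nat (length L2) + 1 < G /\
  IsList H rv1 rk1 L1 /\ IsList H rv2 rk2 L2 /\ Linked H hd nx L2 (length L2).

Lemma Tables_frame H H' rv1 rk1 rv2 rk2 hd nx L1 L2 : hframe [18%nat] H H' ->
  Tables H rv1 rk1 rv2 rk2 hd nx L1 L2 -> Tables H' rv1 rk1 rv2 rk2 hd nx L1 L2.
Proof.
  intros HF (Hr & H1 & H2 & Hl1 & Hl2 & HI1 & HI2 & HLh & HLn).
  pose proof Q_pos. pose proof QW_ge.
  repeat split; auto; try lia; try apply H1; auto; intros; rewrite ?HF by inreg;
    try apply HI1; try apply HI2; auto.
Qed.

Definition sweep_loop (rv1 rk1 rv2 hd nx : nat) (right : bool) : cmd := While 33 37 (block [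
  LdR 34 rk1 33; Minus 35 23 34; fixneg 35 4; LdR 34 rv1 33; LdR 36 hd 35;
  chain_loop rv2 nx right; Plus 33 33 10]).

Lemma wp_sweep_loop (P : post) rv1 rk1 rv2 rk2 hd nx right HL S0 L1 L2 tau R0 H0 b0 :
  Env R0 -> Z.abs t < Q * W ->
  Tables H0 rv1 rk1 rv2 rk2 hd nx L1 L2 ->
  HitInv right HL S0 H0 ->
  R0 33%nat = 0 -> R0 37%nat = Z.of_nat (length L1) -> R0 23%nat = tau mod Q ->
  R0 39%nat = cutoff n Q - Z.of_nat (length S0) -> 0 <= R0 39%nat ->
  (right = true -> forall v, In v (sweep Q tau L1 L2) -> In (t - v) HL -> D true) ->
  (cutoff n Q < Z.of_nat (length S0 + length (sweep Q tau L1 L2)) -> D false) ->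
  30 * R0 39%nat + 40 + 30 * Z.of_nat (length L1) + 10 <= b0 ->
  (forall R H b, agree (sweep_loop rv1 rk1 rv2 hd nx right) R0 R -> hframe [18%nat] H0 H ->
     HitInv right HL (sweep Q tau L1 L2 ++ S0) H ->
     R 39%nat = cutoff n Q - Z.of_nat (length (sweep Q tau L1 L2 ++ S0)) -> 0 <= R 39%nat ->
     b0 - 5 - 30 * Z.of_nat (length L1) - 30 * (R0 39%nat - R 39%nat) <= b -> P R H b) ->
  wp (sweep_loop rv1 rk1 rv2 hd nx right) P R0 H0 b0.
Proof.
  intros HE Ht HTab HHit H33 H37 H23 H39 H39p HDt HDf Hb HP.
  destruct HTab as ((Hrv1 & Hrk1 & Hrv2 & Hrk2 & Hhd & Hnx) & HL1 & HL2 & Hlen1 & Hlen2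
    & HI1 & HI2 & HLk).
  pose proof Q_pos as HQ. pose proof W_pos as HW. pose proof QW_ge as [HQW _].
  assert (Hsplit : forall i, (i < length L1)%nat ->
    sweep Q tau (firstn (S i) L1) L2 =
    row ((tau - snd (nth i L1 (0, 0))) mod Q) (fst (nth i L1 (0, 0))) L2
      ++ sweep Q tau (firstn i L1) L2).
  { intros i Hi. unfold sweep. rewrite (firstn_snoc (0, 0)), rev_app_distr by lia. reflexivity. }
  (* The hits met so far form a tail of the complete list, so what is assumed of the complete list
     transfers to every partial search. *)
  assert (Hpart : forall i, (i <= length L1)%nat ->
    exists l, sweep Q tau L1 L2 = l ++ sweep Q tau (firstn i L1) L2).
  { intros i Hi. exists (sweep Q tau (skipn i L1) L2). unfold sweep.
    rewrite <- flat_map_app, <- rev_app_distr, firstn_skipn. reflexivity. }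
  apply wp_while with (I := fun R H b => exists i, (i <= length L1)%nat /\
    R 33%nat = Z.of_nat i /\ hframe [18%nat] H0 H /\
    HitInv right HL (sweep Q tau (firstn i L1) L2 ++ S0) H /\
    R 39%nat = cutoff n Q - Z.of_nat (length (sweep Q tau (firstn i L1) L2 ++ S0)) /\
    0 <= R 39%nat /\
    b0 - 30 * Z.of_nat i - 30 * (R0 39%nat - R 39%nat) <= b).
  - exists 0%nat. split; [lia|]. split; auto. split; [apply hframe_refl|].
    split; [exact HHit|]. split; [exact H39|]. split; [auto | lia].
  - intros R H b Hag (i & Hi & E33 & HF & HHit' & E39 & E39p & Eb) Hlt.
    keep_env Hag HER. keep H37 Hag E37. keep H23 Hag E23.
    assert (Hil : (i < length L1)%nat) by lia.
    set (p := nth i L1 (0, 0)) in *.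
    destruct (HL1 p ltac:(apply nth_In; auto)) as [Hpv Hpk].
    destruct (HI1 i Hil) as [Hrv Hrk]. fold p in Hrv, Hrk.
    pose proof (Z.mod_pos_bound tau Q HQ) as Htau.
    assert (Hkm : (tau mod Q - snd p) mod Q = (tau - snd p) mod Q) by (apply Zminus_mod_idemp_l).
    pose proof (Z.mod_pos_bound (tau - snd p) Q HQ) as Hkr.
    pose proof (last_key_range L2 (length L2) ((tau - snd p) mod Q)) as Hlk.
    assert (F1 : rd H rk1 (Z.of_nat i) = snd p)
      by (rewrite HF by inreg; auto).
    assert (F2 : rd H rv1 (Z.of_nat i) = fst p)
      by (rewrite HF by inreg; auto).
    assert (F3 : rd H hd ((tau - snd p) mod Q) = last_key L2 (length L2) ((tau - snd p) mod Q)).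
    { rewrite HF by inreg. now apply HLk. }
    destruct (Hpart (S i) Hil) as [l El].
    rewrite (Hsplit i Hil) in El. fold p in El.
    set (rw := row ((tau - snd p) mod Q) (fst p) L2) in *.
    cbn [block]. do 2 wstep. rewrite E33, F1. do 2 wstep. rewrite E23.
    do 2 wstep. statics. rewrite Hkm. do 2 wstep. rewrite E33, F2.
    do 2 wstep. rewrite F3. wstep.
    apply wp_chain_loop with (rk2 := rk2) (hd := hd) (HL := HL)
      (S0 := sweep Q tau (firstn i L1) L2 ++ S0) (L2 := L2) (k := (tau - snd p) mod Q) (x := fst p);
      auto; try (lookup; auto; lia); [env | | | | |].
    { intros j Hj. rewrite !HF by inreg. now apply HI2. }
    { destruct HLk as [HLh HLn].
      split; intros; rewrite HF by inreg; auto. }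
    { intros Hr v Hv. apply HDt; auto. rewrite El, !in_app_iff. auto. }
    { fold rw. intro Hc. apply HDf. rewrite El. rewrite !length_app in *. lia. }
    intros R1 Hp1 b1 Hag1 HF1 HHit1 E39' E39p' Eb1. fold rw in HHit1, E39'.
    revert Eb1. lookup. intro Eb1.
    keep_env Hag1 HER1.
    assert (E33' : R1 33%nat = Z.of_nat i)
      by (rewrite Hag1 by (destruct right; reflexivity); exact E33).
    wstep. split; [lia|]. exists (S i). statics. rewrite (Hsplit i Hil). fold p rw.
    rewrite <- app_assoc. rewrite E33'. split; [lia|]. split; [lia|]. split.
    { eapply hframe_trans; eauto. intros ? ?; auto. }
    split; auto. split; auto. split; auto. lia.
  - intros R H b Hag (i & Hi & E33 & HF & HHit' & E39 & E39p & Eb) Hge.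
    keep H37 Hag E37.
    assert (i = length L1) by lia. subst i. rewrite firstn_all in *.
    split; [lia|]. apply HP; [exact Hag | ..]; auto; lia.
Qed.

Definition pair_loop (rv1 rk1 rv2 hd nx : nat) (right : bool) : cmd := While 25 24 (block [
  Cst 33 0; sweep_loop rv1 rk1 rv2 hd nx right; Minus 23 23 10; fixneg 23 4; Plus 25 25 10]).

Definition pair_cost (E : nat) (len : nat) : Z := Z.of_nat E * (30 * Z.of_nat len + 30) + 100.

Lemma wp_pair_loop (P : post) rv1 rk1 rv2 rk2 hd nx right HL S0 L1 L2 tau E R0 H0 b0 :
  Env R0 -> Z.abs t < Q * W -> (E <= n + 1)%nat ->
  Tables H0 rv1 rk1 rv2 rk2 hd nx L1 L2 ->
  HitInv right HL S0 H0 ->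
  R0 25%nat = 0 -> R0 24%nat = Z.of_nat E ->
  R0 37%nat = Z.of_nat (length L1) -> R0 23%nat = tau mod Q ->
  R0 39%nat = cutoff n Q - Z.of_nat (length S0) -> 0 <= R0 39%nat ->
  (right = true -> forall v, In v (hits Q tau E L1 L2) -> In (t - v) HL -> D true) ->
  (cutoff n Q < Z.of_nat (length S0 + length (hits Q tau E L1 L2)) -> D false) ->
  30 * R0 39%nat + pair_cost E (length L1) <= b0 ->
  (forall R H b, agree (pair_loop rv1 rk1 rv2 hd nx right) R0 R -> hframe [18%nat] H0 H ->
     HitInv right HL (hits Q tau E L1 L2 ++ S0) H ->
     R 39%nat = cutoff n Q - Z.of_nat (length (hits Q tau E L1 L2 ++ S0)) -> 0 <= R 39%nat ->
     b0 - pair_cost E (length L1) - 30 * (R0 39%nat - R 39%nat) <= b -> P R H b) ->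
  wp (pair_loop rv1 rk1 rv2 hd nx right) P R0 H0 b0.
Proof.
  intros HE Ht HEn HTab HHit H25 H24 H37 H23 H39 H39p HDt HDf Hb HP.
  pose proof (proj1 (proj2 (proj2 (proj2 HTab)))) as Hlen1.
  pose proof Q_pos as HQ. pose proof W_pos as HW. pose proof QW_ge as [HQW _].
  set (C := 30 * Z.of_nat (length L1) + 30). unfold pair_cost in *. fold C in Hb.
  assert (Hsplit : forall e, hits Q tau (S e) L1 L2 =
    sweep Q (tau - Z.of_nat e) L1 L2 ++ hits Q tau e L1 L2).
  { intro e. unfold hits. rewrite seq_S, rev_app_distr. reflexivity. }
  assert (Hpart : forall d e, (e + d = E)%nat ->
    exists l, hits Q tau E L1 L2 = l ++ hits Q tau e L1 L2).
  { induction d as [|d IH]; intros e He.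
    - exists []. now replace e with E by lia.
    - destruct (IH (S e) ltac:(lia)) as [l El]. rewrite Hsplit in El.
      eexists. rewrite El, app_assoc. reflexivity. }
  apply wp_while with (I := fun R H b => exists e, (e <= E)%nat /\
    R 25%nat = Z.of_nat e /\ R 23%nat = (tau - Z.of_nat e) mod Q /\ hframe [18%nat] H0 H /\
    HitInv right HL (hits Q tau e L1 L2 ++ S0) H /\
    R 39%nat = cutoff n Q - Z.of_nat (length (hits Q tau e L1 L2 ++ S0)) /\
    0 <= R 39%nat /\
    b0 - Z.of_nat e * C - 30 * (R0 39%nat - R 39%nat) <= b).
  - exists 0%nat. rewrite Z.sub_0_r. split; [lia|]. split; auto. split; auto.
    split; [apply hframe_refl|].
    split; [exact HHit|]. split; [exact H39|]. split; [auto | lia].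
  - intros R H b Hag (e & He & E25 & E23 & HF & HHit' & E39 & E39p & Eb) Hlt.
    keep_env Hag HER. keep H37 Hag E37. keep H24 Hag E24.
    assert (HeE : (e < E)%nat) by lia.
    destruct (Hpart (E - S e)%nat (S e) ltac:(lia)) as [l El]. rewrite Hsplit in El.
    assert (HC : (Z.of_nat e + 1) * C <= Z.of_nat E * C) by (apply Z.mul_le_mono_nonneg_r; lia).
    pose proof (Z.mod_pos_bound (tau - Z.of_nat e) Q HQ) as Htau.
    set (sw := sweep Q (tau - Z.of_nat e) L1 L2) in *.
    cbn [block]. do 3 wstep.
    apply wp_sweep_loop with (rk2 := rk2) (HL := HL) (S0 := hits Q tau e L1 L2 ++ S0)
      (L1 := L1) (L2 := L2) (tau := tau - Z.of_nat e); auto; try (lookup; auto; lia);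
      [env | eapply Tables_frame; eauto | | |].
    { fold sw. intros Hr v Hv. apply HDt; auto. rewrite El, !in_app_iff. auto. }
    { fold sw. intro Hc. apply HDf. rewrite El. rewrite !length_app in *. lia. }
    intros R1 Hp1 b1 Hag1 HF1 HHit1 E39' E39p' Eb1. fold sw in HHit1, E39'.
    revert Eb1. lookup. intro Eb1.
    keep_env Hag1 HER1.
    assert (E23' : R1 23%nat = (tau - Z.of_nat e) mod Q)
      by (rewrite Hag1 by (destruct right; reflexivity); exact E23).
    assert (E25' : R1 25%nat = Z.of_nat e)
      by (rewrite Hag1 by (destruct right; reflexivity); exact E25).
    do 2 wstep. statics. rewrite E23'. do 3 wstep. split; [lia|].
    exists (S e). rewrite Hsplit. fold sw. rewrite <- app_assoc. statics. rewrite E25'.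
    split; [lia|]. split; [lia|]. split.
    { rewrite Zminus_mod_idemp_l. f_equal. lia. }
    split; [eapply hframe_trans; eauto; intros ? ?; auto|].
    split; auto. split; auto. split; auto. unfold C in *. lia.
  - intros R H b Hag (e & He & E25 & E23 & HF & HHit' & E39 & E39p & Eb) Hge.
    keep H24 Hag E24.
    assert (e = E) by lia. subst e.
    split; [lia|]. apply HP; [exact Hag | ..]; auto; lia.
Qed.

(** Regions [r] to [r + 2] hold values, keys and marks of the first list, [r + 3] to [r + 5] those
    of the second, and [r + 6] and [r + 7] the heads and links of its buckets. Registers [s0], [s1],
    [s2] bound the two segments of the input. *)
Definition side (s0 s1 s2 r : nat) (right : bool) : cmd := block [
  Plus 27 s0 11; Plus 28 s1 11; gen r (r + 1) (r + 2); Plus 37 29 11;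
  Plus 27 s1 11; Plus 28 s2 11; gen (r + 3) (r + 4) (r + 5);
  Cst 33 0; bucket_loop (r + 4) (r + 6) (r + 7);
  Cst 25 0; pair_loop r (r + 1) (r + 3) (r + 6) (r + 7) right].

(** Two lists, the buckets, and for each of the [E] carries a pass over at most [8 * Q] entries. The
    time of the hits is accounted for separately, through register 39. *)
Definition side_cost (E : nat) : Z := 1200 * Q + 300 + Z.of_nat E * (240 * Q + 30).

Lemma wp_plus_static (P : post) d s R H b z :
  Env R -> is_static s = true -> static_value s = z -> 0 <= z <= BB -> 1 <= b ->
  P (upd R d z) H (b - 1) -> wp (Plus d s 11) P R H b.
Proof.
  intros HE Hs Hz Hb H1 HP. apply wp_add; auto; rewrite (HE s Hs), (HE 11%nat eq_refl), Hz;
    cbn [static_value]; rewrite Z.add_0_r; auto. lia.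
Qed.

Lemma wp_side (P : post) s0 s1 s2 r right HL S0 lo len1 len2 tau E R0 H0 b0 :
  let L1 := items Q kf (seg lo (lo + len1) a) in
  let L2 := items Q kf (seg (lo + len1) (lo + len1 + len2) a) in
  (2 <= r <= 10)%nat ->
  is_static s0 = true -> is_static s1 = true -> is_static s2 = true ->
  static_value s0 = Z.of_nat lo -> static_value s1 = Z.of_nat (lo + len1) ->
  static_value s2 = Z.of_nat (lo + len1 + len2) ->
  (lo + len1 + len2 <= n)%nat -> (len1 <= q + 3)%nat -> (len2 <= q + 3)%nat ->
  Env R0 -> Inp H0 -> Keys H0 -> Z.abs t < Q * W -> (E <= n + 1)%nat ->
  (forall r' v, (r <= r' < r + 8)%nat -> Z.abs v < G -> rd H0 r' v = 0) ->
  HitInv right HL S0 H0 ->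
  R0 24%nat = Z.of_nat E -> R0 23%nat = tau mod Q ->
  R0 39%nat = cutoff n Q - Z.of_nat (length S0) -> 0 <= R0 39%nat ->
  (right = true -> forall v, In v (hits Q tau E L1 L2) -> In (t - v) HL -> D true) ->
  (cutoff n Q < Z.of_nat (length S0 + length (hits Q tau E L1 L2)) -> D false) ->
  30 * R0 39%nat + side_cost E <= b0 ->
  (forall R H b, agree (side s0 s1 s2 r right) R0 R ->
     hframe [r; r+1; r+2; r+3; r+4; r+5; r+6; r+7; 18]%nat H0 H ->
     HitInv right HL (hits Q tau E L1 L2 ++ S0) H ->
     R 39%nat = cutoff n Q - Z.of_nat (length (hits Q tau E L1 L2 ++ S0)) -> 0 <= R 39%nat ->
     b0 - side_cost E - 30 * (R0 39%nat - R 39%nat) <= b -> P R H b) ->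
  wp (side s0 s1 s2 r right) P R0 H0 b0.
Proof.
  intros L1 L2 Hr Hs0 Hs1 Hs2 V0 V1 V2 Hlo Hlen1 Hlen2 HE HI HK Ht HEn Hz HHit
    H24 H23 H39 H39p HDt HDf Hb HP.
  pose proof Q_pos as HQ. pose proof W_pos as HW. pose proof QW_ge as [HQW HWW].
  assert (Hl1 : 1 <= Z.of_nat (length L1) <= 8 * Q) by (destruct (items_seg_length lo len1 ltac:(lia) ltac:(lia)) as [? ?]; unfold L1; lia).
  assert (Hl2 : 1 <= Z.of_nat (length L2) <= 8 * Q)
    by (destruct (items_seg_length (lo + len1) len2 ltac:(lia) ltac:(lia)) as [? ?]; unfold L2; lia).
  assert (Hpc : pair_cost E (length L1) <= Z.of_nat E * (240 * Q + 30) + 100).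
  { unfold pair_cost. apply Z.add_le_mono_r, Z.mul_le_mono_nonneg_l; lia. }
  assert (HEp : 0 <= Z.of_nat E * (240 * Q + 30)) by (apply Z.mul_nonneg_nonneg; lia).
  unfold side_cost in *.
  apply wp_agree. unfold side. cbn [block].
  wstep. eapply wp_plus_static; [env | exact Hs0 | exact V0 | lia | lia |].
  wstep. eapply wp_plus_static; [env | exact Hs1 | exact V1 | lia | lia |].
  wstep. apply wp_gen with (lo := lo) (len := len1); auto; try (lookup; auto; lia);
    [unfold distinct3; lia | env | intros v Hv; apply Hz; lia |].
  intros R1 Hp1 b1 Hag1 HF1 HL1 E29 Eb1. fold L1 in HL1, E29.
  keep_env Hag1 HER1.
  do 2 wstep.
  wstep. eapply wp_plus_static; [env | exact Hs1 | exact V1 | lia | lia |].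
  wstep. eapply wp_plus_static; [env | exact Hs2 | exact V2 | lia | lia |].
  statics. rewrite E29, Z.add_0_r.
  assert (HK1 : Keys Hp1).
  { intros j Hj. rewrite <- HK by auto. apply HF1; [apply in_region_pos; lia | simpl; lia]. }
  wstep. apply wp_gen with (lo := (lo + len1)%nat) (len := len2); auto; try (lookup; auto; lia);
    [unfold distinct3; lia | env | eapply Inp_frame; [|eassumption|assumption]; simpl; lia | |].
  { intros v Hv. rewrite HF1 by inreg. apply Hz; lia. }
  intros R2 Hp2 b2 Hag2 HF2 HL2 E29' Eb2. fold L2 in HL2, E29'.
  keep_env Hag2 HER2.
  do 3 wstep.
  apply wp_bucket_loop with (rv := (r + 3)%nat) (L := L2); auto; try (lookup; auto; lia);
    [unfold distinct3; lia | env | | |].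
  { intros p Hp. apply (items_seg_range (lo + len1) (lo + len1 + len2)) in Hp; lia. }
  { intros v Hv. rewrite HF2, HF1 by inreg. apply Hz; lia. }
  intros R3 Hp3 b3 Hag3 HF3 HLk Eb3.
  keep_env Hag3 HER3.
  assert (Hreg : forall k, In k [23%nat; 24%nat; 39%nat] -> R3 k = R0 k).
  { intros k Hk. rewrite Hag3 by (destruct Hk as [<- | [<- | [<- | []]]]; reflexivity).
    replace (upd R2 33 0 k) with (R2 k) by (destruct Hk as [<- | [<- | [<- | []]]]; reflexivity).
    rewrite Hag2 by (destruct Hk as [<- | [<- | [<- | []]]]; reflexivity).
    destruct Hk as [<- | [<- | [<- | []]]]; lookup; rewrite Hag1 by reflexivity; reflexivity. }
  assert (E37 : R3 37%nat = Z.of_nat (length L1)).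
  { rewrite Hag3 by reflexivity. lookup. rewrite Hag2 by reflexivity. reflexivity. }
  pose proof (Hreg 23%nat ltac:(simpl; auto)) as G23.
  pose proof (Hreg 24%nat ltac:(simpl; auto)) as G24.
  pose proof (Hreg 39%nat ltac:(simpl; auto)) as G39.
  assert (HFall : hframe [r; r+1; r+2; r+3; r+4; r+5; r+6; r+7]%nat H0 Hp3).
  { intros r' i Hr' Hn. rewrite HF3, HF2, HF1; auto; simpl in *; lia. }
  do 2 wstep.
  apply wp_pair_loop with (rk2 := (r + 4)%nat) (HL := HL) (S0 := S0) (L1 := L1) (L2 := L2)
    (tau := tau) (E := E); auto; try (lookup; auto; lia); [env | | |].
  { split; [lia|]. split; [intros p Hp; apply (items_seg_range lo (lo + len1)) in Hp; lia|].
    split; [intros p Hp; apply (items_seg_range (lo + len1) (lo + len1 + len2)) in Hp; lia|].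
    split; [lia | split; [lia | split; [| split; [|exact HLk]]]].
    - intros j Hj. rewrite !HF3, !HF2 by inreg. now apply HL1.
    - intros j Hj. rewrite !HF3 by inreg. now apply HL2. }
  { destruct HHit as [HM HR]. split; auto. intros v Hv.
    rewrite HFall by inreg. auto. }
  intros R4 Hp4 b4 Hag4 HF4 HHit4 E39 E39p Eb4. revert Eb4. lookup. intro Eb4.
  intro Hag. apply HP; [exact Hag | | auto | auto | auto | lia].
  intros r' i Hr' Hn. rewrite HF4, HFall; auto; simpl in *; lia.
Qed.

(** Register 39 is not reset between the two sides, so the cutoff limits their hits together. The
    left side uses regions 2 to 9 and the right side 10 to 17; region 18 carries the marks of the
    left hits from one to the other. *)
Definition core : cmd := block [
  Cst 20 0; keys_loop; LdR 40 1 2;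
  Plus 39 12 11; Plus 23 8 11; Plus 24 10 11; side 11 3 17 2 false;
  Minus 23 40 8; fixneg 23 4; Plus 24 15 11; side 17 18 2 10 true; Reject].

Definition core_cost : Z :=
  keys_cost + 30 * cutoff n Q + side_cost 1 + side_cost (n + 1) + 100.

Let HL := left_hits Q kf a (horner pi).
Let HR := right_hits Q kf a t (horner pi).

Lemma quarter_seg i : (i < 4)%nat ->
  quarter a i = seg (i * q) (if Nat.eqb i 3 then n else (i + 1) * q)%nat a.
Proof. intros _. unfold quarter. now rewrite n_def, <- q_def. Qed.

Lemma horner_pi_range : 0 <= horner pi < Q.
Proof.
  pose proof (horner_range pi). rewrite Q_def.
  pose proof (Z.pow_le_mono_r 2 (Z.of_nat (length pi)) (Z.of_nat q)). lia.
Qed.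

Lemma cutoff_nonneg : 0 <= cutoff n Q.
Proof. pose proof Q_pos. unfold cutoff. nia. Qed.

Lemma wp_core (P : post) R0 H0 b0 :
  Env R0 -> Inp H0 -> Z.abs t < Q * W ->
  (forall r v, (1 <= r <= 18)%nat -> Z.abs v < G -> rd H0 r v = 0) ->
  (forall v, In v HL -> In (t - v) HR -> D true) ->
  (~ accepts Q W kf a t (horner pi) -> D false) ->
  core_cost <= b0 -> wp core P R0 H0 b0.
Proof.
  intros HE HI Ht Hz HDt HDf Hb.
  pose proof Q_pos as HQ. pose proof W_pos as HW. pose proof QW_ge as [HQW HWW].
  pose proof horner_pi_range as Hs. pose proof cutoff_nonneg as HT.
  assert (Hq4 : (n = 4 * q + n mod 4)%nat) by (rewrite q_def; apply Nat.div_mod_eq).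
  pose proof (Nat.mod_upper_bound n 4 ltac:(lia)) as Hq4'.
  assert (Hsc : forall E, 300 <= side_cost E) by (intro E; unfold side_cost; nia).
  pose proof (Hsc 1%nat) as Hsc1. pose proof (Hsc (n + 1)%nat) as Hsc2.
  assert (Hkc : 0 <= keys_cost) by (unfold keys_cost; nia).
  unfold core_cost in Hb.
  unfold core. cbn [block]. do 3 wstep.
  apply wp_keys_loop; auto; [env | lia |].
  intros R1 Hp1 b1 Hag1 HF1 HK1 Eb1.
  keep_env Hag1 HER1.
  assert (HI1 : Inp Hp1) by (eapply Inp_frame; [|eassumption|assumption]; simpl; lia).
  assert (Hkt : rd Hp1 1 (Z.of_nat n) = kf t).
  { rewrite HK1 by lia. unfold elt. rewrite app_nth2 by lia. now rewrite n_def, Nat.sub_diag. }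
  assert (Hz1 : forall r v, (2 <= r <= 18)%nat -> Z.abs v < G -> rd Hp1 r v = 0).
  { intros r v Hr Hv. rewrite HF1 by inreg. apply Hz; lia. }
  do 2 wstep. statics. rewrite Hkt. do 7 wstep. statics. rewrite !Z.add_0_r.
  assert (EL : HL = hits Q (horner pi) 1 (items Q kf (seg 0 (0 + q) a))
      (items Q kf (seg (0 + q) (0 + q + q) a))).
  { unfold HL, left_hits. rewrite !quarter_seg by lia. simpl Nat.eqb. cbv iota.
    replace (0 * q)%nat with 0%nat by lia. replace ((0 + 1) * q)%nat with (0 + q)%nat by lia.
    replace (1 * q)%nat with (0 + q)%nat by lia. now replace ((1 + 1) * q)%nat with (0 + q + q)%nat by lia. }
  assert (ER : HR = hits Q (kf t - horner pi) (n + 1) (items Q kf (seg (2 * q) (2 * q + q) a))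
      (items Q kf (seg (2 * q + q) (2 * q + q + (n - 3 * q)) a))).
  { unfold HR, right_hits. rewrite !quarter_seg by lia. simpl Nat.eqb. cbv iota. rewrite n_def.
    replace ((2 + 1) * q)%nat with (2 * q + q)%nat by lia.
    replace (3 * q)%nat with (2 * q + q)%nat by lia.
    replace (2 * q + q + (n - (2 * q + q)))%nat with n by lia. now rewrite Nat.add_1_r. }
  assert (Hcut : cutoff n Q < Z.of_nat (length HL + length HR) -> D false).
  { intro Hc. apply HDf. intros (_ & Hlen & _). fold HL HR in Hlen. rewrite n_def in Hlen. lia. }
  apply wp_side with (HL := []) (S0 := []) (lo := 0%nat) (len1 := q) (len2 := q)
    (tau := horner pi) (E := 1%nat); auto; try (lookup; cbn [static_value length]; auto; lia);
    [env | intros; apply Hz1; lia | | lookup; symmetry; apply Z.mod_small; lia | |].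
  { split; [|discriminate]. intros v Hv. apply Hz1; lia. }
  { rewrite <- EL. intro Hc. apply Hcut. simpl in Hc. lia. }
  rewrite <- EL. intros R2 Hp2 b2 Hag2 HF2 HHit2 E39 E39p Eb2. revert Eb2. lookup. intro Eb2.
  rewrite app_nil_r in *.
  keep_env Hag2 HER2.
  assert (E40 : R2 40%nat = kf t) by (rewrite Hag2 by reflexivity; reflexivity).
  pose proof (kf_range t) as Hkr.
  pose proof (Z.mod_pos_bound (kf t - horner pi) Q HQ) as Hm.
  do 2 wstep. statics. rewrite E40. do 4 wstep. statics. rewrite Z.add_0_r.
  wstep. apply wp_side with (HL := HL) (S0 := HL) (lo := (2 * q)%nat) (len1 := q) (len2 := (n - 3 * q)%nat)
    (tau := kf t - horner pi) (E := (n + 1)%nat); auto;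
    try (lookup; cbn [static_value]; auto; lia);
    [env | | | | | rewrite <- ER | rewrite <- ER | rewrite <- ER].
  { eapply Inp_frame; [|eassumption|assumption]. simpl. lia. }
  { intros j Hj. rewrite <- HK1 by auto. apply HF2; [apply in_region_pos; lia | simpl; lia]. }
  { intros r v Hr Hv. rewrite HF2 by inreg. apply Hz1; lia. }
  { split; [apply HHit2 |]. intros _. exists []. split; auto. }
  { intros _ v Hv Hin. apply (HDt (t - v)); auto. now replace (t - (t - v)) with v by lia. }
  { auto. }
  intros R3 Hp3 b3 Hag3 HF3 [_ HHit3] E39b E39bp Eb3. revert Eb3. lookup. intro Eb3.
  (* The search has run to its end without a match, while [accepts] would provide one. *)
  apply wp_rej; [lia|]. apply HDf. intros (_ & _ & v & HvL & HvR).
  destruct (HHit3 eq_refl) as (S' & ES & HS). apply app_inv_tail in ES. subst S'.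
  apply (HS _ HvR). now replace (t - (t - v)) with v by lia.
Qed.

(** * Reading the input and computing the parameters *)

Hypothesis t_BB : Z.abs t <= BB.
(** The program may depend on [c] only. These two constants are all it contains of the sizes [X] and
    [G], which it computes from the input. *)
Variables (dd g0 : Z).
Hypothesis X_def : X = dd * Z.of_nat n.
Hypothesis dd_pos : 0 < dd.
Hypothesis G_def : 2 * G = g0 * (Q * W).
Hypothesis g0_pos : 0 < g0.

Ltac wstep0 :=
  lazymatch goal with
  | |- wp (Seq _ _) _ _ _ _ => apply wp_seq
  | |- wp (Cst _ _) _ _ _ _ => apply wp_const; [lia | try lia |]
  | |- wp (Plus _ _ _) _ _ _ _ => apply wp_add; [lia | lookup; try lia |]
  | |- wp (Minus _ _ _) _ _ _ _ => apply wp_sub; [lia | lookup; try lia |]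
  end; lookup.

Definition count_loop : cmd := While 12 0 (block [Plus 12 12 14; Plus 2 2 10]).

(** Cell 0 lost the length when it was turned into the address [X]; the length is recovered as the
    quotient of [X] by [dd]. *)
Lemma wp_count_loop (P : post) R0 H b0 :
  R0 0%nat = X -> R0 10%nat = 1 -> R0 14%nat = dd -> R0 12%nat = 0 -> R0 2%nat = 0 ->
  5 * X + 5 <= b0 ->
  (forall R b, agree count_loop R0 R -> R 2%nat = Z.of_nat n -> b0 - (5 * X + 5) <= b -> P R H b) ->
  wp count_loop P R0 H b0.
Proof.
  intros E0 E10 E14 E12 E2 Hb HP.
  assert (HXn : Z.of_nat n <= X) by nia. assert (Hdd : dd <= X) by nia.
  apply wp_while with (I := fun R H' b => H' = H /\ exists i, (i <= n)%nat /\
    R 12%nat = dd * Z.of_nat i /\ R 2%nat = Z.of_nat i /\ b0 - 5 * Z.of_nat i <= b).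
  - split; auto. exists 0%nat. lia.
  - intros R H' b Hag (-> & i & Hi & F12 & F2 & Eb) Hlt.
    keep E0 Hag F0. keep E10 Hag F10. keep E14 Hag F14.
    assert (i < n)%nat by (apply Nat2Z.inj_lt, (Z.mul_lt_mono_pos_l dd); lia).
    assert (0 <= dd * Z.of_nat i) by (apply Z.mul_nonneg_nonneg; lia).
    cbn [block]. do 3 wstep0. split; [lia|]. split; auto. exists (S i). lookup. lia.
  - intros R H' b Hag (-> & i & Hi & F12 & F2 & Eb) Hge.
    keep E0 Hag F0.
    assert (Z.of_nat n <= Z.of_nat i) by (apply (Z.mul_le_mono_pos_l _ _ dd); lia).
    assert (i = n) by lia. subst i. split; [lia|]. apply HP; [exact Hag | auto | lia].
Qed.

Definition cell (z : Z) : Z := nth (Z.to_nat z) (input_cells a t rho pi) 0.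

Definition copy_loop : cmd := While 15 19 (block [
  Plus 16 15 10; Ld 17 16; Plus 18 15 0; St 18 17; Plus 15 15 10]).

(** The first 63 cells of the copy exist already, having been saved from the registers. Sources lie
    below [X] and destinations above it, so nothing still to be read is overwritten. *)
Lemma wp_copy_loop (P : post) R0 H0 b0 :
  R0 0%nat = X -> R0 10%nat = 1 -> R0 19%nat = X - 1 -> R0 15%nat = 63 ->
  (forall j, 0 <= j < 63 -> H0 (X + j) = cell (j + 1)) ->
  (forall z, 64 <= z < X -> H0 z = cell z) ->
  10 * X + 10 <= b0 ->
  (forall R H b, agree copy_loop R0 R -> (forall j, 0 <= j < X - 1 -> H (X + j) = cell (j + 1)) ->
     (forall z, 2 * X <= z -> H z = H0 z) -> b0 - (10 * X + 10) <= b -> P R H b) ->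
  wp copy_loop P R0 H0 b0.
Proof.
  intros E0 E10 E19 E15 Hlow Hhigh Hb HP.
  apply wp_while with (I := fun R H b => 63 <= R 15%nat <= X /\
    (forall j, 0 <= j < R 15%nat -> H (X + j) = cell (j + 1)) /\
    (forall z, 64 <= z < X -> H z = cell z) /\
    (forall z, 2 * X <= z -> H z = H0 z) /\ b0 - 10 * (R 15%nat - 63) <= b).
  - rewrite E15. split; [lia|]. split; auto. split; auto. split; auto. lia.
  - intros R H b Hag (Hi & F1 & F2 & F3 & Eb) Hlt.
    keep E0 Hag F0. keep E10 Hag F10. keep E19 Hag F19.
    cbn [block]. do 3 wstep0.
    apply wp_ld; [lia | unfold nregs; lookup; lia |]. lookup. do 3 wstep0.
    apply wp_st; [lia | unfold nregs; lookup; lia |]. lookup. wstep0. split; [lia|].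
    rewrite F0, F10. unfold hset.
    split; [lia|]. split; [|split; [|split; [|lia]]].
    + intros j Hj. destruct (Z.eqb_spec (X + j) (R 15%nat + X)) as [Ej | Ej].
      * rewrite F2 by lia. f_equal. lia.
      * apply F1. lia.
    + intros z Hz. destruct (Z.eqb_spec z (R 15%nat + X)); [lia|]. auto.
    + intros z Hz. destruct (Z.eqb_spec z (R 15%nat + X)); [lia|]. auto.
  - intros R H b Hag (Hi & F1 & F2 & F3 & Eb) Hge.
    keep E19 Hag F19.
    split; [lia|]. apply HP; [exact Hag | intros; apply F1; lia | auto | lia].
Qed.

Definition quarter_loop : cmd := While 15 2 (block [
  Plus 3 3 10; Plus 4 4 4; Plus 13 13 13; Plus 15 15 16]).

(** Register 15 runs through [4 * i + 3], since [4 * i + 3 < n] is equivalent to [i + 1 <= n / 4];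
    this makes the division round down. *)
Lemma wp_quarter_loop (P : post) R0 H b0 :
  R0 2%nat = Z.of_nat n -> R0 10%nat = 1 -> R0 16%nat = 4 ->
  R0 3%nat = 0 -> R0 4%nat = 1 -> R0 13%nat = g0 -> R0 15%nat = 3 ->
  10 * X + 5 <= b0 ->
  (forall R b, agree quarter_loop R0 R -> R 3%nat = Z.of_nat q -> R 4%nat = Q ->
     R 13%nat = g0 * Q -> b0 - (10 * X + 5) <= b -> P R H b) ->
  wp quarter_loop P R0 H b0.
Proof.
  intros E2 E10 E16 E3 E4 E13 E15 Hb HP.
  pose proof Q_pos as HQ. pose proof W_pos as HW.
  assert (Hq4 : (n = 4 * q + n mod 4)%nat) by (rewrite q_def; apply Nat.div_mod_eq).
  pose proof (Nat.mod_upper_bound n 4 ltac:(lia)) as Hq4'.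
  apply wp_while with (I := fun R H' b => H' = H /\ exists i, (i <= q)%nat /\
    R 3%nat = Z.of_nat i /\ R 4%nat = 2 ^ Z.of_nat i /\ R 13%nat = g0 * 2 ^ Z.of_nat i /\
    R 15%nat = 4 * Z.of_nat i + 3 /\ b0 - 8 * Z.of_nat i <= b).
  - split; auto. exists 0%nat. change (2 ^ Z.of_nat 0) with 1. lia.
  - intros R H' b Hag (-> & i & Hi & F3 & F4 & F13 & F15 & Eb) Hlt.
    keep E2 Hag F2. keep E10 Hag F10. keep E16 Hag F16.
    assert (Hiq : (i < q)%nat) by lia.
    assert (Hp : 2 ^ Z.of_nat (S i) = 2 * 2 ^ Z.of_nat i)
      by (rewrite Nat2Z.inj_succ, Z.pow_succ_r; lia).
    assert (HpQ : 0 < 2 ^ Z.of_nat i <= Q).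
    { rewrite Q_def. split; [apply Z.pow_pos_nonneg; lia | apply Z.pow_le_mono_r; lia]. }
    pose proof QW_ge.
    assert (0 <= g0 * 2 ^ Z.of_nat i <= g0 * (Q * W))
      by (split; [apply Z.mul_nonneg_nonneg; lia | apply Z.mul_le_mono_nonneg_l; lia]).
    assert (Q <= G) by lia.
    cbn [block]. do 7 wstep0. split; [lia|]. split; auto. exists (S i). lookup. rewrite Hp. lia.
  - intros R H' b Hag (-> & i & Hi & F3 & F4 & F13 & F15 & Eb) Hge.
    keep E2 Hag F2.
    assert (i = q) by lia. subst i. rewrite <- Q_def in *.
    split; [lia|]. apply HP; [exact Hag | ..]; auto; lia.
Qed.

Definition modulus_loop : cmd := While 21 5 (block [
  Plus 16 16 16; Plus 6 6 6; Plus 13 13 13; Plus 21 21 10]).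

Lemma wp_modulus_loop (P : post) R0 H b0 :
  R0 5%nat = Z.of_nat w -> R0 10%nat = 1 -> R0 21%nat = Z.of_nat q ->
  R0 16%nat = 1 -> R0 6%nat = Q -> R0 13%nat = g0 * Q ->
  10 * X + 5 <= b0 ->
  (forall R b, agree modulus_loop R0 R -> R 16%nat = W -> R 6%nat = Q * W ->
     R 13%nat = 2 * G -> b0 - (10 * X + 5) <= b -> P R H b) ->
  wp modulus_loop P R0 H b0.
Proof.
  intros E5 E10 E21 E16 E6 E13 Hb HP.
  pose proof Q_pos as HQ. pose proof W_pos as HW.
  apply wp_while with (I := fun R H' b => H' = H /\ exists i, (i <= w - q)%nat /\
    R 21%nat = Z.of_nat q + Z.of_nat i /\ R 16%nat = 2 ^ Z.of_nat i /\
    R 6%nat = Q * 2 ^ Z.of_nat i /\ R 13%nat = g0 * (Q * 2 ^ Z.of_nat i) /\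
    b0 - 8 * Z.of_nat i <= b).
  - split; auto. exists 0%nat. change (2 ^ Z.of_nat 0) with 1. lia.
  - intros R H' b Hag (-> & i & Hi & F21 & F16 & F6 & F13 & Eb) Hlt.
    keep E5 Hag F5. keep E10 Hag F10.
    assert (Hiq : (i < w - q)%nat) by lia.
    assert (Hp : 2 ^ Z.of_nat (S i) = 2 * 2 ^ Z.of_nat i)
      by (rewrite Nat2Z.inj_succ, Z.pow_succ_r; lia).
    assert (HpW : 0 < 2 ^ Z.of_nat i <= W).
    { rewrite W_def. split; [apply Z.pow_pos_nonneg; lia | apply Z.pow_le_mono_r; lia]. }
    assert (Hp1 : 0 <= Q * 2 ^ Z.of_nat i <= Q * W)
      by (split; [apply Z.mul_nonneg_nonneg; lia | apply Z.mul_le_mono_nonneg_l; lia]).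
    assert (Hp2 : 0 <= g0 * (Q * 2 ^ Z.of_nat i) <= g0 * (Q * W))
      by (split; [apply Z.mul_nonneg_nonneg; lia | apply Z.mul_le_mono_nonneg_l; lia]).
    pose proof QW_ge.
    cbn [block]. do 7 wstep0. split; [lia|]. split; auto. exists (S i). lookup. rewrite Hp. lia.
  - intros R H' b Hag (-> & i & Hi & F21 & F16 & F6 & F13 & Eb) Hge.
    keep E5 Hag F5.
    assert (i = (w - q)%nat) by lia. subst i. rewrite <- W_def in *.
    split; [lia|]. apply HP; [exact Hag | ..]; auto; lia.
Qed.

Lemma wp_ldR0 (P : post) d x R H b :
  R 0%nat = X -> 0 <= R x < X -> 2 <= b ->
  (forall z, P (upd (upd R 1 z) d (rd H 0 (R x))) H (b - 2)) ->
  wp (LdR d 0 x) P R H b.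
Proof.
  intros E0 Hx Hb HP. specialize (HP (X + R x)).
  unfold LdR. apply wp_seq, wp_add; [lia | cbn [breg]; lia |].
  apply wp_ld; [lia | unfold nregs; cbn [upd Nat.eqb breg]; lia |].
  cbn [upd Nat.eqb breg]. rewrite E0. unfold rd, base in HP.
  now replace (b - 1 - 1) with (b - 2) by lia.
Qed.

Definition proof_loop : cmd := While 20 21 (block [
  Plus 8 8 8; LdR 22 0 20; Plus 8 8 22; Plus 20 20 10]).

Lemma wp_proof_loop (P : post) R0 H b0 s0 :
  R0 0%nat = X -> R0 10%nat = 1 -> R0 20%nat = Z.of_nat s0 ->
  R0 21%nat = Z.of_nat (s0 + length pi) -> R0 8%nat = 0 ->
  (forall i, (i < length pi)%nat -> rd H 0 (Z.of_nat (s0 + i)) = Z.b2z (nth i pi false)) ->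
  Z.of_nat (s0 + length pi) <= X ->
  10 * X + 5 <= b0 ->
  (forall R b, agree proof_loop R0 R -> R 8%nat = horner pi ->
     b0 - (10 * X + 5) <= b -> P R H b) ->
  wp proof_loop P R0 H b0.
Proof.
  intros E0 E10 E20 E21 E8 Hpi Hlen Hb HP.
  pose proof Q_pos as HQ. pose proof QW_ge as [HQW _].
  apply wp_while with (I := fun R H' b => H' = H /\ exists i, (i <= length pi)%nat /\
    R 20%nat = Z.of_nat (s0 + i) /\ R 8%nat = horner (firstn i pi) /\ b0 - 8 * Z.of_nat i <= b).
  - split; auto. exists 0%nat. rewrite E20, E8. split; [lia|]. split; [lia|]. split; [auto | lia].
  - intros R H' b Hag (-> & i & Hi & F20 & F8 & Eb) Hlt.
    keep E0 Hag F0. keep E10 Hag F10. keep E21 Hag F21.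
    assert (Hil : (i < length pi)%nat) by lia.
    assert (Hh : 0 <= horner (firstn i pi) < Q).
    { pose proof (horner_range (firstn i pi)) as Hr. rewrite length_firstn in Hr.
      rewrite Q_def. pose proof (Z.pow_le_mono_r 2 (Z.of_nat (Nat.min i (length pi))) (Z.of_nat q)).
      lia. }
    assert (Hbit : 0 <= Z.b2z (nth i pi false) <= 1) by (destruct (nth i pi false); cbn; lia).
    cbn [block]. do 3 wstep0. apply wp_ldR0; [exact F0 | lookup; lia | lia |].
    intros z. lookup. rewrite F20, Hpi by lia. do 3 wstep0. split; [lia|]. split; auto.
    exists (S i). lookup. rewrite (firstn_snoc false), horner_snoc by lia. lia.
  - intros R H' b Hag (-> & i & Hi & F20 & F8 & Eb) Hge.
    keep E21 Hag F21.
    assert (i = length pi) by lia. subst i. rewrite firstn_all in F8.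
    split; [lia|]. apply HP; [exact Hag | ..]; auto; lia.
Qed.

Definition times_loop (d s : nat) : cmd := While 21 15 (block [Plus d d s; Plus 21 21 10]).

(** Multiplication by [n + 1], applied twice on the way to the cutoff. Listing the two pairs of
    registers lets their distinctness be decided by computation. *)
Lemma wp_times_loop (P : post) d s R0 H b0 x :
  (d = 22 /\ s = 4 \/ d = 12 /\ s = 22)%nat ->
  R0 10%nat = 1 -> R0 15%nat = Z.of_nat n + 1 -> R0 21%nat = 0 -> R0 d = 0 -> R0 s = x ->
  0 <= x -> (Z.of_nat n + 1) * x <= BB -> Z.of_nat n + 1 <= X -> 10 * X + 5 <= b0 ->
  (forall R b, agree (times_loop d s) R0 R -> R d = (Z.of_nat n + 1) * x ->
     b0 - (10 * X + 5) <= b -> P R H b) ->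
  wp (times_loop d s) P R0 H b0.
Proof.
  intros Hds E10 E15 E21 Ed Es Hx HxB HnX Hb HP.
  apply wp_while with (I := fun R H' b => H' = H /\ 0 <= R 21%nat <= Z.of_nat n + 1 /\
    R d = R 21%nat * x /\ b0 - 5 * R 21%nat <= b).
  - rewrite E21, Ed. split; auto. lia.
  - intros R H' b Hag (-> & Hi & Fd & Eb) Hlt.
    assert (F10 : R 10%nat = 1)
      by (rewrite <- E10; apply Hag; destruct Hds as [[-> ->] | [-> ->]]; reflexivity).
    assert (F15 : R 15%nat = Z.of_nat n + 1)
      by (rewrite <- E15; apply Hag; destruct Hds as [[-> ->] | [-> ->]]; reflexivity).
    assert (Fs : R s = x)
      by (rewrite <- Es; apply Hag; destruct Hds as [[-> ->] | [-> ->]]; reflexivity).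
    assert (0 <= (R 21%nat + 1) * x <= (Z.of_nat n + 1) * x)
      by (split; [apply Z.mul_nonneg_nonneg; lia | apply Z.mul_le_mono_nonneg_r; lia]).
    assert (0 <= R 21%nat * x) by (apply Z.mul_nonneg_nonneg; lia).
    cbn [block]. wstep0. wstep0. wstep0.
    { destruct Hds as [[-> ->] | [-> ->]]; lookup; lia. }
    split; [lia|]. split; auto.
    destruct Hds as [[-> ->] | [-> ->]]; lookup; rewrite F10, Fd, Fs; lia.
  - intros R H' b Hag (-> & Hi & Fd & Eb) Hge.
    assert (F15 : R 15%nat = Z.of_nat n + 1)
      by (rewrite <- E15; apply Hag; destruct Hds as [[-> ->] | [-> ->]]; reflexivity).
    assert (F21 : R 21%nat = Z.of_nat n + 1) by lia. rewrite F21 in *.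
    split; [lia|]. apply HP; [exact Hag | ..]; auto; lia.
Qed.

Lemma cell_elt i : (i <= n)%nat -> cell (Z.of_nat i + 1) = elt i.
Proof.
  intro Hi. unfold cell, elt, input_cells. replace (Z.to_nat (Z.of_nat i + 1)) with (S i) by lia.
  cbn [nth]. destruct (Nat.eq_dec i n) as [-> | Hne].
  - rewrite !app_nth2 by lia. now rewrite n_def, Nat.sub_diag.
  - rewrite !app_nth1 by lia. reflexivity.
Qed.

Lemma cell_w : cell (Z.of_nat n + 2) = Z.of_nat w.
Proof.
  unfold cell, input_cells. replace (Z.to_nat (Z.of_nat n + 2)) with (S (n + 1)) by lia.
  cbn [nth]. rewrite app_nth2 by lia. replace (n + 1 - length a)%nat with 1%nat by lia.
  cbn [nth]. now rewrite rho_length.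
Qed.

Lemma nth_b2z l i : nth i (map Z.b2z l) 0 = Z.b2z (nth i l false).
Proof. apply (map_nth Z.b2z l false i). Qed.

Lemma cell_rho i : (i < w)%nat -> cell (Z.of_nat n + 3 + Z.of_nat i) = Z.b2z (nth i rho false).
Proof.
  intro Hi. unfold cell, input_cells.
  replace (Z.to_nat (Z.of_nat n + 3 + Z.of_nat i)) with (S (n + 2 + i)) by lia.
  cbn [nth]. rewrite app_nth2 by lia. replace (n + 2 + i - length a)%nat with (S (S i)) by lia.
  cbn [nth]. rewrite app_nth1 by (rewrite length_map; lia). apply nth_b2z.
Qed.

Lemma cell_pi_length : cell (Z.of_nat n + 3 + Z.of_nat w) = Z.of_nat (length pi).
Proof.
  unfold cell, input_cells.
  replace (Z.to_nat (Z.of_nat n + 3 + Z.of_nat w)) with (S (n + 2 + w)) by lia.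
  cbn [nth]. rewrite app_nth2 by lia. replace (n + 2 + w - length a)%nat with (S (S w)) by lia.
  cbn [nth]. rewrite app_nth2; rewrite length_map; [|lia].
  now rewrite rho_length, Nat.sub_diag.
Qed.

Lemma cell_pi i : (i < length pi)%nat ->
  cell (Z.of_nat n + 4 + Z.of_nat w + Z.of_nat i) = Z.b2z (nth i pi false).
Proof.
  intro Hi. unfold cell, input_cells.
  replace (Z.to_nat (Z.of_nat n + 4 + Z.of_nat w + Z.of_nat i)) with (S (n + 3 + w + i)) by lia.
  cbn [nth]. rewrite app_nth2 by lia.
  replace (n + 3 + w + i - length a)%nat with (S (S (w + S i))) by lia.
  cbn [nth]. rewrite app_nth2; rewrite length_map; [|lia].
  replace (w + S i - length rho)%nat with (S i) by lia. cbn [nth]. apply nth_b2z.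
Qed.

Definition set_bases : list cmd :=
  Plus 41 13 11 :: map (fun k => Plus (S k) k 13) (seq 41 17).

Definition read_input : list cmd := [
  Cst 10 1; Cst 11 0; Cst 14 dd; Cst 12 0; Cst 2 0; count_loop;
  Minus 19 0 10; Cst 15 63; copy_loop;
  Cst 3 0; Cst 4 1; Cst 13 g0; Cst 15 3; Cst 16 4; quarter_loop;
  Plus 20 2 10; LdR 5 0 20; LdR 9 0 2; Plus 6 4 11; Cst 16 1; Plus 21 3 11; modulus_loop;
  Minus 7 16 10;
  Plus 20 20 10; Plus 20 20 5; LdR 21 0 20; Plus 20 20 10; Plus 21 21 20; Cst 8 0; proof_loop;
  Plus 15 2 10; Plus 17 3 3; Plus 18 17 3;
  Cst 22 0; Cst 21 0; times_loop 22 4; Cst 12 0; Cst 21 0; times_loop 12 22;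
  Plus 12 12 12; Plus 12 12 12; Plus 12 12 12; Plus 12 12 12;
  Plus 12 12 12; Plus 12 12 12; Plus 12 12 12].

Definition main : cmd := block (read_input ++ set_bases ++
  [If 9 6 (Seq (Minus 20 11 9) (If 20 6 core Reject)) Reject]).

Ltac trace := repeat (lookup; match goal with
  | Hag : agree _ _ ?R' |- context [?R' ?k] => rewrite (Hag k eq_refl) end); lookup.

Lemma wp_main (P : post) R0 H0 b0 :
  R0 0%nat = X ->
  (forall j, 0 <= j < 63 -> H0 (X + j) = cell (j + 1)) ->
  (forall z, 64 <= z < X -> H0 z = cell z) ->
  (forall z, 2 * X <= z -> H0 z = 0) ->
  (forall v, In v HL -> In (t - v) HR -> D true) ->
  (~ accepts Q W kf a t (horner pi) -> D false) ->
  100 * X + 300 + core_cost <= b0 -> wp main P R0 H0 b0.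
Proof.
  intros E0 Hlow Hhigh Hzero HDt HDf Hb.
  pose proof Q_pos as HQ. pose proof W_pos as HW. pose proof QW_ge as [HQW HWW].
  pose proof horner_pi_range as Hs. pose proof cutoff_nonneg as HT.
  assert (Hcc : 0 <= core_cost).
  { unfold core_cost, keys_cost, side_cost. nia. }
  assert (HXn : Z.of_nat n <= X) by lia. assert (Hdd : dd <= X) by (clear - X_def dd_pos n_pos; nia).
  assert (Hg0 : g0 <= 2 * G) by (clear - G_def g0_pos HQ HW HQW; nia).
  assert (Hnq : (q <= n)%nat) by (rewrite q_def; apply Nat.Div0.div_le_upper_bound; lia).
  unfold main, read_input, set_bases. cbn [map seq app block].
  do 11 wstep0.
  apply wp_count_loop; [trace; auto .. | lia |]. intros R1 b1 Hag1 F2 Eb1.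
  assert (A0 : R1 0%nat = X) by (trace; auto).
  assert (A10 : R1 10%nat = 1) by (trace; auto).
  assert (A11 : R1 11%nat = 0) by (trace; auto).
  do 5 wstep0.
  apply wp_copy_loop; auto; [trace; lia .. | lia |]. intros R2 H2 b2 Hag2 Hcp Hz Eb2.
  do 11 wstep0.
  apply wp_quarter_loop; [trace; auto .. | lia |]. intros R3 b3 Hag3 F3 F4 F13 Eb3.
  assert (G2 : R3 2%nat = Z.of_nat n) by (trace; auto).
  assert (G0 : R3 0%nat = X) by (trace; auto).
  assert (G10 : R3 10%nat = 1) by (trace; auto).
  assert (G11 : R3 11%nat = 0) by (trace; auto).
  assert (Hrd : forall i, (i <= n + w + q + 2)%nat -> rd H2 0 (Z.of_nat i) = cell (Z.of_nat i + 1))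
    by (intros; apply Hcp; lia).
  do 3 wstep0. apply wp_ldR0; [lookup; auto | lookup; lia | lia |]. intros z. lookup.
  replace (R3 2%nat + R3 10%nat) with (Z.of_nat (n + 1)) by lia. rewrite Hrd by lia.
  replace (Z.of_nat (n + 1) + 1) with (Z.of_nat n + 2) by lia. rewrite cell_w.
  wstep0. apply wp_ldR0; [lookup; auto | lookup; lia | lia |]. intros z1. lookup.
  rewrite G2, Hrd, cell_elt by lia.
  replace (elt n) with t by (unfold elt; rewrite app_nth2 by lia; now rewrite n_def, Nat.sub_diag).
  do 7 wstep0.
  apply wp_modulus_loop; [lookup; lia .. |]. intros R4 b4 Hag4 K16 K6 K13 Eb4.
  assert (J0 : R4 0%nat = X) by (trace; auto).
  assert (J10 : R4 10%nat = 1) by (trace; auto).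
  assert (J11 : R4 11%nat = 0) by (trace; auto).
  assert (J20 : R4 20%nat = Z.of_nat (n + 1)) by (rewrite (Hag4 20%nat eq_refl); lookup; reflexivity).
  assert (J5 : R4 5%nat = Z.of_nat w) by (rewrite (Hag4 5%nat eq_refl); lookup; reflexivity).
  assert (J9 : R4 9%nat = t) by (rewrite (Hag4 9%nat eq_refl); lookup; reflexivity).
  assert (J2 : R4 2%nat = Z.of_nat n) by (rewrite (Hag4 2%nat eq_refl); lookup; auto).
  assert (J3 : R4 3%nat = Z.of_nat q) by (rewrite (Hag4 3%nat eq_refl); lookup; auto).
  assert (J4 : R4 4%nat = Q) by (rewrite (Hag4 4%nat eq_refl); lookup; auto).
  do 7 wstep0. apply wp_ldR0; [lookup; auto | lookup; lia | lia |]. intros z2. lookup.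
  replace (R4 20%nat + R4 10%nat + R4 5%nat) with (Z.of_nat (n + 2 + w)) by lia.
  rewrite Hrd by lia.
  replace (Z.of_nat (n + 2 + w) + 1) with (Z.of_nat n + 3 + Z.of_nat w) by lia.
  rewrite cell_pi_length.
  do 7 wstep0.
  apply wp_proof_loop with (s0 := (n + 3 + w)%nat); [lookup; lia .. | | lia | lia |].
  { intros i Hi. rewrite Hrd by lia. rewrite <- cell_pi by auto. f_equal. lia. }
  intros R5 b5 Hag5 K8 Eb5.
  assert (L10 : R5 10%nat = 1) by (rewrite (Hag5 10%nat eq_refl); lookup; auto).
  assert (L2 : R5 2%nat = Z.of_nat n) by (rewrite (Hag5 2%nat eq_refl); lookup; auto).
  assert (L3 : R5 3%nat = Z.of_nat q) by (rewrite (Hag5 3%nat eq_refl); lookup; auto).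
  assert (L4 : R5 4%nat = Q) by (rewrite (Hag5 4%nat eq_refl); lookup; auto).
  assert (HT1 : 0 <= (Z.of_nat n + 1) * Q) by (apply Z.mul_nonneg_nonneg; lia).
  assert (HT2 : cutoff n Q = 128 * ((Z.of_nat n + 1) * ((Z.of_nat n + 1) * Q)))
    by (unfold cutoff; ring).
  assert (HT3 : 1 * ((Z.of_nat n + 1) * Q) <= (Z.of_nat n + 1) * ((Z.of_nat n + 1) * Q))
    by (apply Z.mul_le_mono_nonneg_r; lia).
  do 11 wstep0.
  apply wp_times_loop with (x := Q); [auto | lookup; lia .. |]. intros R6 b6 Hag6 K22 Eb6.
  assert (M10 : R6 10%nat = 1) by (rewrite (Hag6 10%nat eq_refl); lookup; auto).
  assert (M15 : R6 15%nat = Z.of_nat n + 1) by (rewrite (Hag6 15%nat eq_refl); lookup; lia).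
  do 5 wstep0.
  apply wp_times_loop with (x := (Z.of_nat n + 1) * Q); [auto | lookup; lia .. |].
  intros R7 b7 Hag7 K12 Eb7.
  assert (N13 : R7 13%nat = 2 * G) by (trace; auto).
  assert (N11 : R7 11%nat = 0) by (trace; auto).
  do 14 wstep0.
  do 36 wstep0.
  match goal with |- wp _ _ ?R _ _ => set (RF := R) end.
  assert (HE : Env RF).
  { intros r Hr.
    (* Registers are checked one by one; 58 is the last static one. *)
    do 59 (destruct r as [|r]; [try discriminate Hr; unfold RF; cbn [static_value]; trace; lia|]).
    destruct r; discriminate Hr. }
  clearbody RF.
  assert (HI : Inp H2).
  { split; intros i Hi.
    - rewrite Hrd, cell_elt by lia. reflexivity.
    - replace (Z.of_nat n + 2 + Z.of_nat i) with (Z.of_nat (n + 2 + i)) by lia.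
      rewrite Hrd by lia. rewrite <- cell_rho by auto. f_equal. lia. }
  (* Every region lies above [G], hence above [2 * X], where neither the input nor its copy has
     written. *)
  assert (Hreg : forall r v, (1 <= r <= 18)%nat -> Z.abs v < G -> rd H2 r v = 0).
  { intros r v Hr Hv. unfold rd, base. destruct r as [|r]; [lia|].
    assert (2 * G * 1 <= 2 * G * Z.of_nat (S r)) by (apply Z.mul_le_mono_nonneg_l; lia).
    rewrite Hz, Hzero; lia. }
  apply wp_if; statics; intro Ht1; [|apply wp_rej; [lia|]; apply HDf; intros [Hbad _]; lia].
  do 2 wstep.
  apply wp_if; lookup; statics; intro Ht2; [|apply wp_rej; [lia|]; apply HDf; intros [Hbad _]; lia].
  apply wp_core; [env | exact HI | lia | exact Hreg | exact HDt | exact HDf | lia].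
Qed.

End Machine.

(** * Freeing the registers *)

(** This phase runs while the low cells still hold the input, so it is treated at the level of
    instructions, with [k] counting steps. *)
Definition go (BB : Z) (P : program) pc m pc' m' (k : Z) : Prop :=
  exists s c, msteps P pc m pc' m' s c /\ Z.of_nat c <= k * step_cost BB.

Lemma go_trans BB P pc m pc1 m1 k1 pc2 m2 k2 :
  go BB P pc m pc1 m1 k1 -> go BB P pc1 m1 pc2 m2 k2 -> go BB P pc m pc2 m2 (k1 + k2).
Proof.
  intros (s1 & c1 & H1 & C1) (s2 & c2 & H2 & C2). exists (s1 + s2)%nat, (c1 + c2)%nat.
  split; [eapply msteps_trans; eauto|]. rewrite Z.mul_add_distr_r. lia.
Qed.

Lemma go_refl BB P pc m : go BB P pc m pc m 0.
Proof. exists 0%nat, 0%nat. split; [constructor | lia]. Qed.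

Lemma go_weaken BB P pc m pc' m' k k' :
  0 <= BB -> k <= k' -> go BB P pc m pc' m' k -> go BB P pc m pc' m' k'.
Proof.
  intros HB Hk (s & c & H & C). exists s, c. split; auto.
  pose proof (Z.log2_nonneg BB).
  assert (k * step_cost BB <= k' * step_cost BB)
    by (apply Z.mul_le_mono_nonneg_r; unfold step_cost; lia). lia.
Qed.

Lemma go_instr BB (P : program) pc m x pc' m' :
  bounded BB m -> nth_error P pc = Some x ->
  match x with
  | IConst d z => Z.abs z <= BB /\ pc' = S pc /\ m' = upd m d z
  | IAdd d a b => pc' = S pc /\ m' = upd m d (m a + m b)
  | IStore a s => pc' = S pc /\ m' = upd m (addr (m a)) (m s)
  | IJlt a b l => pc' = (if m a <? m b then l else S pc) /\ m' = m
  | _ => False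
  end -> go BB P pc m pc' m' 1.
Proof.
  intros Hm Hx Hi.
  assert (HBB : 0 <= BB) by (pose proof (Hm 0%nat); lia).
  pose proof (Z.log2_nonneg BB) as Hlog.
  assert (Hz : forall i, Z.of_nat (zlen (m i)) <= Z.log2 BB + 1)
    by (intro; apply zlen_bound, Hm).
  destruct x; try contradiction.
  - destruct Hi as (Hzz & -> & ->). eexists _, _.
    split; [apply msteps_one; unfold step; rewrite Hx; reflexivity|].
    pose proof (zlen_bound _ _ Hzz). unfold step_cost. lia.
  - destruct Hi as [-> ->]. eexists _, _.
    split; [apply msteps_one; unfold step; rewrite Hx; reflexivity|].
    pose proof (Hz a); pose proof (Hz b). unfold step_cost. lia.
  - destruct Hi as [-> ->]. eexists _, _.
    split; [apply msteps_one; unfold step; rewrite Hx; reflexivity|].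
    pose proof (Hz a); pose proof (Hz s). unfold step_cost. lia.
  - destruct Hi as [-> ->]. eexists _, _.
    split; [apply msteps_one; unfold step; rewrite Hx; reflexivity|].
    pose proof (Hz a); pose proof (Hz b). unfold step_cost. lia.
Qed.

(* The bits of [rho] being absent exactly for n = 0, the cells 2, ..., 5 are equal exactly then:
   for n = 0 they all hold 0, for n = 1 and n = 2 the length of [rho] meets its first bit, and
   for larger n they contain two different integers of the input.  The input is then t alone. *)
Definition test_empty : list instr := [
  IJlt 2 3 10; IJlt 3 2 10; IJlt 3 4 10; IJlt 4 3 10; IJlt 4 5 10; IJlt 5 4 10;
  IJlt 0 1 9; IJlt 1 0 9; IAccept; IReject].

(** Cell 1 computes the addresses; its own content has been stored at [X] beforehand. *)
Definition save (j : nat) : list instr := [IConst 1 (Z.of_nat j); IAdd 1 0 1; IStore 1 (S j)].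

(** Doubling cell 0 in place yields an address past the input without destroying any other cell, and
    the old length stays recoverable. Storing cell 1 there frees a second cell, and then the
    remaining ones can follow. *)
Definition save_code (d : nat) : list instr :=
  repeat (IAdd 0 0 0) d ++ [IStore 0 1] ++ flat_map save (seq 1 62).

(** Ten instructions of the emptiness test, [d] doublings, one store, and three instructions for
    each of 62 cells. *)
Definition main_start (d : nat) : nat := (10 + (d + 187))%nat.

(** With [d = c + 6] the factor [2 ^ d] is at least [64 * (c + 1)], so for a nonempty input
    [X = 2 ^ d * n] is at least 64 and lies past all input cells. The second constant gives
    [2 * G = 2 ^ (d + 8 + w)], ample for [2 * X] and [20 * Q * W]. *)
Definition verifier (c : nat) : program :=
  let d := (c + 6)%nat in
  test_empty ++ save_code d
    ++ compile (main_start d) (main (2 ^ Z.of_nat d) (2 ^ Z.of_nat (d + 8))).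

Lemma code_at_start P l : P = l -> code_at P 0 l.
Proof. intros -> i x Hi. exact Hi. Qed.

Lemma go_jumps BB P m l : forall pc, bounded BB m ->
  code_at P pc (map (fun ab => IJlt (fst ab) (snd ab) 10) l) ->
  (exists ab, In ab l /\ m (fst ab) < m (snd ab)) ->
  go BB P pc m 10 m (Z.of_nat (length l)).
Proof.
  induction l as [|[x y] l IH]; intros pc Hm Hc (ab & Hin & Hab); [destruct Hin|].
  assert (HBB : 0 <= BB) by (pose proof (Hm 0%nat); lia).
  cbn [map fst snd length] in *. apply code_at_cons in Hc as [Hi Hc].
  pose proof (fun pc' h => go_instr BB P pc m _ pc' m Hm Hi (conj h eq_refl)) as Hgo.
  rewrite Nat2Z.inj_succ. destruct (Z.ltb_spec (m x) (m y)) as [Hlt | Hge].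
  - eapply go_weaken; [exact HBB | | exact (Hgo _ eq_refl)]. lia.
  - replace (Z.succ (Z.of_nat (length l))) with (1 + Z.of_nat (length l)) by lia.
    eapply go_trans; [exact (Hgo _ eq_refl)|]. apply IH; auto. exists ab. split; auto.
    destruct Hin as [<- | Hin]; [cbn in Hab; lia | auto].
Qed.

Lemma go_test_empty BB P m : bounded BB m -> code_at P 0 test_empty ->
  m 2%nat <> m 3%nat \/ m 3%nat <> m 4%nat \/ m 4%nat <> m 5%nat -> go BB P 0 m 10 m 6.
Proof.
  intros Hm Hc Hne.
  apply (go_jumps BB P m [(2, 3); (3, 2); (3, 4); (4, 3); (4, 5); (5, 4)]%nat); auto.
  - intros i x Hx. apply Hc. do 6 (destruct i as [|i]; [exact Hx|]). now destruct i.
  - destruct Hne as [H | [H | H]]; apply Z.lt_gt_cases in H as [H | H];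
      eexists (_, _); (split; [|exact H]); simpl; auto 10.
Qed.

Lemma go_doubles BB P d : forall pc m,
  bounded BB m -> code_at P pc (repeat (IAdd 0 0 0) d) -> 2 ^ Z.of_nat d * Z.abs (m 0%nat) <= BB ->
  exists m', go BB P pc m (pc + d) m' (Z.of_nat d) /\ bounded BB m' /\
    m' 0%nat = 2 ^ Z.of_nat d * m 0%nat /\ forall j, j <> 0%nat -> m' j = m j.
Proof.
  induction d as [|d IH]; intros pc m Hm Hc Hb.
  - exists m. rewrite Nat.add_0_r. split; [apply go_refl|].
    change (2 ^ Z.of_nat 0) with 1. repeat split; auto; lia.
  - rewrite Nat2Z.inj_succ, Z.pow_succ_r in * by lia. simpl repeat in Hc.
    apply code_at_cons in Hc as [Hi Hc].
    set (m1 := upd m 0 (m 0%nat + m 0%nat)).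
    assert (E1 : m1 0%nat = 2 * m 0%nat) by (unfold m1, upd; simpl Nat.eqb; cbv iota; lia).
    assert (Hp : 0 < 2 ^ Z.of_nat d) by (apply Z.pow_pos_nonneg; lia).
    assert (Hm1 : bounded BB m1) by (apply bounded_upd; auto; nia).
    destruct (IH (S pc) m1 Hm1 Hc ltac:(rewrite E1; lia)) as (m' & Hgo & Hb' & E0 & Ej).
    exists m'. split; [|split; [auto | split]].
    + replace (pc + S d)%nat with (S pc + d)%nat by lia.
      replace (Z.succ (Z.of_nat d)) with (1 + Z.of_nat d) by lia.
      eapply go_trans; [|exact Hgo]. eapply go_instr; eauto. simpl. auto.
    + rewrite E0, E1. lia.
    + intros j Hj. rewrite Ej by auto. unfold m1, upd. destruct (Nat.eqb_spec j 0); [lia | auto].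
Qed.

Lemma go_saves BB P (X : nat) (cells : nat -> Z) k : forall s pc m,
  bounded BB m -> code_at P pc (flat_map save (seq s k)) -> (1 <= s)%nat ->
  (s + k < X)%nat -> 2 * Z.of_nat X <= BB ->
  m 0%nat = Z.of_nat X -> (forall j, (j < s)%nat -> m (X + j)%nat = cells (S j)) ->
  (forall j, (2 <= j < X \/ 2 * X <= j)%nat -> m j = cells j) ->
  exists m', go BB P pc m (pc + 3 * k) m' (3 * Z.of_nat k) /\ bounded BB m' /\
    m' 0%nat = Z.of_nat X /\ (forall j, (j < s + k)%nat -> m' (X + j)%nat = cells (S j)) /\
    (forall j, (2 <= j < X \/ 2 * X <= j)%nat -> m' j = cells j).
Proof.
  induction k as [|k IH]; intros s pc m Hm Hc Hs HsX HBB E0 Elow Ehigh.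
  - exists m. rewrite !Nat.add_0_r. split; [apply go_refl | auto].
  - cbn [seq flat_map] in Hc. unfold save at 1 in Hc.
    apply code_at_app in Hc as [Hc1 Hc2]. cbn [length] in Hc2.
    apply code_at_cons in Hc1 as [I1 Hc1]. apply code_at_cons in Hc1 as [I2 Hc1].
    apply code_at_cons in Hc1 as [I3 _].
    set (m1 := upd m 1 (Z.of_nat s)).
    set (m2 := upd m1 1 (m1 0%nat + m1 1%nat)).
    set (m3 := upd m2 (addr (m2 1%nat)) (m2 (S s))).
    assert (B1 : bounded BB m1) by (apply bounded_upd; auto; lia).
    assert (F2 : m1 0%nat + m1 1%nat = Z.of_nat (X + s))
      by (unfold m1, upd; simpl Nat.eqb; cbv iota; lia).
    assert (B2 : bounded BB m2) by (apply bounded_upd; auto; lia).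
    assert (B3 : bounded BB m3) by (apply bounded_upd; auto; apply B2).
    assert (Ea : addr (m2 1%nat) = (X + s)%nat).
    { unfold m2, upd, addr. simpl Nat.eqb. cbv iota. rewrite F2. lia. }
    assert (E2 : forall j, j <> 1%nat -> m2 j = m j).
    { intros j Hj. unfold m2, m1, upd. destruct (Nat.eqb_spec j 1); [lia | auto]. }
    assert (E3 : forall j, j <> 1%nat -> j <> (X + s)%nat -> m3 j = m j).
    { intros j Hj1 Hj2. unfold m3, upd at 1. rewrite Ea.
      destruct (Nat.eqb_spec j (X + s)); [lia | auto]. }
    destruct (IH (S s) (pc + 3)%nat m3) as (m' & Hgo & Hb' & R0 & R1 & R2); auto; try lia.
    + rewrite E3 by lia. exact E0.
    + intros j Hj. destruct (Nat.eq_dec j s) as [-> | Hne].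
      * unfold m3, upd at 1. rewrite Ea, Nat.eqb_refl, E2 by lia. apply Ehigh. lia.
      * rewrite E3 by lia. apply Elow. lia.
    + intros j Hj. rewrite E3 by lia. auto.
    + exists m'. split; [|split; [auto | split; [auto | split; [intros; apply R1; lia | auto]]]].
      replace (pc + 3 * S k)%nat with (pc + 3 + 3 * k)%nat by lia.
      replace (3 * Z.of_nat (S k)) with (1 + (1 + (1 + 3 * Z.of_nat k))) by lia.
      eapply go_trans; [eapply go_instr with (m' := m1); [exact Hm | exact I1 | simpl; repeat split; lia]|].
      eapply go_trans; [eapply go_instr with (m' := m2); [exact B1 | exact I2 | simpl; auto]|].
      replace (pc + 3)%nat with (S (S (S pc))) in Hgo by lia.
      eapply go_trans; [eapply go_instr with (m' := m3); [exact B2 | exact I3 | simpl; auto]|].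
      replace (pc + 3 + 3 * k)%nat with (S (S (S pc)) + 3 * k)%nat by lia. exact Hgo.
Qed.

Lemma flat_map_save_length s k : length (flat_map save (seq s k)) = (3 * k)%nat.
Proof.
  revert s. induction k as [|k IH]; intro s; auto. cbn [seq flat_map].
  rewrite length_app, IH. cbn [save length]. lia.
Qed.

Lemma go_save_code BB P d (X : nat) (m : memory) :
  bounded BB m -> code_at P 10 (save_code d) -> Z.of_nat X = 2 ^ Z.of_nat d * m 0%nat ->
  (64 <= X)%nat -> 2 * Z.of_nat X <= BB ->
  exists m', go BB P 10 m (main_start d) m' (Z.of_nat d + 187) /\ bounded BB m' /\
    m' 0%nat = Z.of_nat X /\ (forall j, (j < 63)%nat -> m' (X + j)%nat = m (S j)) /\
    (forall j, (2 <= j < X \/ 2 * X <= j)%nat -> m' j = m j).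
Proof.
  intros Hm Hc HX HX64 HBB. unfold save_code in Hc.
  apply code_at_app in Hc as [Hc1 Hc]. rewrite repeat_length in Hc.
  apply code_at_app in Hc as [Hc2 Hc]. cbn [length] in Hc.
  apply code_at_cons in Hc2 as [I2 _].
  assert (Hp : 0 < 2 ^ Z.of_nat d) by (apply Z.pow_pos_nonneg; lia).
  destruct (go_doubles BB P d 10 m Hm Hc1) as (m1 & G1 & B1 & E0 & Ej).
  { rewrite <- (Z.abs_eq (2 ^ Z.of_nat d)) by lia. rewrite <- Z.abs_mul, <- HX. lia. }
  rewrite <- HX in E0.
  set (m2 := upd m1 (addr (m1 0%nat)) (m1 1%nat)).
  assert (B2 : bounded BB m2) by (apply bounded_upd; auto; apply B1).
  assert (Ea : addr (m1 0%nat) = X) by (rewrite E0; unfold addr; lia).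
  assert (E2 : forall j, j <> 0%nat -> j <> X -> m2 j = m j).
  { intros j Hj Hj'. unfold m2, upd. rewrite Ea. destruct (Nat.eqb_spec j X); [lia|]. auto. }
  destruct (go_saves BB P X m 62 1 (10 + d + 1) m2) as (m' & G' & B' & R0 & R1 & R2);
    auto; try lia.
  - unfold m2, upd. rewrite Ea. destruct (Nat.eqb_spec 0 X); [lia | auto].
  - intros j Hj. assert (j = 0)%nat by lia. subst j. rewrite Nat.add_0_r. unfold m2, upd.
    rewrite Ea, Nat.eqb_refl. apply Ej. lia.
  - intros j Hj. apply E2; lia.
  - exists m'. split; [|auto].
    replace (main_start d) with (10 + d + 1 + 3 * 62)%nat by (unfold main_start; lia).
    replace (Z.of_nat d + 187) with (Z.of_nat d + (1 + 3 * Z.of_nat 62)) by lia.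
    eapply go_trans; [exact G1|]. eapply go_trans; [|exact G'].
    eapply go_instr; [exact B1 | exact I2 | simpl]. split; [lia | auto].
Qed.

Lemma verifier_code c :
  code_at (verifier c) 0 test_empty /\ code_at (verifier c) 10 (save_code (c + 6)) /\
  code_at (verifier c) (main_start (c + 6))
    (compile (main_start (c + 6)) (main (2 ^ Z.of_nat (c + 6)) (2 ^ Z.of_nat (c + 6 + 8)))).
Proof.
  pose proof (code_at_start _ _ (eq_refl (verifier c))) as H.
  unfold verifier at 2 in H. cbv zeta in H.
  apply code_at_app in H as [H1 H]. apply code_at_app in H as [H2 H].
  split; [exact H1 | split; [exact H2|]].
  replace (0 + length test_empty + length (save_code (c + 6)))%nat
    with (main_start (c + 6)) in H; [exact H|].
  unfold save_code. rewrite !length_app, repeat_length, flat_map_save_length.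
  unfold main_start. cbn [length test_empty]. lia.
Qed.

(** The first summand pays for reading the input, which is linear in [X], the second for the passes
    over the [(c + 4) * n] random bits, and the last for everything else, including [30 * 128] for
    the hits. *)
Definition kfactor (c : nat) : Z := 100 * 2 ^ Z.of_nat (c + 6) + 40 * (Z.of_nat c + 4) + 20000.

Lemma core_cost_bound c n Q : 1 <= Q ->
  100 * (2 ^ Z.of_nat (c + 6) * Z.of_nat n) + 300 + core_cost n (rlen c n) Q + Z.of_nat (c + 6) + 200
  <= kfactor c * ((Z.of_nat n + 1) * (Z.of_nat n + 1) * Q).
Proof.
  intro HQ. unfold core_cost, keys_cost, side_cost, cutoff, kfactor, rlen.
  rewrite !Nat2Z.inj_mul, !Nat2Z.inj_add.
  pose proof (Z.pow_pos_nonneg 2 (Z.of_nat (c + 6)) ltac:(lia) ltac:(lia)) as Hp.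
  rewrite Nat2Z.inj_add in Hp.
  set (p := 2 ^ (Z.of_nat c + Z.of_nat 6)) in *.
  change (Z.of_nat 4) with 4. change (Z.of_nat 6) with 6. change (Z.of_nat 1) with 1.
  set (N := Z.of_nat n). set (C := Z.of_nat c).
  assert (HN : 0 <= N) by (unfold N; lia). assert (HC : 0 <= C) by (unfold C; lia).
  clearbody p N C.
  set (Y := (N + 1) * (N + 1) * Q).
  assert (Y1 : N <= Y) by (unfold Y; nia).
  assert (Y2 : (N + 1) * N <= Y) by (unfold Y; nia).
  assert (Y3 : (N + 1) * Q <= Y) by (unfold Y; nia).
  assert (Y4 : N + 1 <= Y) by (unfold Y; nia).
  assert (Y5 : Q <= Y) by (unfold Y; nia).
  assert (P1 : p * N <= p * Y) by (apply Z.mul_le_mono_nonneg_l; lia).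
  assert (P2 : C * ((N + 1) * N) <= C * Y) by (apply Z.mul_le_mono_nonneg_l; lia).
  assert (P3 : C * 1 <= C * Y) by (apply Z.mul_le_mono_nonneg_l; lia).
  replace (30 * (128 * (N + 1) * (N + 1) * Q)) with (3840 * Y) by (unfold Y; ring).
  replace ((N + 1) * (20 * ((C + 4) * N) + 4 * Q + 60)) with
    (20 * (C * ((N + 1) * N)) + 80 * ((N + 1) * N) + 4 * ((N + 1) * Q) + 60 * (N + 1)) by ring.
  replace ((N + 1) * (240 * Q + 30)) with (240 * ((N + 1) * Q) + 30 * (N + 1)) by ring.
  clearbody Y. lia.
Qed.

Lemma abs_lt_zlen z : Z.abs z < 2 ^ Z.of_nat (zlen z).
Proof.
  unfold zlen. rewrite Nat2Z.inj_add. pose proof (Z.log2_nonneg (Z.abs z)).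
  rewrite Z2Nat.id by lia. change (Z.of_nat 1) with 1.
  destruct (Z.eq_dec (Z.abs z) 0) as [-> | Hz]; [cbn; lia|].
  apply Z.log2_spec. lia.
Qed.

Lemma input_cells_length a t rho pi :
  length (input_cells a t rho pi) = (length a + length rho + length pi + 4)%nat.
Proof.
  unfold input_cells. cbn [length]. rewrite !length_app. cbn [length].
  rewrite !length_app, !length_map. cbn [length]. rewrite !length_map. lia.
Qed.

Lemma init_mem_bounded BB a t rho pi :
  1 <= BB -> Z.of_nat (length a) <= BB -> Z.abs t <= BB -> Z.of_nat (length rho) <= BB ->
  Z.of_nat (length pi) <= BB -> (forall x, In x a -> Z.abs x <= BB) ->
  bounded BB (init_mem (input_cells a t rho pi)).
Proof.
  intros H1 Ha Ht Hr Hp Hx.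
  assert (Hall : forall x, In x (input_cells a t rho pi) -> Z.abs x <= BB).
  { assert (Hbits : forall l x, In x (map Z.b2z l) -> Z.abs x <= BB).
    { intros l x Hin. apply in_map_iff in Hin as (b & <- & _). destruct b; cbn; lia. }
    intros x. unfold input_cells. simpl. rewrite in_app_iff. simpl. rewrite in_app_iff. simpl.
    intros [<- | [Hin | [<- | [<- | [Hin | [<- | Hin]]]]]]; eauto; lia. }
  intro i. unfold init_mem.
  destruct (nth_in_or_default i (input_cells a t rho pi) 0) as [Hin | ->]; [auto | cbn; lia].
Qed.

(* Distinct integers are needed for the emptiness test to recognize a nonempty input. *)
Lemma input_not_empty c a t rho pi : (0 < length a)%nat -> NoDup a ->
  length rho = rlen c (length a) ->
  let m := init_mem (input_cells a t rho pi) in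
  m 2%nat <> m 3%nat \/ m 3%nat <> m 4%nat \/ m 4%nat <> m 5%nat.
Proof.
  intros Hn Hnd Hr m. unfold m, init_mem, input_cells.
  destruct a as [|a1 [|a2 [|a3 a]]]; simpl in Hn; [lia| | |].
  - right. left. unfold rlen in Hr. destruct rho as [|b rho]; cbn [length] in Hr; [lia|].
    cbn [length app nth map]. rewrite Hr. destruct b; cbn [Z.b2z]; lia.
  - right. right. unfold rlen in Hr. destruct rho as [|b rho]; cbn [length] in Hr; [lia|].
    cbn [length app nth map]. rewrite Hr. destruct b; cbn [Z.b2z]; lia.
  - left. cbn [app nth]. intros ->. inversion Hnd as [|x l _ Hnd2]; subst.
    inversion Hnd2 as [|x l Hx _]; subst. apply Hx. simpl. auto.
Qed.

(** Two implications that leave room between them: when the instance is solvable but [accepts]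
    fails, either answer is allowed. The first gives soundness, the second completeness. *)
Definition answer_spec (c : nat) (a : list Z) (t : Z) (rho pi : list bool) (b : bool) : Prop :=
  let q := (length a / 4)%nat in
  let Q := 2 ^ Z.of_nat q in
  let W := 2 ^ Z.of_nat (rlen c (length a) - q) in
  (b = true -> subset_sum a t) /\
  (b = false -> ~ accepts Q W (key (horner rho) Q W) a t (horner pi)).

Lemma verifier_run c a t rho pi : (0 < length a)%nat -> NoDup a ->
  (forall x, In x a -> Z.abs x <= 2 ^ Z.of_nat (c * length a)) ->
  length rho = rlen c (length a) -> (length pi <= length a / 4)%nat ->
  exists b cost, halts_with (verifier c) (init_mem (input_cells a t rho pi)) b cost /\
    Z.of_nat cost <= kfactor c * ((Z.of_nat (length a) + 1) * (Z.of_nat (length a) + 1)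
        * 2 ^ Z.of_nat (length a / 4))
      * (2 * Z.of_nat (rlen c (length a) + c + 40 + zlen t) + 3) /\
    answer_spec c a t rho pi b.
Proof.
  intros Hn Hnd Ha Hrho Hpi.
  pose proof (input_not_empty c a t rho pi Hn Hnd Hrho) as Htest. cbv zeta in Htest.
  set (n := length a) in *. set (w := rlen c n) in *. set (q := (n / 4)%nat) in *.
  set (Q := 2 ^ Z.of_nat q). set (W := 2 ^ Z.of_nat (w - q)).
  set (d := (c + 6)%nat). set (X := (2 ^ d * n)%nat).
  (* The largest address needs [w + c + 20] bits at most. The length of [t] is added because [t],
     which may be arbitrarily large, is read before its size is tested. *)
  set (NB := (w + c + 40 + zlen t)%nat). set (BB := 2 ^ Z.of_nat NB).
  set (G := 2 ^ Z.of_nat (d + 7 + w)).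
  assert (Hqn : (q <= n)%nat) by (apply Nat.Div0.div_le_upper_bound; lia).
  assert (Hw : (w = c * n + 4 * n)%nat) by (unfold w, rlen; lia).
  assert (HQW : Q * W = 2 ^ Z.of_nat w).
  { unfold Q, W. rewrite <- Z.pow_add_r by lia. f_equal. lia. }
  assert (pmono : forall i j, (i <= j)%nat -> 2 ^ Z.of_nat i <= 2 ^ Z.of_nat j)
    by (intros; apply Z.pow_le_mono_r; lia).
  assert (ppos : forall i, 0 < 2 ^ Z.of_nat i) by (intro; apply Z.pow_pos_nonneg; lia).
  assert (padd : forall i j, 2 ^ Z.of_nat (i + j) = 2 ^ Z.of_nat i * 2 ^ Z.of_nat j)
    by (intros; rewrite Nat2Z.inj_add, Z.pow_add_r; lia).
  pose proof (pow2_ge_succ n) as Hn2. pose proof (pow2_ge_succ c) as Hc2.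
  assert (EX : Z.of_nat X = 2 ^ Z.of_nat d * Z.of_nat n).
  { unfold X. rewrite Nat2Z.inj_mul, Nat2Z.inj_pow. reflexivity. }
  clearbody X.
  assert (Hd64 : 64 * (Z.of_nat c + 1) <= 2 ^ Z.of_nat d).
  { unfold d. rewrite padd. change (2 ^ Z.of_nat 6) with 64. lia. }
  assert (HXin : Z.of_nat (n + w + q) + 4 <= Z.of_nat X).
  { rewrite EX, Hw.
    assert (64 * (Z.of_nat c + 1) * Z.of_nat n <= 2 ^ Z.of_nat d * Z.of_nat n)
      by (apply Z.mul_le_mono_nonneg_r; lia).
    assert (0 <= Z.of_nat c * Z.of_nat n) by (apply Z.mul_nonneg_nonneg; lia).
    rewrite !Nat2Z.inj_add, !Nat2Z.inj_mul. lia. }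
  assert (HX64 : (64 <= X)%nat).
  { assert (64 * 1 <= 2 ^ Z.of_nat d * Z.of_nat n) by (apply Z.mul_le_mono_nonneg; lia). lia. }
  assert (HXG : 2 * Z.of_nat X <= G).
  { rewrite EX. unfold G. rewrite !padd. change (2 ^ Z.of_nat 7) with 128.
    assert (Z.of_nat n <= 2 ^ Z.of_nat w) by (pose proof (pmono n w); lia).
    assert (2 ^ Z.of_nat d * Z.of_nat n <= 2 ^ Z.of_nat d * 2 ^ Z.of_nat w)
      by (apply Z.mul_le_mono_nonneg_l; [pose proof (ppos d); lia | lia]).
    lia. }
  assert (HGM : 20 * (Q * W) <= G).
  { rewrite HQW. unfold G. rewrite padd, (padd d 7%nat). change (2 ^ Z.of_nat 7) with 128.
    apply Z.mul_le_mono_nonneg_r; [pose proof (ppos w); lia | lia]. }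
  assert (HGB : 100 * G <= BB).
  { unfold G, BB. apply Z.le_trans with (2 ^ Z.of_nat (7 + (d + 7 + w))).
    - rewrite (padd 7%nat). change (2 ^ Z.of_nat 7) with 128. pose proof (ppos (d + 7 + w)%nat). lia.
    - apply pmono. unfold NB, d. lia. }
  assert (Hcut : cutoff n Q <= BB).
  { unfold BB, cutoff. apply Z.le_trans with (2 ^ Z.of_nat (7 + (n + (n + q)))).
    - rewrite !padd. change (2 ^ Z.of_nat 7) with 128. fold Q.
      assert ((Z.of_nat n + 1) * (Z.of_nat n + 1) <= 2 ^ Z.of_nat n * 2 ^ Z.of_nat n)
        by (apply Z.mul_le_mono_nonneg; lia).
      assert ((Z.of_nat n + 1) * (Z.of_nat n + 1) * Q <= 2 ^ Z.of_nat n * 2 ^ Z.of_nat n * Q)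
        by (apply Z.mul_le_mono_nonneg_r; [pose proof (ppos q); lia | lia]).
      lia.
    - apply pmono. unfold NB. lia. }
  assert (HtB : Z.abs t <= BB).
  { pose proof (abs_lt_zlen t). pose proof (pmono (zlen t) NB ltac:(unfold NB; lia)).
    unfold BB. lia. }
  assert (HaW : Z.of_nat n * 2 ^ Z.of_nat (c * n) < W).
  { unfold W. apply Z.lt_le_trans with (2 ^ Z.of_nat (n + c * n)).
    - rewrite padd. apply Z.mul_lt_mono_pos_r; [apply ppos | lia].
    - apply pmono. lia. }
  set (m := init_mem (input_cells a t rho pi)) in *.
  assert (Hm : bounded BB m).
  { apply init_mem_bounded; auto; fold n; try lia.
    intros x Hx. specialize (Ha x Hx). pose proof (pmono (c * n)%nat NB ltac:(unfold NB; lia)).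
    unfold BB. lia. }
  destruct (verifier_code c) as (V1 & V2 & V3). fold d in V2, V3.
  pose proof (go_test_empty BB (verifier c) m Hm V1 Htest) as G1.
  destruct (go_save_code BB (verifier c) d X m Hm V2) as (m' & G2 & Hm' & E0 & E1 & E2);
    [exact EX | exact HX64 | lia |].
  assert (Hlen : length (input_cells a t rho pi) = (n + w + length pi + 4)%nat)
    by (rewrite input_cells_length, Hrho; reflexivity).
  (* The postcondition [False] says that [main] never runs past its end: it halts with an answer. *)
  assert (Hwp : wp BB (answer_spec c a t rho pi) (main (2 ^ Z.of_nat d) (2 ^ Z.of_nat (d + 8)))
    (fun _ _ _ => False) m' (fun z => m' (Z.to_nat z))
    (100 * Z.of_nat X + 300 + core_cost n w Q)).
  { eapply wp_main with (X := Z.of_nat X) (G := G) (a := a) (t := t) (rho := rho) (pi := pi)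
      (n := n) (q := q) (w := w) (Q := Q) (W := W) (A_max := 2 ^ Z.of_nat (c * n))
      (kf := key (horner rho) Q W); auto; try lia; try reflexivity.
    - unfold G. rewrite HQW, <- padd. replace (d + 8 + w)%nat with (1 + (d + 7 + w))%nat by lia.
      rewrite (padd 1%nat). reflexivity.
    - intros j Hj. replace (Z.to_nat (Z.of_nat X + j)) with (X + Z.to_nat j)%nat by lia.
      rewrite E1 by lia. unfold m, init_mem, cell. f_equal. lia.
    - intros z Hz. rewrite E2 by lia. reflexivity.
    - intros z Hz. rewrite E2 by lia. apply nth_overflow. lia.
    - intros v Hv1 Hv2. split; [intros _ | discriminate]. eapply accepts_sound; eauto.
    - intros Hna. split; [discriminate | intros _; exact Hna]. }
  destruct Hwp as (k & r & Hex & Hk & Hr).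
  destruct r as [|b]; [contradiction|].
  assert (Hrep : rep m' (fun z => m' (Z.to_nat z)) m').
  { split; auto. intros i _. now rewrite Nat2Z.id. }
  pose proof (compile_correct _ (verifier c) _ _ _ _ _ Hex (main_start d) m' eq_refl V3 Hrep Hm') as Hre.
  destruct (go_trans _ _ _ _ _ _ _ _ _ _ G1 G2) as (s & c0 & Hs & Hc0).
  pose proof (reaches_prepend BB _ _ _ _ _ _ _ _ _ _ _ Hs Hc0 Hre) as (fuel & cost & Hrun & Hcost).
  exists b, cost. split; [exists fuel; exact Hrun|]. split; [|exact Hr].
  unfold step_cost in Hcost.
  assert (Elog : Z.log2 BB = Z.of_nat NB) by (apply Z.log2_pow2; lia).
  rewrite Elog in Hcost. fold NB.
  eapply Z.le_trans; [exact Hcost|]. apply Z.mul_le_mono_nonneg_r; [lia|].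
  assert (HQ1 : 1 <= Q) by (pose proof (ppos q); lia).
  pose proof (core_cost_bound c n Q HQ1) as Hcc. fold d w in Hcc. rewrite <- EX in Hcc. fold Q. lia.
Qed.

(* The empty input and the final bounds *)
Close Scope Z_scope.

(** Cells 2 to 5 hold 0, so the first six jumps fall through at cost 3 each, 18 in all. Cell 0 holds
    the length 0 and serves as the constant with which [t], in cell 1, is compared. *)
Lemma empty_run P t : code_at P 0 test_empty ->
  exists cost, halts_with P (init_mem (input_cells [] t [] [])) (t =? 0)%Z cost /\
    cost <= 30 * zlen t.
Proof.
  intro Hc.
  assert (Hi : forall i x, nth_error test_empty i = Some x -> nth_error P i = Some x)
    by (intros i x Hx; apply (Hc i x Hx)).
  assert (Hz : 1 <= zlen t) by (unfold zlen; lia).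
  set (m := init_mem (input_cells [] t [] [])).
  assert (Hjump : forall pc a b l, nth_error test_empty pc = Some (IJlt a b l) ->
    (m b <= m a)%Z -> step P pc m = Continue (S pc) m (1 + zlen (m a) + zlen (m b))).
  { intros pc a b l Hx Hab. unfold step. rewrite (Hi _ _ Hx). apply Z.ltb_ge in Hab as ->.
    reflexivity. }
  assert (E : forall f, run P (6 + f) 0 m =
    match run P f 6 m with Some (b, c) => Some (b, 18 + c) | None => None end).
  { intro f. cbn [run Nat.add].
    rewrite (Hjump 0 _ _ _ eq_refl), (Hjump 1 _ _ _ eq_refl), (Hjump 2 _ _ _ eq_refl),
      (Hjump 3 _ _ _ eq_refl), (Hjump 4 _ _ _ eq_refl), (Hjump 5 _ _ _ eq_refl)
      by (cbn; lia).
    destruct (run P f 6 m) as [[b c]|]; reflexivity. }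
  unfold halts_with.
  destruct (Z.lt_trichotomy t 0) as [Ht | [-> | Ht]].
  - exists (18 + (1 + 1 + zlen t + (1 + zlen t + 1 + 1))). split; [|lia].
    exists 9. change 9 with (6 + 3). rewrite E. cbn [run].
    rewrite (Hjump 6 _ _ _ eq_refl) by (cbn; lia).
    unfold step at 1. rewrite (Hi 7 _ eq_refl).
    change (m 1) with t. change (m 0) with 0%Z.
    destruct (Z.ltb_spec t 0); [|lia]. unfold step. rewrite (Hi 9 _ eq_refl).
    destruct (Z.eqb_spec t 0); [lia|]. reflexivity.
  - exists (18 + (3 + (3 + 1))). split; [|lia].
    exists 9. change 9 with (6 + 3). rewrite E. cbn [run].
    rewrite (Hjump 6 _ _ _ eq_refl), (Hjump 7 _ _ _ eq_refl) by (cbn; lia).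
    unfold step. rewrite (Hi 8 _ eq_refl). reflexivity.
  - exists (18 + (1 + 1 + zlen t + 1)). split; [|lia].
    exists 8. change 8 with (6 + 2). rewrite E. cbn [run].
    unfold step at 1. rewrite (Hi 6 _ eq_refl).
    change (m 1) with t. change (m 0) with 0%Z.
    destruct (Z.ltb_spec 0 t); [|lia]. unfold step. rewrite (Hi 9 _ eq_refl).
    destruct (Z.eqb_spec t 0); [lia|]. reflexivity.
Qed.

Lemma subset_sum_nil t : subset_sum [] t <-> t = 0%Z.
Proof.
  split.
  - intros (mask & Hl & Ht). destruct mask; [|discriminate]. now cbn in Ht.
  - intros ->. exists []. auto.
Qed.

(** The second factor bounds the cost of a step per unit of input size: [2 * c + 8] for the random
    bits, [2 * c] for the constant [c], 2 for the length of [t], and 83 for the rest. *)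
Definition cost_factor (c : nat) : nat := Z.to_nat (kfactor c * (4 * Z.of_nat c + 93)).

Lemma kfactor_ge c : (20000 + 40 * Z.of_nat c <= kfactor c)%Z.
Proof.
  unfold kfactor. pose proof (Z.pow_nonneg 2 (Z.of_nat (c + 6)) ltac:(lia)). lia.
Qed.

Lemma input_size_ge a t :
  length a + 1 <= input_size a t /\ zlen t <= input_size a t.
Proof. unfold input_size. assert (1 <= zlen t) by (unfold zlen; lia). lia. Qed.

(** The exponent 3 comes from the two factors [n + 1] of the cutoff and one for the logarithmic cost
    of a step. *)
Lemma cost_bound c a t cost :
  (Z.of_nat cost <= kfactor c * ((Z.of_nat (length a) + 1) * (Z.of_nat (length a) + 1)
        * 2 ^ Z.of_nat (length a / 4))
      * (2 * Z.of_nat (rlen c (length a) + c + 40 + zlen t) + 3))%Z ->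
  cost <= cost_factor c * input_size a t ^ 3 * 2 ^ (length a / 4).
Proof.
  intro Hc. destruct (input_size_ge a t) as [H1 H2].
  set (q := (length a / 4)%nat) in *. set (n := length a) in *. set (s := input_size a t) in *.
  pose proof (kfactor_ge c) as Hk. set (K := kfactor c) in *.
  apply Nat2Z.inj_le. eapply Z.le_trans; [exact Hc|].
  rewrite !Nat2Z.inj_mul, !Nat2Z.inj_pow. unfold cost_factor. fold K.
  rewrite Z2Nat.id by (apply Z.mul_nonneg_nonneg; lia).
  change (Z.of_nat 2) with 2%Z. change (Z.of_nat 3) with 3%Z.
  set (p := (2 ^ Z.of_nat q)%Z) in *.
  assert (Hp : (0 <= p)%Z) by (apply Z.pow_nonneg; lia).
  assert (Hlin : (2 * Z.of_nat (rlen c n + c + 40 + zlen t) + 3 <=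
    (4 * Z.of_nat c + 93) * Z.of_nat s)%Z).
  { unfold rlen. rewrite !Nat2Z.inj_add, Nat2Z.inj_mul, Nat2Z.inj_add.
    assert (Z.of_nat c * Z.of_nat n <= Z.of_nat c * Z.of_nat s)%Z
      by (apply Z.mul_le_mono_nonneg_l; lia).
    assert (Z.of_nat c * 1 <= Z.of_nat c * Z.of_nat s)%Z
      by (apply Z.mul_le_mono_nonneg_l; lia).
    lia. }
  assert (Hsq : ((Z.of_nat n + 1) * (Z.of_nat n + 1) <= Z.of_nat s * Z.of_nat s)%Z)
    by (apply Z.mul_le_mono_nonneg; lia).
  assert (Hsq' : ((Z.of_nat n + 1) * (Z.of_nat n + 1) * p <= Z.of_nat s * Z.of_nat s * p)%Z)
    by (apply Z.mul_le_mono_nonneg_r; lia).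
  assert (Hpos : (0 <= (Z.of_nat n + 1) * (Z.of_nat n + 1) * p)%Z)
    by (apply Z.mul_nonneg_nonneg; [apply Z.mul_nonneg_nonneg|]; lia).
  replace (K * (4 * Z.of_nat c + 93) * Z.of_nat s ^ 3 * p)%Z
    with (K * (Z.of_nat s * Z.of_nat s * p) * ((4 * Z.of_nat c + 93) * Z.of_nat s))%Z by ring.
  apply Z.mul_le_mono_nonneg; auto; try lia.
  - apply Z.mul_nonneg_nonneg; lia.
  - apply Z.mul_le_mono_nonneg_l; lia.
Qed.

Lemma randomness_bound c n : rlen c n <= cost_factor c * S n ^ 3 * 2 ^ (n / 4).
Proof.
  assert (Hc : c + 4 <= cost_factor c).
  { unfold cost_factor. pose proof (kfactor_ge c). nia. }
  assert (Hp : 1 <= 2 ^ (n / 4)) by (apply Nat.neq_0_lt_0, Nat.pow_nonzero; lia).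
  unfold rlen. apply Nat.le_trans with (cost_factor c * S n ^ 3 * 1); [|now apply Nat.mul_le_mono_l].
  rewrite Nat.mul_1_r. apply Nat.mul_le_mono; auto.
  cbn [Nat.pow]. rewrite Nat.mul_1_r.
  apply Nat.le_trans with (S n * (1 * 1)); [lia|]. apply Nat.mul_le_mono_l, Nat.mul_le_mono; lia.
Qed.

Theorem mainTheorem2 :
  forall c : nat,
  exists (P : program) (r : nat -> nat) (C k : nat),
  forall (a : list Z) (t : Z),
    NoDup a ->
    (forall x, In x a -> (Z.abs x <= 2 ^ Z.of_nat (c * length a))%Z) ->
    r (length a) <= C * (S (length a)) ^ k * 2 ^ (length a / 4) /\
    (forall rho pi : list bool,
       length rho = r (length a) -> length pi <= length a / 4 ->
       exists b cost,
         halts_with P (init_mem (input_cells a t rho pi)) b cost /\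
         cost <= C * (input_size a t) ^ k * 2 ^ (length a / 4)) /\
    (subset_sum a t ->
       exists S : list (list bool),
         NoDup S /\
         (forall rho, In rho S ->
            length rho = r (length a) /\
            exists pi : list bool, length pi <= length a / 4 /\
              exists cost, halts_with P (init_mem (input_cells a t rho pi)) true cost) /\
         3 * length S >= 2 * 2 ^ (r (length a))) /\
    (~ subset_sum a t ->
       forall rho pi : list bool,
         length rho = r (length a) -> length pi <= length a / 4 ->
         forall cost, ~ halts_with P (init_mem (input_cells a t rho pi)) true cost).
Proof.
  intro c. exists (verifier c), (rlen c), (cost_factor c), 3. intros a t Hnd Ha.
  split; [apply randomness_bound|].
  destruct (Nat.eq_dec (length a) 0) as [Hn | Hn].
  - apply length_zero_iff_nil in Hn. subst a.
    destruct (empty_run (verifier c) t (proj1 (verifier_code c))) as (cost & Hrun & Hcost).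
    assert (Hr : rlen c 0 = 0) by (unfold rlen; lia). cbn [length] in *. rewrite Hr.
    split; [|split].
    + intros [|] [|] Hrho Hpi; try discriminate; try (cbn in Hpi; lia).
      exists (t =? 0)%Z, cost. split; auto. eapply Nat.le_trans; [exact Hcost|].
      destruct (input_size_ge [] t) as [_ Hs].
      assert (Hc : 30 <= cost_factor c).
      { unfold cost_factor. pose proof (kfactor_ge c). nia. }
      change (2 ^ (0 / 4)) with 1. rewrite Nat.mul_1_r. apply Nat.mul_le_mono; auto.
      eapply Nat.le_trans; [exact Hs|]. set (s := input_size [] t) in *.
      assert (1 <= s) by (unfold s, input_size, zlen; lia).
      cbn [Nat.pow]. rewrite Nat.mul_1_r.
      apply Nat.le_trans with (s * (1 * 1)); [lia|]. apply Nat.mul_le_mono_l, Nat.mul_le_mono; lia.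
    (* For [n = 0] there is a single random string, the empty one, and it is good. *)
    + intro Hs. apply subset_sum_nil in Hs. subst t. exists [[]].
      split; [repeat constructor; intros []|]. split; [|simpl; lia].
      intros rho [<- | []]. split; auto. exists []. split; [simpl; lia|]. exists cost. exact Hrun.
    + intros Hs [|] [|] Hrho Hpi cost' Hh; try discriminate; try (cbn in Hpi; lia).
      pose proof (halts_with_deterministic _ _ _ _ _ _ Hrun Hh) as Et.
      apply Z.eqb_eq in Et. apply Hs, subset_sum_nil, Et.
  - assert (Hpos : 0 < length a) by lia.
    split; [|split].
    + intros rho pi Hrho Hpi.
      destruct (verifier_run c a t rho pi Hpos Hnd Ha Hrho Hpi) as (b & cost & Hh & Hc & _).
      exists b, cost. split; auto. now apply cost_bound.
    + intro Hs. destruct (protocol_complete c a t Hpos Ha Hs) as (S & HS & Hgood & Hcard).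
      exists S. split; auto. split; [|lia]. intros rho Hin.
      destruct (Hgood rho Hin) as (Hrho & pi & Hpi & Hacc). split; auto.
      exists pi. split; [lia|].
      destruct (verifier_run c a t rho pi Hpos Hnd Ha Hrho ltac:(lia)) as (b & cost & Hh & _ & _ & Hb).
      exists cost. destruct b; auto. exfalso. now apply (Hb eq_refl).
    + intros Hs rho pi Hrho Hpi cost Hh.
      destruct (verifier_run c a t rho pi Hpos Hnd Ha Hrho Hpi) as (b & cost' & Hh' & _ & Hb & _).
      pose proof (halts_with_deterministic _ _ _ _ _ _ Hh Hh') as <-. auto.
Qed.
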